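(* Let $X$ be a separable Banach space that has a symmetric sequence space $\mathbb{S}$ as a complemented subspace. Suppose also that $(\Lambda_m[\mathbb{S}])_{m=1}^\infty$ has the lower regularity property (LRP). Then $X$ has a squeeze-symmetric basis $\mathcal{B}$ (bidemocratic if $(\Lambda_m[\mathbb{S}])_{m=1}^\infty$ has additionally the upper regularity property (URP)) with $$\tilde{k}_m[\mathcal{B},X]\approx \log(1+m)\quad\text{and}\quad \varphi_u[\mathcal{B},X](m)\approx \Lambda_m[\mathbb{S}],\qquad m\in\mathbb{N}.$$ Moreover, we can choose $\mathcal{B}$ to be non quasi-greedy.
   Context: Spaces are over $\mathbb{F}\in\{\mathbb{R},\mathbb{C}\}$ and infinite-dimensional; $\mathbb{E}=\{\lambda\in\mathbb{F}:|\lambda|=1\}$. For positive quantities, $\alpha_m\lesssim\beta_m$ means $\alpha_m\le C\beta_m$ for a constant $C$ independent of $m$; $\approx$ means both $\lesssim$ and $\gtrsim$. A basis of a (quasi-)Banach space $X$ is a sequence $\mathcal{X}=(x_n)_{n=1}^\infty$ with closed linear span $X$ for which there is a (unique) sequence $\mathcal{X}^*=(x_n^* )_{n=1}^\infty$ in $X^*$ with $x_n^*(x_k)=\delta_{k,n}$; it need not be a Schauder basis. $\mathcal{X}^*$ is the dual basis. For finite $A\subseteq\mathbb{N}$, $S_A(f)=\sum_{n\in A}x_n^*(f)\,x_n$. Put $$\tilde{k}_m[\mathcal{X},X]=\sup\{\|S_A(f)\|: \|f\|\le 1,\ f\in[x_j:1\le j\le m],\ A\subseteq\mathbb{N}\},$$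 where $[\,\cdot\,]$ denotes closed linear span, and $$\varphi_u[\mathcal{X},X](m)=\sup\Big\{\Big\|\sum_{n\in A}x_n\Big\|:|A|\le m\Big\}.$$ A sequence space is a quasi-Banach space $Y$ with $c_{00}\subseteq Y\subseteq\mathbb{F}^{\mathbb{N}}$ in which $c_{00}$ is dense and whose unit vector system $(e_n)$ is a basis with the usual coordinate functionals. It is symmetric if $\|\sum_n\varepsilon_n a_n e_{\pi(n)}\|=\|\sum_n a_ne_n\|$ for all $(a_n)\in c_{00}$, all $(\varepsilon_n)\in\mathbb{E}^{\mathbb{N}}$ and all bijections $\pi$ of $\mathbb{N}$. Its fundamental function is $\Lambda_m[\mathbb{S}]=\|\sum_{n\in A}e_n\|_{\mathbb{S}}$, for any $A$ with $|A|=m$. ''$X$ has $\mathbb{S}$ as a complemented subspace'' means that $\mathbb{S}$ is isomorphic to a complemented subspace of $X$. A positive sequence $(\Gamma_m)$ has the LRP if there is a positive integer $b$ with $2\Gamma_m\le\Gamma_{bm}$ for all $m$; it has the URP if there is a positive integer $b$ with $2\Gamma_{bm}\le b\Gamma_m$ for all $m$. A basis $\mathcal{X}$ of $X$ is squeeze-symmetric if there are symmetric sequence spaces $\mathbb{S}_1,\mathbb{S}_2$ such that $(a_n)\mapsto\sum_n a_nx_n$ is a bounded operator from $\mathbb{S}_1$ into $X$, $f\mapsto(x_n^*(f))_n$ is a bounded operator from $X$ into $\mathbb{S}_2$, and $\Lambda_m[\mathbb{S}_1]\approx\Lambda_m[\mathbb{S}_2]$. It is bidemocratic if $\sup_m \frac1m\varphi_u[\mathcal{X},X](m)\,\varphi_u[\mathcal{X}^*,X^*](m)<\infty$.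 A finite set $A\subseteq\mathbb{N}$ is a greedy set of $f$ if $|x_n^*(f)|\ge|x_k^*(f)|$ whenever $n\in A$, $k\notin A$. A basis is quasi-greedy if there is a constant $C$ with $\|S_A(f)\|\le C\|f\|$ for all $f\in X$ and all greedy sets $A$ of $f$. *)

(* Defs.v *)
From HB Require Import structures.
From mathcomp Require Import all_boot all_order all_algebra.
From mathcomp Require Import finmap.
From mathcomp Require Import all_classical all_reals all_analysis.
From mathcomp Require Import complex.

Set Implicit Arguments.
Unset Strict Implicit.
Unset Printing Implicit Defensive.

Import Order.TTheory GRing.Theory Num.Theory.
Import numFieldNormedType.Exports.

Local Open Scope classical_set_scope.
Local Open Scope ring_scope.

(** Throughout, sequences are indexed from 0, so that the index n of the
    mathematics is the index n - 1 here. Quantities depending on a size m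
    (fundamental functions etc.) keep their argument; only m >= 1 matters. *)

Inductive scalar_kind := real_scalars | complex_scalars.

Definition scalar_field (R : realType) (k : scalar_kind) : numFieldType :=
  match k with
  | real_scalars => R
  | complex_scalars => R[i]
  end.

(** Norms of a normed space over [scalar_field R k] are values of that field;
    they lie on the real line, and [to_real] reads them as elements of R. *)
Definition to_real (R : realType) (k : scalar_kind) : scalar_field R k -> R :=
  match k return scalar_field R k -> R with
  | real_scalars => fun a => a
  | complex_scalars => fun a => complex.Re a
  end.

Definition rnorm (R : realType) (k : scalar_kind)
    (X : normedModType (scalar_field R k)) (f : X) : R :=
  to_real `|f|.

Definition lesssim (R : realType) (u v : nat -> \bar R) : Prop :=
  exists2 C : R, 0 < C & forall m, (0 < m)%N -> (u m <= C%:E * v m)%E.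

Definition equivalent (R : realType) (u v : nat -> \bar R) : Prop :=
  lesssim u v /\ lesssim v u.

Definition LRP (R : realType) (G : nat -> R) : Prop :=
  exists2 b : nat, (0 < b)%N &
    forall m, (0 < m)%N -> 2 * G m <= G (b * m)%N.

Definition URP (R : realType) (G : nat -> R) : Prop :=
  exists2 b : nat, (0 < b)%N &
    forall m, (0 < m)%N -> 2 * G (b * m)%N <= b%:R * G m.

Definition separable (T : topologicalType) : Prop :=
  exists2 D : set T, countable D & dense D.

Section SequenceSpaces.
Context (R : realType) (k : scalar_kind).
Local Notation K := (scalar_field R k).

Definition unit_vec (n : nat) : nat -> K^o := fun j => (j == n)%:R.

Definition c00 : set (nat -> K^o) :=
  [set f | exists N : nat, forall n, (N <= n)%N -> f n = 0].

(** [ss_norm] is only meaningful on [ss_carrier]. *)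
Record sequence_space := SequenceSpace {
  ss_carrier : set (nat -> K^o);
  ss_norm : (nat -> K^o) -> R;
  ss_linear : forall (a : K) f g, ss_carrier f -> ss_carrier g ->
    ss_carrier (a *: f + g);
  ss_norm_ge0 : forall f, ss_carrier f -> 0 <= ss_norm f;
  ss_norm_eq0 : forall f, ss_carrier f -> (ss_norm f = 0 <-> f = 0);
  ss_normZ : forall (a : K) f, ss_carrier f ->
    ss_norm (a *: f) = to_real `|a| * ss_norm f;
  ss_quasi_triangle : exists kappa : R, forall f g,
    ss_carrier f -> ss_carrier g ->
    ss_norm (f + g) <= kappa * (ss_norm f + ss_norm g);
  ss_complete : forall u : nat -> nat -> K^o, (forall n, ss_carrier (u n)) ->
    (forall e : R, 0 < e -> exists N, forall i j, (N <= i)%N -> (N <= j)%N ->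
       ss_norm (u i - u j) <= e) ->
    exists2 l, ss_carrier l &
      forall e : R, 0 < e -> exists N, forall i, (N <= i)%N ->
        ss_norm (u i - l) <= e;
  ss_c00 : c00 `<=` ss_carrier;
  ss_c00_dense : forall f (e : R), ss_carrier f -> 0 < e ->
    exists2 g, c00 g & ss_norm (f - g) <= e;
  ss_coord_bounded : forall n, exists C : R, forall f, ss_carrier f ->
    to_real `|f n| <= C * ss_norm f
}.

Definition symmetric_space (S : sequence_space) : Prop :=
  forall (N : nat) (a eps : nat -> K) (s : nat -> nat),
    (forall n, `|eps n| = 1) -> bijective s ->
    ss_norm S (\sum_(n < N) (eps n * a n) *: unit_vec (s n)) =
    ss_norm S (\sum_(n < N) a n *: unit_vec n).

(** In a symmetric space any index set of cardinality m gives the same value;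
    the set {0, ..., m - 1} is used. *)
Definition fundamental (S : sequence_space) (m : nat) : R :=
  ss_norm S (\sum_(n < m) unit_vec n).

End SequenceSpaces.

Section Bases.
Context (R : realType) (k : scalar_kind).
Local Notation K := (scalar_field R k).

(** S is isomorphic, via T, to the range of a bounded projection P of X. *)
Definition complemented_subspace (S : sequence_space R k)
    (X : normedModType K) : Prop :=
  exists (T : (nat -> K^o) -> X) (P : {linear X -> X}),
    [/\ forall (a : K) f g, ss_carrier S f -> ss_carrier S g ->
          T (a *: f + g) = a *: T f + T g,
        exists c C : R, [/\ 0 < c, 0 < C &
          forall f, ss_carrier S f ->
            c * ss_norm S f <= rnorm (T f) <= C * ss_norm S f],
        continuous P,
        forall f, P (P f) = P f &
        range P = T @` ss_carrier S].

Variable X : normedModType K.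

Definition closed_span (x : nat -> X) (I : set nat) : set X :=
  closure [set f | exists (A : {fset nat}) (a : nat -> K),
    [set` A] `<=` I /\ f = \sum_(n <- A) a n *: x n].

Record biorth_basis := BiorthBasis {
  bvec : nat -> X;
  bcoord : nat -> {linear X -> K^o};
  bcoord_continuous : forall n, continuous (bcoord n);
  bcoord_biorthogonal : forall n j, bcoord n (bvec j) = (j == n)%:R;
  bvec_total : closed_span bvec setT = setT
}.

(** For infinite A the sum ranges over the coordinates n in A not annihilating
    f, provided that there are finitely many of them. *)
Definition coord_proj (B : biorth_basis) (A : set nat) (f : X) : X :=
  \sum_(n \in A) bcoord B n f *: bvec B n.

Definition uncond_parameter (B : biorth_basis) (m : nat) : \bar R :=
  ereal_sup [set r : \bar R | exists (f : X) (A : set nat),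
    [/\ rnorm f <= 1, closed_span (bvec B) `I_m f &
        r = (rnorm (coord_proj B A f))%:E]].

Definition dual_norm (g : X -> K^o) : \bar R :=
  ereal_sup [set (to_real `|g f|)%:E | f in [set f : X | rnorm f <= 1]].

Definition upper_democracy (V : zmodType) (nrm : V -> \bar R)
    (x : nat -> V) (m : nat) : \bar R :=
  ereal_sup [set nrm (\sum_(n <- A) x n) | A in
    [set A : {fset nat} | (#|` A| <= m)%N]].

Definition phi_u (B : biorth_basis) : nat -> \bar R :=
  upper_democracy (fun f : X => (rnorm f)%:E) (bvec B).

Definition phi_u_dual (B : biorth_basis) : nat -> \bar R :=
  upper_democracy dual_norm (fun n => bcoord B n : X -> K^o).

Definition squeeze_symmetric (B : biorth_basis) : Prop :=
  exists S1 S2 : sequence_space R k,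
    [/\ symmetric_space S1, symmetric_space S2,
        exists C : R, forall a, ss_carrier S1 a ->
          cvgn (series (fun n => a n *: bvec B n)) /\
          rnorm (limn (series (fun n => a n *: bvec B n))) <= C * ss_norm S1 a,
        exists C : R, forall f : X,
          ss_carrier S2 (fun n => bcoord B n f) /\
          ss_norm S2 (fun n => bcoord B n f) <= C * rnorm f &
        equivalent (fun m => (fundamental S1 m)%:E)
                   (fun m => (fundamental S2 m)%:E)].

Definition bidemocratic (B : biorth_basis) : Prop :=
  (ereal_sup [set (m%:R^-1)%:E * (phi_u B m * phi_u_dual B m) | m in
    [set m : nat | (0 < m)%N]] < +oo)%E.

Definition greedy_set (B : biorth_basis) (f : X) (A : {fset nat}) : Prop :=
  forall n j, n \in A -> j \notin A -> `|bcoord B j f| <= `|bcoord B n f|.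

Definition quasi_greedy (B : biorth_basis) : Prop :=
  exists C : R, forall (f : X) (A : {fset nat}), greedy_set B f A ->
    rnorm (coord_proj B [set` A] f) <= C * rnorm f.

End Bases.

(* Main.v *)
Require Import Defs.
From HB Require Import structures.
From mathcomp Require Import all_boot all_order all_algebra.
From mathcomp Require Import finmap.
From mathcomp Require Import all_classical all_reals all_analysis.
From mathcomp Require Import complex.
From mathcomp Require Import zify ring lra.

Set Implicit Arguments.
Unset Strict Implicit.
Unset Printing Implicit Defensive.

Import Order.TTheory GRing.Theory Num.Theory.
Import numFieldNormedType.Exports.

Local Open Scope classical_set_scope.
Local Open Scope ring_scope.

(** Why the theorem is true. Let [Phi] be a function equivalent to the
    fundamental function of S, nondecreasing and with [Phi m / m] nonincreasing.
    Suppose that signed sums of m vectors of a basis have norm at most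
    C [Phi m], and that a vector f with m coordinates of modulus at least t has
    norm at least t [Phi m] / C. Such a basis lies between the Lorentz space and
    the weak Lorentz space of [Phi], whose fundamental functions are equivalent
    to [Phi] by the lower regularity; so it is squeeze-symmetric. Abel summation
    against the decreasing rearrangement of the coordinates bounds a projection
    of a vector supported on m coordinates by the sum over i <= m of
    ([Phi i] / i) (1 / [Phi i]), that is by log m. Upper regularity makes the
    sum of 1 / [Phi i] over i <= m comparable to m / [Phi m], which is
    bidemocracy. These are the lemmas whose names start with sandwich.

    The construction of such a basis is that of Dilworth, Kalton and Kutzarova.
    Cut the integers into consecutive blocks of sizes 2^j, and let (e_n) be the
    copy in X of the unit vectors of S. Let (y_j) be a bounded biorthogonal system
    independent of the vectors e_n - (average of e over the block of n), and
    spanning X together with them. Put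
      x_n = e_n - (average of e over the block of n) + ([Phi(2^j)] / 2^j) y_j
    for n in the block j. The terms added to e_n are of the size of
    [Phi n] / n, so that by the lower regularity they do not spoil the upper
    estimate ([dkk_democracy]), and a large coordinate coming from them bounds
    its own index, which gives the lower estimate ([dkk_weak]). The sum over the
    block j of the x_n is [Phi(2^j)] y_j: the y_j can be arbitrarily conditional,
    and the span of x_1, ..., x_m contains about log m of them. If the signed sum
    of 2^l of these y_j, first + and then -, is bounded while the sum of
    the first half has norm of order 2^l, both the lower bound log m and the
    failure of the quasi-greedy property follow ([dkk_conditional]), since the
    coordinates of the signed sum are nonincreasing in modulus.

    Vectors y_j of this kind arise from 2^l vectors of the symmetric family by
    stretching the indicator and shrinking the vector of signs
    ([conditional_system]). They are completed to a system spanning the rest of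
    X, namely the block averages and the kernel of the projection onto S. There,
    Gram-Schmidt and the Hahn-Banach theorem give biorthogonal functionals
    without any control of their norms; each vector is made bounded by spreading
    it over N vectors of the symmetric family, N being larger than the norm of
    its functional ([exchange_system]). To have room for all this, the family
    (e_n) is split into three.

    The function [Phi] is the upper super-democracy function of (e_n)
    ([superdem]), and the dual estimate of the sums of coordinates comes from
    averaging over the rotations of a finite set ([coord_sum_c00]). *)

(** * Moduli and norms read as real numbers *)

Section Scalars.
Context {R : realType} {k : scalar_kind}.
Local Notation K := (scalar_field R k).

(** The embedding of the real line into the scalars. Norms are compared in R,
    where the order is total, by means of [rabs] and [rnorm]. *)
Definition emb : R -> K :=
  match k return R -> scalar_field R k with
  | real_scalars => fun a => a
  | complex_scalars => fun a => a%:C%C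
  end.

Lemma emb_is_zmod_morphism : zmod_morphism emb.
Proof. by rewrite /emb; case: k => //= a b; rewrite rmorphB. Qed.

Lemma emb_is_monoid_morphism : monoid_morphism emb.
Proof. by rewrite /emb; case: k => //=; split=> // a b; rewrite rmorphM. Qed.

HB.instance Definition _ :=
  GRing.isZmodMorphism.Build R K emb emb_is_zmod_morphism.
HB.instance Definition _ :=
  GRing.isMonoidMorphism.Build R K emb emb_is_monoid_morphism.

Lemma embK a : to_real (emb a) = a.
Proof. by rewrite /emb /to_real; case: k. Qed.

Lemma to_realK (a : K) : 0 <= a -> emb (to_real a) = a.
Proof.
rewrite /emb /to_real; case: k a => //= -[x y].
by rewrite lecE /= => /andP[/eqP ->].
Qed.

Lemma ler_emb a b : (emb a <= emb b) = (a <= b).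
Proof. by rewrite /emb; case: k => //=; rewrite lecR. Qed.

Lemma ltr_emb a b : (emb a < emb b) = (a < b).
Proof. by rewrite /emb; case: k => //=; rewrite ltcR. Qed.

Lemma to_real_gt0 (a : K) : 0 < a -> 0 < to_real a.
Proof. by move=> a0; rewrite -ltr_emb to_realK ?ltW // rmorph0. Qed.

Lemma norm_emb a : `|emb a| = emb `|a|.
Proof. by rewrite /emb; case: k => //=; rewrite normc_def /= expr0n/= addr0 sqrtr_sqr. Qed.

Definition rabs (a : K) : R := to_real `|a|.

Lemma emb_rabs a : emb (rabs a) = `|a|.
Proof. exact/to_realK/normr_ge0. Qed.

Lemma emb_inj : injective (emb : R -> K).
Proof. by move=> a b /(congr1 (@to_real R k)); rewrite !embK. Qed.

Lemma rabs_ge0 a : 0 <= rabs a.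
Proof. by rewrite -ler_emb emb_rabs rmorph0. Qed.

Lemma rabsM a b : rabs (a * b) = rabs a * rabs b.
Proof. by apply: emb_inj; rewrite rmorphM /= !emb_rabs normrM. Qed.

Lemma rabsD a b : rabs (a + b) <= rabs a + rabs b.
Proof. by rewrite -ler_emb rmorphD /= !emb_rabs ler_normD. Qed.

Lemma rabsN a : rabs (- a) = rabs a.
Proof. by rewrite /rabs normrN. Qed.

Lemma rabs0 : rabs 0 = 0.
Proof. by apply: emb_inj; rewrite emb_rabs normr0 rmorph0. Qed.

Lemma rabs1 : rabs 1 = 1.
Proof. by apply: emb_inj; rewrite emb_rabs normr1 rmorph1. Qed.

Lemma rabs_emb r : rabs (emb r) = `|r|.
Proof. by apply: emb_inj; rewrite emb_rabs norm_emb. Qed.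

Lemma rabs_eq0 a : rabs a = 0 -> a = 0.
Proof. by move=> a0; apply/eqP; rewrite -normr_eq0 -emb_rabs a0 rmorph0. Qed.

Lemma rabs_eq1 a : (rabs a = 1) <-> (`|a| = 1).
Proof.
rewrite -emb_rabs; split=> [->|h]; first by rewrite rmorph1.
by apply: emb_inj; rewrite h rmorph1.
Qed.

Lemma rabs_le a b : (rabs a <= rabs b) = (`|a| <= `|b|).
Proof. by rewrite -ler_emb !emb_rabs. Qed.

Lemma rabs_sum (I : Type) (s : seq I) (P : pred I) (F : I -> K) :
  rabs (\sum_(i <- s | P i) F i) <= \sum_(i <- s | P i) rabs (F i).
Proof.
elim/big_ind2: _ => [|x1 x2 y1 y2 h1 h2|//]; first by rewrite rabs0.
exact: le_trans (rabsD _ _) (lerD h1 h2).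
Qed.

(** Polar decomposition; the phase of 0 is taken to be 1. *)
Definition phase (a : K) : K := if a == 0 then 1 else a / `|a|.

Lemma rabs_phase a : rabs (phase a) = 1.
Proof.
apply/rabs_eq1; rewrite /phase; case: eqVneq => [_|a0]; first exact: normr1.
by rewrite normf_div normr_id divff // normr_eq0.
Qed.

Lemma phase_neq0 a : phase a != 0.
Proof. by rewrite -normr_eq0 (rabs_eq1 _).1 ?oner_eq0 // rabs_phase. Qed.

Lemma phaseE a : a = emb (rabs a) * phase a.
Proof.
rewrite emb_rabs /phase; case: eqVneq => [->|a0]; first by rewrite normr0 mul0r.
by rewrite mulrCA divff ?mulr1 // normr_eq0.
Qed.

Lemma rabsV a : rabs a^-1 = (rabs a)^-1.
Proof. by apply: emb_inj; rewrite fmorphV /= !emb_rabs normfV. Qed.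

Lemma phaseVE a : (phase a)^-1 * a = emb (rabs a).
Proof. by rewrite {2}(phaseE a) mulrCA mulVf ?mulr1 // phase_neq0. Qed.

Section Normed.
Context {X : normedModType K}.
Implicit Types x y : X.

Lemma emb_rnorm x : emb (rnorm x) = `|x|.
Proof. exact/to_realK/normr_ge0. Qed.

Lemma rnorm_ge0 x : 0 <= rnorm x.
Proof. by rewrite -ler_emb emb_rnorm rmorph0. Qed.

Lemma rnormZ a x : rnorm (a *: x) = rabs a * rnorm x.
Proof. by apply: emb_inj; rewrite rmorphM /= !emb_rnorm emb_rabs normrZ. Qed.

Lemma rnormD x y : rnorm (x + y) <= rnorm x + rnorm y.
Proof. by rewrite -ler_emb rmorphD /= !emb_rnorm ler_normD. Qed.

Lemma rnormN x : rnorm (- x) = rnorm x.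
Proof. by rewrite /rnorm normrN. Qed.

Lemma rnormB x y : rnorm (x - y) <= rnorm x + rnorm y.
Proof. by rewrite (le_trans (rnormD _ _)) // rnormN. Qed.

Lemma rnormBC x y : rnorm (x - y) = rnorm (y - x).
Proof. by rewrite /rnorm distrC. Qed.

Lemma rnorm0 : rnorm (0 : X) = 0.
Proof. by apply: emb_inj; rewrite emb_rnorm normr0 rmorph0. Qed.

Lemma rnorm_eq0 x : rnorm x = 0 -> x = 0.
Proof. by move=> x0; apply/eqP; rewrite -normr_eq0 -emb_rnorm x0 rmorph0. Qed.

Lemma rnorm_gt0 x : x != 0 -> 0 < rnorm x.
Proof.
by move=> x0; rewrite lt_def rnorm_ge0 andbT; apply: contra_neq x0 => /rnorm_eq0.
Qed.

Lemma rnorm_sum (I : Type) (s : seq I) (P : pred I) (F : I -> X) :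
  rnorm (\sum_(i <- s | P i) F i) <= \sum_(i <- s | P i) rnorm (F i).
Proof.
elim/big_ind2: _ => [|x1 x2 y1 y2 h1 h2|//]; first by rewrite rnorm0.
exact: le_trans (rnormD _ _) (lerD h1 h2).
Qed.

Lemma closure_rnormP (A : set X) x :
  closure A x <-> forall e : R, 0 < e -> exists2 y, A y & rnorm (x - y) < e.
Proof.
split=> [Ax e e0|Ax U].
  have /Ax [y [Ay]] : nbhs x (ball x (emb e)).
    by apply: nbhsx_ballx; rewrite -(rmorph0 (emb : R -> K)) ltr_emb.
  by rewrite -ball_normE /= -emb_rnorm ltr_emb; exists y.
rewrite -nbhs_ballE => -[e /= e0 eU].
have [y Ay xy] := Ax _ (to_real_gt0 e0).
exists y; split=> //; apply: eU; rewrite -ball_normE /=.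
by rewrite -emb_rnorm -(to_realK (ltW e0)) ltr_emb.
Qed.

Lemma cvg_rnormP (u : nat -> X) x :
  (u n @[n --> \oo] --> x) <-> (forall e : R, 0 < e ->
    exists N, forall n, (N <= n)%N -> rnorm (x - u n) <= e).
Proof.
split=> [/cvgrPdist_le ux e e0|ux].
  have /ux [N _ NP] : 0 < emb e by rewrite -(rmorph0 (emb : R -> K)) ltr_emb.
  by exists N => n /NP /=; rewrite -emb_rnorm ler_emb.
apply/cvgrPdist_le => e e0.
have [N NP] := ux _ (to_real_gt0 e0).
by exists N => // n /NP; rewrite -ler_emb emb_rnorm (to_realK (ltW e0)).
Qed.

End Normed.

Lemma cauchy_rnorm_cvg (X : completeNormedModType K) (u : nat -> X) :
  (forall e : R, 0 < e -> exists N, forall i j, (N <= i)%N -> (N <= j)%N ->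
     rnorm (u i - u j) <= e) ->
  cvgn u.
Proof.
move=> uC; apply/cauchy_cvgP/cauchy_ballP => e e0.
have [|N NP] := uC (to_real e / 2); first by rewrite divr_gt0 // to_real_gt0.
exists (u @` [set n | (N <= n)%N], u @` [set n | (N <= n)%N]) => /=.
  by split; exists N => // n Nn; exists n.
move=> [_ _] /= [[i Ni <-] [j Nj <-]]; rewrite -ball_normE /= -emb_rnorm.
rewrite -(to_realK (ltW e0)) ltr_emb.
have := to_real_gt0 e0; have := NP _ _ Ni Nj; lra.
Qed.

End Scalars.

(** * Quasi-concave functions and their Hardy sums *)

Section QuasiConcave.
Context {R : realType}.
Implicit Types Phi : nat -> R.

(** The regularity shared by the fundamental functions of symmetric norms, up to
    equivalence. *)
Definition quasiconcave Phi : Prop :=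
  [/\ Phi 0%N = 0,
      forall m, (0 < m)%N -> 0 < Phi m,
      forall m n, (m <= n)%N -> Phi m <= Phi n &
      forall m n, (0 < m <= n)%N -> Phi n / n%:R <= Phi m / m%:R].

Definition weight Phi (i : nat) : R := Phi i.+1 / i.+1%:R.

Lemma qc_ge0 Phi m : quasiconcave Phi -> 0 <= Phi m.
Proof. by move=> [<- _ mono _]; exact: mono. Qed.

Lemma weight_ge0 Phi i : quasiconcave Phi -> 0 <= weight Phi i.
Proof. by move=> qc; rewrite divr_ge0 // qc_ge0. Qed.

Lemma weight_anti Phi i j : quasiconcave Phi -> (i <= j)%N ->
  weight Phi j <= weight Phi i.
Proof. by move=> [_ _ _ dec] ij; apply: dec; rewrite ltnS. Qed.

Lemma qc_subadd Phi m n : quasiconcave Phi -> Phi (m + n)%N <= Phi m + Phi n.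
Proof.
move=> [Phi0 pos mono dec].
have [->|m0] := posnP m; first by rewrite Phi0 add0r.
have [->|n0] := posnP n; first by rewrite Phi0 addn0 addr0.
have hm := dec m (m + n)%N; have hn := dec n (m + n)%N.
rewrite m0 leq_addr in hm; rewrite n0 leq_addl in hn.
have {}hm := hm isT; have {}hn := hn isT.
have mR : 0 < m%:R :> R by rewrite ltr0n.
have nR : 0 < n%:R :> R by rewrite ltr0n.
have -> : Phi (m + n)%N = Phi (m + n)%N / (m + n)%:R * m%:R +
                          Phi (m + n)%N / (m + n)%:R * n%:R.
  by rewrite -mulrDr -natrD divfK // pnatr_eq0 -lt0n addn_gt0 m0.
by rewrite lerD // -ler_pdivlMr.
Qed.

Lemma qc_mull Phi b m : quasiconcave Phi -> Phi (b * m)%N <= b%:R * Phi m.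
Proof.
move=> qc; elim: b => [|b IH]; first by rewrite mul0n mul0r; case: qc => ->.
by rewrite mulSn -natr1 mulrDl mul1r addrC (le_trans (qc_subadd _ _ qc)) // lerD2l.
Qed.

(** The increment [Phi (m + 1) - Phi m] is at most the weight at m, because
    [Phi m / m] is nonincreasing. *)
Lemma qc_le_sum_weight Phi m : quasiconcave Phi ->
  Phi m <= \sum_(i < m) weight Phi i.
Proof.
move=> qc; have [Phi0 pos mono dec] := qc.
elim: m => [|m IH]; first by rewrite big_ord0 Phi0.
rewrite big_ord_recr /=; case: m IH => [|m] IH.
  by rewrite big_ord0 add0r /weight divr1.
apply: le_trans (lerD IH (lexx _)).
rewrite -lerBlDr.
have h := dec m.+1 m.+2 (leqnSn _).
rewrite ler_pdivlMr ?ltr0n // in h.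
rewrite /weight; apply: le_trans h.
rewrite -[X in X - _](divfK (_ : m.+2%:R != 0)) ?pnatr_eq0 //.
by rewrite -[X in _ - X]mulr1 -mulrBr -natr1 addrK.
Qed.

(** Lower regularity makes the discrete Hardy sum comparable to its last
    term: dividing m by b at least halves [Phi], while each of the remaining weights is
    at most [Phi m] over (m %/ b) + 1. *)
Lemma hardy_sum Phi b : quasiconcave Phi -> (0 < b)%N ->
  (forall m, (0 < m)%N -> 2 * Phi m <= Phi (b * m)%N) ->
  forall m, \sum_(0 <= i < m) weight Phi i <= 2 * b%:R * Phi m.
Proof.
move=> qc b0 lrp; have [Phi0 pos mono dec] := qc.
have b1 : (1 < b)%N.
  rewrite ltn_neqAle b0 andbT; apply/eqP => b1.
  by have := lrp 1%N isT; rewrite -b1; have := pos 1%N isT; lra.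
elim/ltn_ind => m IH.
have [->|m0] := posnP m; first by rewrite big_geq // Phi0 mulr0.
have qm : (m %/ b < m)%N by rewrite ltn_Pdiv.
rewrite (big_cat_nat (leq0n _) (ltnW qm)) /=.
have h1 : \sum_(0 <= i < m %/ b) weight Phi i <= b%:R * Phi m.
  apply: le_trans (IH _ qm) _.
  have [->|q0] := posnP (m %/ b)%N.
    by rewrite Phi0 mulr0 mulr_ge0 // qc_ge0.
  rewrite -mulrA mulrCA ler_wpM2l //.
  by apply: le_trans (lrp _ q0) (mono _ _ _); rewrite mulnC leq_trunc_div.
have h2 : \sum_(m %/ b <= i < m) weight Phi i <= b%:R * Phi m.
  apply: (@le_trans _ _ (\sum_(m %/ b <= i < m) (Phi m / (m %/ b).+1%:R))).
    rewrite big_nat_cond [leRHS]big_nat_cond; apply: ler_sum => i.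
    rewrite andbT => /andP[qi im].
    rewrite /weight ler_pM ?qc_ge0 ?invr_ge0 ?mono //.
    by rewrite lef_pV2 ?posrE ?ltr0n // ler_nat ltnS.
  rewrite sumr_const_nat -[X in X <= _]mulr_natl mulrCA [leRHS]mulrC.
  rewrite ler_wpM2l ?qc_ge0 // ler_pdivrMr ?ltr0n // -natrM ler_nat.
  have h := ltn_ceil m b0; rewrite leq_subLR mulnC (leq_trans (ltnW h)) //.
  exact: leq_addl.
by apply: le_trans (lerD h1 h2) _; lra.
Qed.

Lemma qc_dual Phi : quasiconcave Phi -> quasiconcave (fun m => m%:R / Phi m).
Proof.
move=> qc; have [Phi0 pos mono dec] := qc.
split=> [|m m0|m n mn|m n /andP[m0 mn]]; first by rewrite mul0r.
- by rewrite divr_gt0 ?ltr0n ?pos.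
- have [->|m0] := posnP m; first by rewrite mul0r divr_ge0 // qc_ge0.
  have n0 := leq_trans m0 mn.
  have := dec m n; rewrite m0 mn => /(_ isT).
  by rewrite ler_pdivrMr ?ltr0n // mulrAC ler_pdivlMr ?ltr0n // => h;
    rewrite ler_pdivrMr ?pos // mulrAC ler_pdivlMr ?pos // mulrC [leRHS]mulrC.
- have n0 := leq_trans m0 mn.
  rewrite mulrAC divff ?pnatr_eq0 -?lt0n // mul1r.
  rewrite mulrAC divff ?pnatr_eq0 -?lt0n // mul1r.
  by rewrite lef_pV2 ?posrE ?pos // mono.
Qed.

Lemma weight_dual Phi i : weight (fun m => m%:R / Phi m) i = (Phi i.+1)^-1.
Proof. by rewrite /weight mulrAC divff ?pnatr_eq0 // mul1r. Qed.

(** The upper regularity of [Phi] is the lower regularity of its dual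
    function m / [Phi] m. *)
Lemma hardy_sum_dual Phi b : quasiconcave Phi -> (0 < b)%N ->
  (forall m, (0 < m)%N -> 2 * Phi (b * m)%N <= b%:R * Phi m) ->
  forall m, \sum_(0 <= i < m) (Phi i.+1)^-1 <= 2 * b%:R * (m%:R / Phi m).
Proof.
move=> qc b0 urp m; have [Phi0 pos _ _] := qc.
under eq_bigr do rewrite -weight_dual.
apply: (@hardy_sum _ b (qc_dual qc)) => // {}m m0.
have bm0 : (0 < b * m)%N by rewrite muln_gt0 b0.
rewrite mulrA ler_pdivrMr ?pos // mulrAC ler_pdivlMr ?pos // natrM.
have := ler_wpM2l (ler0n R m) (urp m m0); lra.
Qed.

Lemma ler_sum_uniq (I : eqType) (f : I -> R) (s t : seq I) :
  uniq s -> uniq t -> (forall n, 0 <= f n) ->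
  (forall n, n \in s -> n \notin t -> f n = 0) ->
  \sum_(n <- s) f n <= \sum_(n <- t) f n.
Proof.
move=> us ut f0 st; rewrite (bigID (mem t)) /= [X in _ + X]big1_seq ?addr0; last first.
  by move=> n /andP[nt /st]; exact.
have -> : \sum_(n <- s | n \in t) f n = \sum_(n <- t | n \in s) f n.
  rewrite -[LHS]big_filter -[RHS]big_filter; apply: perm_big.
  apply: uniq_perm => [||n]; try exact: filter_uniq.
  by rewrite !mem_filter andbC.
by rewrite big_mkcond; apply: ler_sum => n _; case: ifP.
Qed.

(** A nonincreasing sequence is summed over an arbitrary set of n indices by
    separating the indices below n from those above. *)
Lemma sum_anti_le (w : nat -> R) (s : seq nat) : uniq s ->
  (forall i, 0 <= w i) -> (forall i j, (i <= j)%N -> w j <= w i) ->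
  \sum_(n <- s) w n <= \sum_(0 <= i < size s) w i + (size s)%:R * w (size s).
Proof.
move=> us w0 wa; rewrite (bigID (fun n => n < size s)%N) /= lerD //.
  rewrite -big_filter; apply: ler_sum_uniq => //.
  - exact: filter_uniq.
  - exact: iota_uniq.
  - by move=> n; rewrite mem_filter mem_index_iota => /andP[-> _].
rewrite -big_filter; apply: (@le_trans _ _ (\sum_(i <- [seq i <- s | ~~ (i < size s)%N]) w (size s))).
  rewrite big_seq [leRHS]big_seq; apply: ler_sum => i.
  by rewrite mem_filter -leqNgt => /andP[h _]; exact: wa.
rewrite big_const_seq count_predT iter_addr_0 -[leLHS]mulr_natl ler_wpM2r //.
by rewrite ler_nat size_filter count_size.
Qed.

Lemma harmonic_le_ln m :
  \sum_(0 <= i < m) (i.+1%:R : R)^-1 <= 2 * ln (1 + m%:R).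
Proof.
elim: m => [|m IH]; first by rewrite big_geq // addr0 ln1 mulr0.
rewrite big_nat_recr //= -lerBrDr (le_trans IH) //.
suff : (m.+1%:R)^-1 <= 2 * (ln (1 + m.+1%:R) - ln (1 + m%:R)) :> R.
  by move=> h; rewrite lerBrDr -lerBrDl -mulrBr.
have p1 : 0 < 1 + m%:R :> R by rewrite ltr_pwDl.
have p2 : 0 < 1 + m.+1%:R :> R by rewrite ltr_pwDl.
have := expR_ge1Dx (ln ((1 + m%:R) / (1 + m.+1%:R)) : R).
rewrite lnK ?posrE ?divr_gt0 // ln_div ?posrE //.
move: (ln (1 + m%:R)) (ln (1 + m.+1%:R)) => x y.
have mE : m.+1%:R = m%:R + 1 :> R by rewrite -natr1.
move: p1 p2; rewrite !mE; move: (m%:R : R) (ler0n R m) => t t0 p1 p2 h.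
have h1 : (1 + t) / (1 + (t + 1)) = 1 - (1 + (t + 1))^-1 by field; lra.
have h2 : (1 + t)^-1 <= 2 * (1 + (t + 1))^-1.
  by rewrite -[leLHS]mul1r ler_pdivrMr // mulrAC ler_pdivlMr //; lra.
rewrite h1 in h.
move: h h2; rewrite [t + 1]addrC; lra.
Qed.

End QuasiConcave.

(** * Abel summation along a decreasing rearrangement *)

Section Abel.
Context {R : realType} {k : scalar_kind} {X : normedModType (scalar_field R k)}.
Local Notation K := (scalar_field R k).

(** The Lorentz norm when the list is decreasing; since the weights decrease,
    the supremum over all the orderings of a list is reached there. *)
Definition lorentz_sum (Phi : nat -> R) (l : seq R) : R :=
  \sum_(0 <= i < size l) weight Phi i * l`_i.

Lemma lorentz_sum_rcons Phi l t :
  lorentz_sum Phi (rcons l t) = lorentz_sum Phi l + weight Phi (size l) * t.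
Proof.
rewrite /lorentz_sum size_rcons big_nat_recr //= nth_rcons ltnn eqxx; congr (_ + _).
by rewrite big_nat [RHS]big_nat; apply: eq_bigr => i /= il; rewrite nth_rcons il.
Qed.

(** Induction on the list by removing its smallest modulus t: the vectors with
    all moduli equal to t are bounded by the democracy hypothesis, and what
    remains is supported on a shorter list, still decreasing. *)
Lemma abel_lorentz (I : eqType) (v : I -> X) (Phi : nat -> R) (D : R) :
  quasiconcave Phi -> 0 <= D ->
  (forall (s : seq I) (eps : I -> K), uniq s -> (forall n, rabs (eps n) = 1) ->
     rnorm (\sum_(n <- s) eps n *: v n) <= D * Phi (size s)) ->
  forall (s : seq I) (a : I -> K), uniq s ->
    pairwise (fun i j => rabs (a j) <= rabs (a i)) s ->
    rnorm (\sum_(n <- s) a n *: v n) <=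
      D * lorentz_sum Phi [seq rabs (a n) | n <- s].
Proof.
move=> qc D0 dem; elim/last_ind => [|s n0 IH] a.
  by rewrite big_nil rnorm0 /lorentz_sum /= big_geq // mulr0.
rewrite rcons_uniq pairwise_rcons => /andP[n0s us] /andP[/allP alls ps].
set t := rabs (a n0).
pose b n := emb (rabs (a n) - t) * phase (a n).
have rb n : n \in s -> rabs (b n) = rabs (a n) - t.
  by move=> /alls h; rewrite rabsM rabs_phase mulr1 rabs_emb ger0_norm // subr_ge0.
have -> : \sum_(n <- rcons s n0) a n *: v n =
    emb t *: (\sum_(n <- rcons s n0) phase (a n) *: v n) + \sum_(n <- s) b n *: v n.
  rewrite !big_rcons /= scalerDr scaler_sumr addrAC -big_split /=; congr (_ + _).
    by apply: eq_bigr => n _; rewrite scalerA -scalerDl {1}(phaseE (a n)) /b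
      -mulrDl -rmorphD /= subrKC.
  by rewrite scalerA -phaseE.
apply: le_trans (rnormD _ _) _; rewrite rnormZ rabs_emb ger0_norm ?rabs_ge0 //.
have /(_ us) hs := IH b; have {}hs : rnorm (\sum_(n <- s) b n *: v n) <=
    D * lorentz_sum Phi [seq rabs (b n) | n <- s].
  apply: hs; rewrite -(eq_in_pairwise (P := mem s)
    (r := fun i j => rabs (a j) <= rabs (a i))) //.
  by move=> i j /= si sj; rewrite !rb // lerD2r.
have hd : rnorm (\sum_(n <- rcons s n0) phase (a n) *: v n) <= D * Phi (size s).+1.
  rewrite -(size_rcons s n0); apply: dem; first by rewrite rcons_uniq n0s.
  by move=> n; exact: rabs_phase.
have ht : 0 <= t by exact: rabs_ge0.
apply: le_trans (lerD (ler_wpM2l ht hd) hs) _.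
rewrite mulrCA -mulrDr ler_wpM2l // map_rcons lorentz_sum_rcons size_map -/t.
have -> : lorentz_sum Phi [seq rabs (b n) | n <- s] =
    lorentz_sum Phi [seq rabs (a n) | n <- s] - t * \sum_(i < size s) weight Phi i.
  rewrite /lorentz_sum !size_map !big_mkord mulr_sumr -sumrB.
  apply: eq_bigr => i _; rewrite !(nth_map n0) // rb ?mem_nth //.
  by rewrite mulrBr [t * _]mulrC.
have := ler_wpM2l ht (qc_le_sum_weight (size s).+1 qc); rewrite big_ord_recr /=; lra.
Qed.

End Abel.

(** * Symmetric sequence spaces given by a supremum over finite lists *)

Section Completeness.
Context {R : realType}.

(** The complex case reduces to the real one through real and imaginary
    parts. *)
Lemma rabs_complete (k : scalar_kind) (u : nat -> scalar_field R k) :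
  (forall e : R, 0 < e -> exists N, forall i j, (N <= i)%N -> (N <= j)%N ->
     rabs (u i - u j) <= e) ->
  exists l, forall e : R, 0 < e -> exists N, forall i, (N <= i)%N ->
     rabs (l - u i) <= e.
Proof.
have realC (v : nat -> R) :
    (forall e : R, 0 < e -> exists N, forall i j, (N <= i)%N -> (N <= j)%N ->
      `|v i - v j| <= e) ->
    exists l, forall e : R, 0 < e -> exists N, forall i, (N <= i)%N ->
      `|l - v i| <= e.
  move=> vC; have cv : cvgn (v : nat -> R^o).
    exact: (@cauchy_rnorm_cvg R real_scalars R^o).
  exists (limn (v : nat -> R^o)).
  exact: (cvg_rnormP (k := real_scalars) (X := R^o) v _).1 cv.
case: k u => u uC; first exact: realC uC.
have re_le (z : R[i]) : `|complex.Re z| <= rabs (k := complex_scalars) z.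
  case: z => x y; rewrite /rabs normc_def /= -sqrtr_sqr ler_sqrt ?lerDl ?sqr_ge0 //.
  by rewrite addr_ge0 ?sqr_ge0.
have im_le (z : R[i]) : `|complex.Im z| <= rabs (k := complex_scalars) z.
  case: z => x y; rewrite /rabs normc_def /= -sqrtr_sqr ler_sqrt ?lerDr ?sqr_ge0 //.
  by rewrite addr_ge0 ?sqr_ge0.
have le_reim (z : R[i]) : rabs (k := complex_scalars) z <=
    `|complex.Re z| + `|complex.Im z|.
  case: z => x y; rewrite /rabs normc_def /=.
  rewrite -[leRHS]ger0_norm ?addr_ge0 // -sqrtr_sqr ler_sqrt ?sqr_ge0 //.
  rewrite sqrrD !real_normK ?num_real // lerD2r lerDl.
  by rewrite mulrn_wge0 // mulr_ge0.
have [x xP] : exists l, forall e : R, 0 < e -> exists N, forall i, (N <= i)%N ->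
    `|l - complex.Re (u i)| <= e.
  apply: realC => e /uC [N NP]; exists N => i j Ni Nj.
  by rewrite -raddfB; exact: le_trans (re_le _) (NP _ _ Ni Nj).
have [y yP] : exists l, forall e : R, 0 < e -> exists N, forall i, (N <= i)%N ->
    `|l - complex.Im (u i)| <= e.
  apply: realC => e /uC [N NP]; exists N => i j Ni Nj.
  by rewrite -raddfB; exact: le_trans (im_le _) (NP _ _ Ni Nj).
exists (x +i* y)%C => e e0.
have [|M MP] := xP (e / 2); first by rewrite divr_gt0.
have [|N NP] := yP (e / 2); first by rewrite divr_gt0.
exists (maxn M N) => i; rewrite geq_max => /andP[/MP h1 /NP h2].
apply: le_trans (le_reim _) _; rewrite !raddfB /=.
by rewrite [leRHS]splitr lerD.
Qed.

End Completeness.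

Section GaugeSpace.
Context {R : realType} {k : scalar_kind}.
Local Notation K := (scalar_field R k).
Variable phi : seq R -> R.

Definition moduli (f : nat -> K^o) (s : seq nat) : seq R :=
  [seq rabs (f n) | n <- s].

Definition gauge_le (f : nat -> K^o) (r : R) : Prop :=
  forall s, uniq s -> phi (moduli f s) <= r.

Definition gauge (f : nat -> K^o) : R :=
  sup [set phi (moduli f s) | s in [set s | uniq s]].

(** The requirements on [phi] under which the closure of the finitely supported
    sequences in the gauge is a symmetric quasi-Banach sequence space. *)
Record gauge_axioms := GaugeAxioms {
  phi_ge0 : forall l, all (fun x => 0 <= x) l -> 0 <= phi l;
  phiZ : forall c l, 0 <= c -> phi [seq c * x | x <- l] = c * phi l;
  phi_lipschitz : forall n, exists2 c, 0 <= c & forall l l' e,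
    size l = n -> size l' = n -> 0 <= e ->
    (forall i, (i < n)%N -> l`_i <= l'`_i + e) -> phi l <= phi l' + c * e;
  phi_quasi : exists2 kappa, 0 <= kappa & forall (f g : nat -> R) r1 r2,
    (forall n, 0 <= f n) -> (forall n, 0 <= g n) ->
    (forall s, uniq s -> phi [seq f n | n <- s] <= r1) ->
    (forall s, uniq s -> phi [seq g n | n <- s] <= r2) ->
    forall s, uniq s -> phi [seq f n + g n | n <- s] <= kappa * (r1 + r2);
  phi_single : exists2 c, 0 < c & forall x, 0 <= x -> phi [:: x] = c * x;
  phi_finite : forall N (f : nat -> R), (forall n, 0 <= f n) ->
    (forall n, (N <= n)%N -> f n = 0) ->
    exists r, forall s, uniq s -> phi [seq f n | n <- s] <= r
}.

Hypothesis ax : gauge_axioms.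

Lemma phi_mono l l' : size l = size l' ->
  (forall i, (i < size l)%N -> l`_i <= l'`_i) -> phi l <= phi l'.
Proof.
move=> sl h; have [c _ lip] := phi_lipschitz ax (size l).
have := lip l l' 0 erefl (esym sl) (lexx _); rewrite mulr0 addr0; apply.
by move=> i /h; rewrite addr0.
Qed.

Lemma phi_moduli_mono f (g : nat -> R) s : (forall n, rabs (f n) <= g n) ->
  phi (moduli f s) <= phi [seq g n | n <- s].
Proof.
move=> fg; apply: phi_mono; rewrite ?size_map // => i si.
by rewrite !(nth_map 0%N).
Qed.

Lemma gauge_set_neq0 f : [set phi (moduli f s) | s in [set s | uniq s]] !=set0.
Proof. by exists (phi (moduli f [::])); exists [::]. Qed.

Lemma gauge_leP f r : gauge_le f r -> gauge f <= r.
Proof. by move=> h; apply: ge_sup (gauge_set_neq0 f) _ => _ [s /h ? <-]. Qed.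

Lemma le_gauge f r s : gauge_le f r -> uniq s -> phi (moduli f s) <= gauge f.
Proof.
move=> h us; apply: ub_le_sup; last by exists s.
by exists r => _ [s' /h ? <-].
Qed.

Lemma gauge_le_gauge f r : gauge_le f r -> gauge_le f (gauge f).
Proof. by move=> h s us; exact: le_gauge h us. Qed.

Lemma gauge_ge0 f r : gauge_le f r -> 0 <= gauge f.
Proof.
by move=> h; apply: le_trans (le_gauge h (isT : uniq [::])); apply: phi_ge0.
Qed.

Lemma gauge_leS f r r' : r <= r' -> gauge_le f r -> gauge_le f r'.
Proof. by move=> rr h s /h /le_trans; apply. Qed.

Lemma gauge_leZ a f r : gauge_le f r -> gauge_le (a *: f) (rabs a * r).
Proof.
move=> h s us; have -> : moduli (a *: f) s = [seq rabs a * x | x <- moduli f s].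
  by rewrite /moduli -map_comp; apply: eq_map => n /=; rewrite rabsM.
by rewrite phiZ ?rabs_ge0 // ler_wpM2l ?rabs_ge0 // h.
Qed.

Lemma gaugeZ a f r : gauge_le f r -> gauge (a *: f) = rabs a * gauge f.
Proof.
move=> h; have h1 := gauge_le_gauge h.
apply/eqP; rewrite eq_le gauge_leP ?andTb; last exact: gauge_leZ.
have [->|a0] := eqVneq a 0.
  by rewrite rabs0 mul0r; apply: gauge_ge0 (gauge_leZ 0 h).
have ra : 0 < rabs a.
  by rewrite lt_def rabs_ge0 andbT; apply: contra_neq a0 => /rabs_eq0.
rewrite -ler_pdivlMl // -rabsV; apply: gauge_leP.
have := gauge_leZ a^-1 (gauge_le_gauge (gauge_leZ a h)).
by rewrite scalerA mulVf // scale1r.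
Qed.

Lemma gauge_leD : exists2 kappa, 0 <= kappa & forall f g r1 r2,
  gauge_le f r1 -> gauge_le g r2 -> gauge_le (f + g) (kappa * (r1 + r2)).
Proof.
have [kappa k0 q] := phi_quasi ax; exists kappa => // f g r1 r2 h1 h2 s us.
apply: le_trans (q (fun n => rabs (f n)) (fun n => rabs (g n)) r1 r2 _ _ h1 h2 s us);
  try by move=> n; exact: rabs_ge0.
by apply: phi_moduli_mono => n; exact: rabsD.
Qed.

Lemma gauge_leN f r : gauge_le f r -> gauge_le (- f) r.
Proof.
move=> h; rewrite -scaleN1r -[r]mul1r -[X in X * r](@rabs1 R k) -rabsN.
exact: gauge_leZ.
Qed.

Lemma gauge_le_coord : exists2 c, 0 <= c & forall f r n,
  gauge_le f r -> rabs (f n) <= c * r.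
Proof.
have [c c0 p1] := phi_single ax; exists c^-1; first by rewrite invr_ge0 ltW.
move=> f r n /(_ [:: n] isT); rewrite /moduli /= p1 ?rabs_ge0 // => h.
by rewrite mulrC ler_pdivlMr // mulrC.
Qed.

Lemma gauge_le_c00 f : c00 f -> exists r, gauge_le f r.
Proof.
move=> [N fN]; apply: (phi_finite ax (N := N)) => [n|n /fN ->].
  exact: rabs_ge0.
exact: rabs0.
Qed.

(** Each list only sees finitely many coordinates, so that a gauge bound passes
    to pointwise limits. *)
Lemma gauge_fatou (u : nat -> nat -> K^o) (l : nat -> K^o) r M :
  (forall n (e : R), 0 < e -> exists N, forall i, (N <= i)%N -> rabs (l n - u i n) <= e) ->
  (forall i, (M <= i)%N -> gauge_le (u i) r) -> gauge_le l r.
Proof.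
move=> ul ur s us; have [c c0 lip] := phi_lipschitz ax (size s).
apply/ler_addgt0Pr => e e0.
have d0 : 0 < e / (c + 1) by rewrite divr_gt0 // ltr_wpDl.
have [N [MN NP]] : exists N, (M <= N)%N /\
    forall n, n \in s -> rabs (l n - u N n) <= e / (c + 1).
  have [N NP] : exists N, forall i, (N <= i)%N ->
      forall n, n \in s -> rabs (l n - u i n) <= e / (c + 1).
    elim: (s) => [|n s' [N NP]]; first by exists 0%N.
    have [N' NP'] := ul n _ d0; exists (maxn N N') => i.
    rewrite geq_max => /andP[Ni N'i] m; rewrite inE => /orP[/eqP ->|]; first exact: NP'.
    exact: NP.
  by exists (maxn M N); rewrite leq_maxl; split=> //; apply: NP; exact: leq_maxr.
have h : phi (moduli l s) <= phi (moduli (u N) s) + c * (e / (c + 1)).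
  apply: lip; rewrite ?size_map ?ltW // => i si.
  rewrite !(nth_map 0%N) //.
  have := NP _ (mem_nth 0%N si); have := rabsD (u N s`_i) (l s`_i - u N s`_i).
  rewrite subrKC; lra.
apply: le_trans h _; rewrite lerD ?ur //.
by rewrite mulrCA ger_pMr // ler_pdivrMr ?mul1r ?ltr_wpDl // lerDl.
Qed.

(** The closure of the finitely supported sequences, because the whole space of
    sequences of finite gauge need not have them dense. *)
Definition gauge_carrier : set (nat -> K^o) :=
  [set f | (exists r, gauge_le f r) /\
    forall e : R, 0 < e -> exists2 g, c00 g & gauge_le (f - g) e].

Lemma c00_linear (a : K) f g : c00 f -> c00 g -> c00 (a *: f + g).
Proof.
move=> [N fN] [M gM]; exists (maxn N M) => n; rewrite geq_max => /andP[/fN f0 /gM g0].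
by rewrite -[LHS]/(a * f n + g n) f0 g0 mulr0 addr0.
Qed.

Lemma gauge_carrier_linear (a : K) f g :
  gauge_carrier f -> gauge_carrier g -> gauge_carrier (a *: f + g).
Proof.
have [kappa k0 q] := gauge_leD.
move=> [[r fr] fd] [[t gt] gd]; split.
  by eexists; apply: q; [exact: gauge_leZ fr | exact: gt].
move=> e e0; pose d := e / ((kappa + 1) * (rabs a + 1)).
have a0 : 0 <= rabs a by exact: rabs_ge0.
have d0 : 0 < d by rewrite divr_gt0 // mulr_gt0 // ltr_wpDl.
have [f' cf hf] := fd _ d0; have [g' cg hg] := gd _ d0.
exists (a *: f' + g'); first exact: c00_linear.
have -> : a *: f + g - (a *: f' + g') = a *: (f - f') + (g - g').
  by rewrite scalerBr opprD addrACA.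
apply: gauge_leS (q _ _ _ _ (gauge_leZ a hf) hg).
have <- : (kappa + 1) * (rabs a + 1) * d = e.
  by rewrite /d mulrC divfK // gt_eqF // mulr_gt0 // ltr_wpDl.
by have := mulr_ge0 a0 (ltW d0); lra.
Qed.

Lemma gauge_carrier_c00 f : c00 f -> gauge_carrier f.
Proof.
move=> cf; split; first exact: gauge_le_c00.
move=> e e0; exists f => //; rewrite subrr => s us.
have -> : moduli 0 s = [seq 0 * x | x <- moduli 0 s].
  by rewrite /moduli -map_comp; apply: eq_map => n /=; rewrite rabs0 mul0r.
by rewrite phiZ // mul0r ltW.
Qed.

Lemma gauge_carrierB f g :
  gauge_carrier f -> gauge_carrier g -> gauge_carrier (f - g).
Proof.
by move=> hf hg; rewrite -scaleN1r addrC; exact: gauge_carrier_linear.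
Qed.

(** A Cauchy sequence converges pointwise by the coordinate estimate, and then in
    the gauge by the Fatou property. *)
Lemma gauge_complete (u : nat -> nat -> K^o) : (forall n, gauge_carrier (u n)) ->
  (forall e : R, 0 < e -> exists N, forall i j, (N <= i)%N -> (N <= j)%N ->
     gauge (u i - u j) <= e) ->
  exists2 l, gauge_carrier l &
    forall e : R, 0 < e -> exists N, forall i, (N <= i)%N -> gauge (u i - l) <= e.
Proof.
move=> uc uC.
have uB i j : gauge_le (u i - u j) (gauge (u i - u j)).
  by have [[r hr] _] := gauge_carrierB (uc i) (uc j); exact: gauge_le_gauge hr.
have [c c0 coord] := gauge_le_coord.
have /choice[l lP] n : exists l : K, forall e : R, 0 < e ->
    exists N, forall i, (N <= i)%N -> rabs (l - u i n) <= e.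
  apply: rabs_complete => e e0.
  have [|N NP] := uC (e / (c + 1)); first by rewrite divr_gt0 // ltr_wpDl.
  exists N => i j Ni Nj; apply: le_trans (coord _ _ n (uB i j)) _.
  apply: le_trans (ler_wpM2l c0 (NP _ _ Ni Nj)) _.
  by rewrite mulrCA ger_pMr // ler_pdivrMr ?mul1r ?ltr_wpDl // lerDl.
have ul (e : R) : 0 < e -> exists N, forall i, (N <= i)%N -> gauge_le (u i - l) e.
  move=> e0; have [N NP] := uC e e0; exists N => i Ni.
  apply: (@gauge_fatou (fun j => u i - u j) _ _ N) => [n d d0|j Nj].
    have [N' NP'] := lP n d d0; exists N' => j N'j.
    have -> : (u i - l) n - (u i - u j) n = - (l n - u j n) :> K.
      rewrite -[LHS]/(u i n - l n - (u i n - u j n)); ring.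
    by rewrite rabsN NP'.
  exact: gauge_leS (NP _ _ Ni Nj) (uB i j).
exists l; last by move=> e /ul [N NP]; exists N => i /NP /gauge_leP.
have [kappa k0 q] := gauge_leD; split.
  have [N /(_ N (leqnn _)) h] := ul 1 ltr01.
  have [[r hr] _] := uc N.
  have -> : l = u N + (- (u N - l)) by rewrite opprB subrKC.
  by eexists; apply: q; [exact: hr | exact: gauge_leN h].
move=> e e0; pose d := e / (2 * (kappa + 1)).
have d0 : 0 < d by rewrite divr_gt0 // mulr_gt0 // ltr_wpDl.
have [N /(_ N (leqnn _)) h] := ul _ d0.
have [_ /(_ d d0) [g cg hg]] := uc N; exists g => //.
have -> : l - g = - (u N - l) + (u N - g) by rewrite opprB addrA subrK.
apply: gauge_leS (q _ _ _ _ (gauge_leN h) hg).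
have <- : 2 * (kappa + 1) * d = e.
  by rewrite /d mulrC divfK // gt_eqF // mulr_gt0 // ltr_wpDl.
lra.
Qed.

Definition gauge_space : sequence_space R k.
Proof.
refine (@SequenceSpace R k gauge_carrier gauge gauge_carrier_linear _ _ _ _
  gauge_complete gauge_carrier_c00 _ _).
- by move=> f [[r hr] _]; exact: gauge_ge0 hr.
- move=> f [[r hr] _]; split=> [f0|->].
    apply/funext => n; apply: rabs_eq0; apply/eqP; rewrite eq_le rabs_ge0 andbT.
    have [c c0 coord] := gauge_le_coord.
    by have := coord _ _ n (gauge_le_gauge hr); rewrite f0 mulr0.
  have := gaugeZ 0 hr; rewrite scale0r => ->; by rewrite rabs0 mul0r.
- by move=> a f [[r hr] _]; exact: gaugeZ hr.
- have [kappa _ q] := gauge_leD; exists kappa => f g [[r hr] _] [[t ht] _].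
  by apply: gauge_leP; apply: q; [exact: gauge_le_gauge hr | exact: gauge_le_gauge ht].
- move=> f e [_ h] /h [g cg hg]; exists g => //; exact: gauge_leP.
- move=> n; have [c _ coord] := gauge_le_coord; exists c => f [[r hr] _].
  exact: coord (gauge_le_gauge hr).
Defined.

(** The supremum ranges over all lists without repetition, a family stable
    under bijections of the integers. *)
Lemma gauge_perm (f g : nat -> K^o) (s : nat -> nat) : bijective s ->
  (forall n, rabs (g (s n)) = rabs (f n)) -> gauge g = gauge f.
Proof.
move=> [t st ts] fg; rewrite /gauge; congr sup; apply/seteqP; split=> _ [l /= ul <-].
  exists [seq t n | n <- l]; first by rewrite /= map_inj_uniq //; exact: can_inj ts.
  congr phi; rewrite /moduli -map_comp; apply: eq_map => n /=.
  by rewrite -fg ts.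
exists [seq s n | n <- l]; first by rewrite /= map_inj_uniq //; exact: can_inj st.
by congr phi; rewrite /moduli -map_comp; apply: eq_map => n /=.
Qed.

Lemma sum_unit_vec (N : nat) (a : nat -> K) (s : nat -> nat) j : injective s ->
  (\sum_(n < N) a n *: (@unit_vec R k (s n) : nat -> K^o)) (s j) = if (j < N)%N then a j else 0.
Proof.
move=> si; rewrite fct_sumE; under eq_bigr => i _.
  rewrite -[(_ *: _) _]/(a i * (s j == s i)%:R) (inj_eq si); over.
case: ifPn => [jN|]; last first.
  rewrite -leqNgt => Nj; rewrite big1 // => i _.
  by rewrite gtn_eqF ?mulr0 // (leq_trans (ltn_ord i)).
rewrite (bigD1 (Ordinal jN)) //= eqxx mulr1 big1 ?addr0 // => i.
by rewrite -val_eqE /= eq_sym => /negPf ->; rewrite mulr0.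
Qed.

Lemma gauge_space_symmetric : symmetric_space gauge_space.
Proof.
move=> N a eps s e1 sb /=; apply: (@gauge_perm _ _ s) => // n.
rewrite (@sum_unit_vec N (fun n => eps n * a n) s n (bij_inj sb)).
rewrite (@sum_unit_vec N a id n (fun i j h => h)); case: ifP => // _.
by rewrite rabsM (rabs_eq1 _).2 ?mul1r.
Qed.

End GaugeSpace.

(** * The Lorentz and the weak Lorentz space *)

Section LorentzWeak.
Context {R : realType}.
Variable Phi : nat -> R.
Hypothesis qc : quasiconcave Phi.

Lemma lorentz_sumE (I : Type) (f : I -> R) (x0 : I) (s : seq I) :
  lorentz_sum Phi [seq f n | n <- s] =
  \sum_(0 <= i < size s) weight Phi i * f (nth x0 s i).
Proof.
rewrite /lorentz_sum size_map big_nat [RHS]big_nat; apply: eq_bigr => i /= si.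
by rewrite (nth_map x0).
Qed.

Lemma lorentz_axioms : gauge_axioms (lorentz_sum Phi).
Proof.
have w0 i : 0 <= weight Phi i by exact: weight_ge0.
split.
- move=> l /allP l0; rewrite /lorentz_sum big_nat sumr_ge0 // => i /= il.
  by rewrite mulr_ge0 // l0 // mem_nth.
- move=> c l _; rewrite (lorentz_sumE _ 0) mulr_sumr; apply: eq_bigr => i _.
  by rewrite mulrCA.
- move=> n; exists (\sum_(0 <= i < n) weight Phi i); first exact: sumr_ge0.
  move=> l l' e sl sl' e0 h; rewrite /lorentz_sum sl sl' mulr_suml -big_split /=.
  rewrite big_nat [leRHS]big_nat; apply: ler_sum => i /= /h hi.
  by rewrite -mulrDr ler_wpM2l.
- exists 1 => // f g r1 r2 f0 g0 h1 h2 s us; rewrite mul1r.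
  apply: le_trans (lerD (h1 s us) (h2 s us)).
  rewrite !(lorentz_sumE _ 0%N) -big_split /= le_eqVlt; apply/orP; left.
  by apply/eqP/eq_bigr => i _; rewrite mulrDr.
- exists (Phi 1%N); first by case: qc => _ pos _ _; exact: pos.
  by move=> x x0; rewrite /lorentz_sum /= big_nat1 /weight divr1.
- move=> N f f0 fN; exists (weight Phi 0 * \sum_(0 <= n < N) f n) => s us.
  rewrite (lorentz_sumE _ 0%N).
  apply: (@le_trans _ _ (weight Phi 0 * \sum_(n <- s) f n)).
    rewrite [X in _ <= _ * X](big_nth 0%N) mulr_sumr; apply: ler_sum => i _.
    by rewrite ler_wpM2r // weight_anti.
  rewrite ler_wpM2l //; apply: ler_sum_uniq => //; first exact: iota_uniq.
  by move=> n _; rewrite mem_index_iota /= -leqNgt => /fN.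
Qed.

Fixpoint lmin (l : seq R) : R :=
  if l is x :: l' then (if l' is [::] then x else Num.min x (lmin l')) else 0.

Lemma le_lmin t l : l != [::] -> (t <= lmin l) = all (fun x => t <= x) l.
Proof.
elim: l => // x [|y l] IH _; first by rewrite /= andbT.
rewrite -[lmin _]/(Num.min x (lmin (y :: l))) le_min IH //.
Qed.

Lemma lminZ c l : 0 <= c -> lmin [seq c * x | x <- l] = c * lmin l.
Proof.
move=> c0; elim: l => [|x [|y l] IH]; rewrite ?mulr0 //.
by rewrite -[lmin [:: x, y & l]]/(Num.min x (lmin (y :: l))) minr_pMr // -IH.
Qed.

Definition weak_val (l : seq R) : R := Phi (size l) * lmin l.

Lemma le_weak_val (I : eqType) (f : I -> R) (s : seq I) t :
  (forall n, n \in s -> t <= f n) -> Phi (size s) * t <= weak_val [seq f n | n <- s].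
Proof.
case: s => [|n s] h; first by rewrite /weak_val /=; case: qc => -> _ _ _; rewrite !mul0r.
rewrite /weak_val size_map ler_wpM2l ?qc_ge0 // le_lmin // all_map.
by apply/allP => m /h.
Qed.

Lemma weak_val_le (I : eqType) (f : I -> R) (s : seq I) r :
  (forall t, (forall n, n \in s -> t <= f n) -> Phi (size s) * t <= r) ->
  weak_val [seq f n | n <- s] <= r.
Proof.
rewrite /weak_val size_map; apply; case: s => // n0 s n ns.
have := lexx (lmin [seq f n | n <- n0 :: s]); rewrite le_lmin // all_map => /allP.
by apply.
Qed.

(** Quasi-triangle inequality: when |f + g| >= t on a set, one of f and g is at
    least t / 2 in modulus at each of its points, and [Phi] is subadditive. *)
Lemma weak_axioms : gauge_axioms weak_val.
Proof.
have P0 i : 0 <= Phi i by exact: qc_ge0.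
split.
- move=> l l0; rewrite -[l]map_id; apply: le_trans (le_weak_val (t := 0) _).
    by rewrite mulr0.
  exact/allP.
- by move=> c l c0; rewrite /weak_val size_map lminZ // mulrCA.
- move=> n; exists (Phi n) => // l l' e sl sl' e0 h.
  rewrite -[l]map_id; apply: weak_val_le => t tl.
  rewrite -lerBlDr sl -mulrBr -sl' -{2}[l']map_id; apply: le_weak_val => x.
  move=> /(nthP 0) [i il' <-]; rewrite lerBlDr; apply: le_trans (h _ _).
    by apply: tl; rewrite mem_nth // sl -sl'.
  by rewrite -sl'.
- exists 2 => // f g r1 r2 f0 g0 h1 h2 s us; apply: weak_val_le => t tfg.
  pose p n := t / 2 <= f n.
  have u1 : uniq [seq n <- s | p n] by exact: filter_uniq.
  have u2 : uniq [seq n <- s | ~~ p n] by exact: filter_uniq.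
  have e1 : Phi (size [seq n <- s | p n]) * (t / 2) <= r1.
    apply: le_trans (h1 _ u1); apply: le_weak_val => n.
    by rewrite mem_filter => /andP[].
  have e2 : Phi (size [seq n <- s | ~~ p n]) * (t / 2) <= r2.
    apply: le_trans (h2 _ u2); apply: le_weak_val => n.
    rewrite mem_filter /p -ltNge => /andP[fn /tfg]; lra.
  have [t0|t0] := leP t 0.
    have r10 : 0 <= r1.
      by apply: le_trans (h1 [::] isT); rewrite /weak_val /= mulr0.
    have r20 : 0 <= r2.
      by apply: le_trans (h2 [::] isT); rewrite /weak_val /= mulr0.
    have : Phi (size s) * t <= 0 by rewrite mulr_ge0_le0.
    lra.
  have : Phi (size s) <= Phi (size [seq n <- s | p n]) + Phi (size [seq n <- s | ~~ p n]).
    apply: le_trans (qc_subadd _ _ qc); rewrite !size_filter.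
    by rewrite count_predC.
  move=> /(fun h => ler_wpM2r (ltW t0) h); lra.
- exists (Phi 1%N); first by case: qc => _ pos _ _; exact: pos.
  by [].
- move=> N f f0 fN; exists (Phi N * \sum_(0 <= n < N) f n) => s us.
  apply: weak_val_le => t tf.
  have S0 : 0 <= \sum_(0 <= n < N) f n by exact: sumr_ge0.
  have [t0|t0] := leP t 0.
    by rewrite (@le_trans _ _ 0) ?mulr_ge0 // mulr_ge0_le0.
  have sN : {subset s <= iota 0 N}.
    move=> n ns; rewrite mem_iota add0n /= ltnNge; apply/negP => /fN fn0.
    by have := tf _ ns; rewrite fn0 leNgt t0.
  have [s0|] := eqVneq s [::].
    by rewrite s0 /=; case: qc => -> _ _ _; rewrite mul0r mulr_ge0.
  case: s us tf sN => // n s us tf sN _.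
  apply: ler_pM => //; first exact: ltW.
    by case: qc => _ _ mono _; apply: mono; rewrite -(size_iota 0 N) uniq_leq_size.
  apply: le_trans (tf n (mem_head _ _)) _.
  have nN : n \in iota 0 N by apply: sN; exact: mem_head.
  by rewrite /index_iota subn0 (big_rem n) //= lerDl sumr_ge0.
Qed.

End LorentzWeak.

Section Fundamental.
Context {R : realType} (k : scalar_kind).
Local Notation K := (scalar_field R k).
Variable Phi : nat -> R.
Hypothesis qc : quasiconcave Phi.

Definition lorentz_space : sequence_space R k := gauge_space (k := k) (lorentz_axioms qc).
Definition weak_space : sequence_space R k := gauge_space (k := k) (weak_axioms qc).

Lemma indicator_moduli m n :
  rabs ((\sum_(i < m) @unit_vec R k i : nat -> K^o) n) = (n < m)%:R :> R.
Proof.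
have -> : \sum_(i < m) @unit_vec R k i =
    \sum_(i < m) (1 : K) *: (@unit_vec R k i : nat -> K^o).
  by apply: eq_bigr => i _; rewrite scale1r.
rewrite (@sum_unit_vec R k m (fun=> 1) id n) //.
by case: ifP => _; rewrite ?rabs1 ?rabs0.
Qed.

Lemma indicator_c00 m : c00 (\sum_(i < m) @unit_vec R k i : nat -> K^o).
Proof.
exists m => n mn; apply: rabs_eq0; by rewrite indicator_moduli ltnNge mn.
Qed.

Lemma weak_fundamental m : fundamental weak_space m = Phi m.
Proof.
have [r hr] := gauge_le_c00 (weak_axioms qc) (indicator_c00 m).
apply/eqP; rewrite eq_le; apply/andP; split.
  apply: gauge_leP => s us; apply: weak_val_le => t ht.
  have [t0|t0] := leP t 0.
    by rewrite (@le_trans _ _ 0) ?qc_ge0 // mulr_ge0_le0 // qc_ge0.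
  have t1 n : n \in s -> (n < m)%N /\ t <= 1.
    move=> /ht; rewrite indicator_moduli; case: ltnP => // _.
    by rewrite leNgt t0.
  have [s0|[n ns]] : s = [::] \/ exists n, n \in s.
    by case: (s) => [|n s']; [left | right; exists n; exact: mem_head].
    by rewrite s0 /=; case: (qc) => -> _ _ _; rewrite mul0r qc_ge0.
  have [_ t1'] := t1 _ ns.
  apply: (@le_trans _ _ (Phi (size s) * 1)); first by rewrite ler_wpM2l // qc_ge0.
  rewrite mulr1; case: (qc) => _ _ mono _; apply: mono.
  rewrite -(size_iota 0 m) uniq_leq_size // => j /t1 [jm _].
  by rewrite mem_iota.
apply: le_trans (le_gauge hr (iota_uniq 0 m)).
rewrite -[leLHS]mulr1 -{1}(size_iota 0 m); apply: le_weak_val => // n.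
by rewrite mem_iota indicator_moduli => /andP[_ ->].
Qed.

Lemma lorentz_fundamental_ge m : Phi m <= fundamental lorentz_space m.
Proof.
have [r hr] := gauge_le_c00 (lorentz_axioms qc) (indicator_c00 m).
apply: le_trans (le_gauge hr (iota_uniq 0 m)).
rewrite /moduli (lorentz_sumE _ _ 0%N) size_iota.
apply: le_trans (qc_le_sum_weight m qc) _.
rewrite big_mkord; apply: ler_sum => i _.
by rewrite nth_iota // add0n indicator_moduli ltn_ord mulr1.
Qed.

Lemma mul_weight_le m : m%:R * weight Phi m <= Phi m.
Proof.
have [->|m0] := posnP m; first by rewrite mul0r qc_ge0.
case: qc => _ _ _ dec; have := dec m m.+1; rewrite m0 leqnSn => /(_ isT).
by rewrite ler_pdivlMr ?ltr0n // mulrC.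
Qed.

Lemma sum_weight_uniq_le C (s : seq nat) :
  (forall m, \sum_(0 <= i < m) weight Phi i <= C * Phi m) -> uniq s ->
  \sum_(n <- s) weight Phi n <= (C + 1) * Phi (size s).
Proof.
move=> hC us; have w0 i : 0 <= weight Phi i by exact: weight_ge0.
apply: le_trans (sum_anti_le us w0 _) _.
  by move=> i j ij; exact: weight_anti.
by rewrite mulrDl mul1r lerD ?hC // mul_weight_le.
Qed.

(** The positions in s of the indices below m form a set of at most m integers,
    over which the weights are summed. *)
Lemma lorentz_fundamental_le C m : 0 <= C ->
  (forall m, \sum_(0 <= i < m) weight Phi i <= C * Phi m) ->
  fundamental lorentz_space m <= (C + 1) * Phi m.
Proof.
move=> C0 hC; apply: gauge_leP => s us; rewrite /moduli (lorentz_sumE _ _ 0%N).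
have -> : \sum_(0 <= i < size s) weight Phi i *
      rabs ((\sum_(i < m) @unit_vec R k i : nat -> K^o) (nth 0%N s i)) =
    \sum_(i <- [seq i <- iota 0 (size s) | (nth 0%N s i < m)%N]) weight Phi i.
  rewrite big_filter [RHS]big_mkcond /index_iota subn0; apply: eq_bigr => i _.
  by rewrite indicator_moduli; case: ifP => _; rewrite ?mulr1 ?mulr0.
set l := [seq i <- _ | _].
have ul : uniq l by rewrite filter_uniq // iota_uniq.
apply: le_trans (sum_weight_uniq_le hC ul) _.
rewrite ler_wpM2l ?addr_ge0 //; case: (qc) => _ _ mono _; apply: mono.
rewrite -(size_map (nth 0%N s)) -[leqRHS](size_iota 0 m); apply: uniq_leq_size.
  rewrite map_inj_in_uniq // => i j; rewrite !mem_filter !mem_iota !add0n.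
  move=> /andP[_ /= si] /andP[_ /= sj] /eqP.
  by rewrite nth_uniq // => /eqP.
move=> _ /mapP[i + ->]; rewrite mem_filter => /andP[h _].
by rewrite mem_iota.
Qed.

End Fundamental.

(** * Families with symmetric estimates *)

Section SymmetricFamilies.
Context {R : realType} {k : scalar_kind} {X : normedModType (scalar_field R k)}.
Local Notation K := (scalar_field R k).

Definition islin (g : X -> K^o) : Prop :=
  forall (a : K) x y, g (a *: x + y) = a * g x + g y.

Section IsLin.
Variable g : X -> K^o.
Hypothesis lg : islin g.

Lemma islin0 : g 0 = 0.
Proof. by have := lg (-1) 0 0; rewrite scaleN1r oppr0 addr0 mulN1r addNr. Qed.

Lemma islinD x y : g (x + y) = g x + g y.
Proof. by have := lg 1 x y; rewrite scale1r mul1r. Qed.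

Lemma islinZ a x : g (a *: x) = a * g x.
Proof. by have := lg a x 0; rewrite !addr0 islin0 addr0. Qed.

Lemma islinN x : g (- x) = - g x.
Proof. by rewrite -scaleN1r islinZ mulN1r. Qed.

Lemma islinB x y : g (x - y) = g x - g y.
Proof. by rewrite islinD islinN. Qed.

Lemma islin_sum (I : Type) (s : seq I) (P : pred I) (F : I -> X) :
  g (\sum_(i <- s | P i) F i) = \sum_(i <- s | P i) g (F i).
Proof. exact: (big_morph g islinD islin0). Qed.

End IsLin.

Lemma islin_add g h : islin g -> islin h -> islin (fun x => g x + h x).
Proof. by move=> lg lh a x y; rewrite lg lh; ring. Qed.

Lemma islin_scale c g : islin g -> islin (fun x => c * g x).
Proof. by move=> lg a x y; rewrite lg; ring. Qed.

Lemma islin_sub g h : islin g -> islin h -> islin (fun x => g x - h x).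
Proof. by move=> lg lh a x y; rewrite lg lh; ring. Qed.

Lemma islin_bigsum (I : Type) (s : seq I) (g : I -> X -> K^o) :
  (forall i, islin (g i)) -> islin (fun x => \sum_(i <- s) g i x).
Proof.
move=> lg a x y; rewrite mulr_sumr -big_split /=; apply: eq_bigr => i _.
exact: lg.
Qed.

(** The two estimates, dual to each other, through which a symmetric basis enters
    the construction. Unlike symmetry itself they mention only sums over finite
    sets, so that they pass to subfamilies. *)
Definition sym_family (I : eqType) (e : I -> X) (es : I -> X -> K^o)
    (Phi : nat -> R) (C : R) : Prop :=
  [/\ forall i, islin (es i),
      forall i j, es i (e j) = (i == j)%:R,
      forall s (eps : I -> K), uniq s -> (forall n, rabs (eps n) = 1) ->
        rnorm (\sum_(n <- s) eps n *: e n) <= Phi (size s) &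
      forall s f, uniq s ->
        \sum_(n <- s) rabs (es n f) <= C * rnorm f * ((size s)%:R / Phi (size s))].

Lemma sym_family_inj (I J : eqType) (h : J -> I) e es Phi C : injective h ->
  sym_family e es Phi C -> sym_family (e \o h) (es \o h) Phi C.
Proof.
move=> hi [le be E1 E2]; split=> [i|i j|s eps us e1|s f us] /=.
- exact: le.
- by rewrite be (inj_eq hi).
- have us' : uniq (map h s) by rewrite map_inj_uniq.
  have [eps' eE e1'] : exists2 eps' : I -> K, forall j, eps' (h j) = eps j &
      forall i, rabs (eps' i) = 1.
    have h' i : {c : K | rabs c = 1 /\ forall j, h j = i -> c = eps j}.
      apply: cid; have [[j <-]|nj] := pselect (exists j, h j = i).
        by exists (eps j); split=> // j' /hi ->.
      by exists 1; split=> [|j hj]; [exact: rabs1 | case: nj; exists j].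
    exists (fun i => sval (h' i)) => [j|i]; last by case: (h' i) => c [].
    by case: (h' _) => c [_ /= hc]; exact: hc.
  have := E1 _ eps' us' e1'; rewrite big_map size_map.
  by under eq_bigr do rewrite eE.
- have us' : uniq (map h s) by rewrite map_inj_uniq.
  by have := E2 _ f us'; rewrite big_map size_map.
Qed.

Section Consequences.
Variables (I : eqType) (e : I -> X) (es : I -> X -> K^o) (Phi : nat -> R) (C : R).
Hypotheses (qc : quasiconcave Phi) (C0 : 0 <= C) (sf : sym_family e es Phi C).

Lemma sym_sum_le s : uniq s -> rnorm (\sum_(n <- s) e n) <= Phi (size s).
Proof.
case: sf => _ _ E1 _ us; have := E1 _ (fun=> 1) us (fun=> rabs1).
by under eq_bigr do rewrite scale1r.
Qed.

Lemma sym_norm_le i : rnorm (e i) <= Phi 1%N.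
Proof. by have := @sym_sum_le [:: i] isT; rewrite big_seq1. Qed.

Lemma sym_coord_le i f : rabs (es i f) <= C / Phi 1%N * rnorm f.
Proof.
case: sf => _ _ _ E2; have := E2 [:: i] f isT; rewrite big_seq1 /= mul1r => h.
by rewrite mulrAC.
Qed.

Lemma sym_coord_sum_le s f : uniq s ->
  rabs (\sum_(n <- s) es n f) <= C * rnorm f * ((size s)%:R / Phi (size s)).
Proof. by case: sf => _ _ _ E2 us; exact: le_trans (rabs_sum _ _ _) (E2 s f us). Qed.

Lemma sym_weak_le s f t : uniq s -> (forall n, n \in s -> t <= rabs (es n f)) ->
  Phi (size s) * t <= C * rnorm f.
Proof.
move=> us ht; have [Phi0 pos _ _] := qc.
have [s0|s0] := posnP (size s).
  by rewrite s0 Phi0 mul0r mulr_ge0 // rnorm_ge0.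
case: sf => _ _ _ E2; have := E2 s f us.
have : \sum_(n <- s) t <= \sum_(n <- s) rabs (es n f).
  by rewrite big_seq [leRHS]big_seq; apply: ler_sum.
rewrite big_const_seq count_predT iter_addr_0 -[_ *+ _]mulr_natl => h1 h2.
have := le_trans h1 h2; rewrite mulrCA ler_pM2l ?ltr0n //.
by rewrite ler_pdivlMr ?pos // mulrC.
Qed.

(** Duality: the m coordinates of the sum over s are all equal to 1. *)
Lemma sym_sum_ge s : uniq s -> Phi (size s) <= C * rnorm (\sum_(n <- s) e n).
Proof.
move=> us; rewrite -[leLHS]mulr1; apply: sym_weak_le => // n ns.
case: sf => le be _ _; rewrite (islin_sum (le n)) (bigD1_seq n) //=.
rewrite be eqxx big1 ?addr0 ?rabs1 // => j jn.
by rewrite be eq_sym (negPf jn).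
Qed.

End Consequences.

End SymmetricFamilies.

(** * The basis built on blocks *)

Section Blocks.

(** Blocks of geometrically growing sizes: an index is comparable to the size of
    its block, and the first m indices meet about log m blocks. The block j
    starts at 2^j - 1. *)
Definition block (j : nat) : seq nat := index_iota (2 ^ j).-1 (2 ^ j.+1).-1.

Definition block_of (n : nat) : nat := trunc_log 2 n.+1.

Lemma size_block j : size (block j) = (2 ^ j)%N.
Proof. by rewrite size_iota expnS; have := expn_gt0 2 j; lia. Qed.

Lemma uniq_block j : uniq (block j).
Proof. exact: iota_uniq. Qed.

Lemma mem_block j n : (n \in block j) = (block_of n == j).
Proof.
rewrite mem_index_iota /block_of; apply/idP/eqP => [h|<-].
  by apply: trunc_log_eq => //; have := expn_gt0 2 j; have := expn_gt0 2 j.+1; lia.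
have := trunc_log_bounds (isT : (1 < 2)%N) (ltn0Sn n).
by have := expn_gt0 2 (trunc_log 2 n.+1); have := expn_gt0 2 (trunc_log 2 n.+1).+1; lia.
Qed.

Lemma block_of_bounds n : (2 ^ block_of n <= n.+1 < 2 ^ (block_of n).+1)%N.
Proof. exact: trunc_log_bounds. Qed.

End Blocks.

Section DKK.
Context {R : realType} {k : scalar_kind} {X : normedModType (scalar_field R k)}.
Local Notation K := (scalar_field R k).
Variables (Phi : nat -> R) (C CW D : R).
Hypotheses (qc : quasiconcave Phi) (C0 : 0 <= C) (D0 : 0 <= D) (CW0 : 0 <= CW).
Hypothesis hW : forall m, \sum_(0 <= i < m) weight Phi i <= CW * Phi m.
Variables (e : nat -> X) (es : nat -> X -> K^o).
Hypothesis sf : sym_family e es Phi C.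

Definition blkw (j : nat) : R := (2 ^ j)%:R.

Definition eavg j : X := emb (blkw j)^-1 *: \sum_(i <- block j) e i.
Definition savg j : X -> K^o := fun f => emb (blkw j)^-1 * \sum_(i <- block j) es i f.
Definition osc n : X := e n - eavg (block_of n).
Definition oscs n : X -> K^o := fun f => es n f - savg (block_of n) f.

Lemma blkw_gt0 j : 0 < blkw j.
Proof. by rewrite ltr0n expn_gt0. Qed.

Lemma blkw_ge0 j : 0 <= blkw j.
Proof. exact: ler0n. Qed.

Lemma emb_blkwE j : emb (blkw j) = (2 ^ j)%:R :> K.
Proof. exact: rmorph_nat. Qed.

Lemma embV_neq0 (t : R) : t != 0 -> emb t^-1 * emb t = 1 :> K.
Proof. by move=> t0; rewrite -rmorphM /= mulVf // rmorph1. Qed.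

Lemma savg_lin j : islin (savg j).
Proof. by apply/islin_scale/islin_bigsum => i; case: sf. Qed.

Lemma oscs_lin n : islin (oscs n).
Proof. by apply: islin_sub; [case: sf | exact: savg_lin]. Qed.

Lemma sum_block_delta j n :
  \sum_(i <- block j) ((n == i)%:R : K) = (block_of n == j)%:R.
Proof.
rewrite -mem_block; have [nj|nj] := boolP (n \in block j).
  rewrite (bigD1_seq n) ?uniq_block //= eqxx big1 ?addr0 // => i.
  by rewrite eq_sym => /negPf ->.
rewrite big_seq big1 // => i ij; case: eqP => // ni.
by rewrite ni ij in nj.
Qed.

Lemma es_eavg m j : es m (eavg j) = emb (blkw j)^-1 * (block_of m == j)%:R.
Proof.
case: sf => le be _ _; rewrite (islinZ (le m)) (islin_sum (le m)) -sum_block_delta.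
by congr (_ * _); apply: eq_bigr => i _; rewrite be.
Qed.

Lemma savg_e j n : savg j (e n) = emb (blkw j)^-1 * (block_of n == j)%:R.
Proof.
case: sf => le be _ _; rewrite /savg -sum_block_delta.
by congr (_ * _); apply: eq_bigr => i _; rewrite be eq_sym.
Qed.

Lemma savg_eavg i j : savg i (eavg j) = emb (blkw j)^-1 * (i == j)%:R.
Proof.
rewrite /savg; under eq_big_seq => m.
  rewrite mem_block => /eqP mi; rewrite es_eavg mi; over.
rewrite big_const_seq count_predT iter_addr_0 size_block -[_ *+ _]mulr_natl.
rewrite -emb_blkwE mulrA embV_neq0 ?mul1r //.
by rewrite gt_eqF // blkw_gt0.
Qed.

Lemma oscs_osc m n : oscs m (osc n) =
  (m == n)%:R - emb (blkw (block_of n))^-1 * (block_of m == block_of n)%:R.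
Proof.
rewrite /osc (islinB (oscs_lin m)) /oscs es_eavg savg_e savg_eavg.
by case: sf => _ -> _ _; have [->|_] := eqVneq (block_of m) (block_of n);
  rewrite ?mulr1 ?mulr0 /=; ring.
Qed.

Lemma oscs_eavg m j : oscs m (eavg j) = 0.
Proof.
by rewrite /oscs es_eavg savg_eavg subrr.
Qed.

Lemma savg_osc j n : savg j (osc n) = 0.
Proof.
rewrite /osc (islinB (savg_lin j)) savg_e savg_eavg.
by rewrite eq_sym; case: eqP => [->|_]; rewrite ?mulr0 subrr.
Qed.

Lemma sum_osc j : \sum_(n <- block j) osc n = 0.
Proof.
under eq_big_seq => m do
  (rewrite mem_block => /eqP mi; rewrite /osc mi; over).
rewrite big_split /= sumrN big_const_seq count_predT iter_addr_0 size_block.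
rewrite -scaler_nat -emb_blkwE /eavg scalerA mulrC embV_neq0 ?scale1r ?subrr //.
by rewrite gt_eqF // blkw_gt0.
Qed.

Lemma eavg_norm j : rnorm (eavg j) <= Phi (2 ^ j)%N / blkw j.
Proof.
rewrite rnormZ rabs_emb ger0_norm ?invr_ge0 ?blkw_ge0 // mulrC.
rewrite ler_wpM2r ?invr_ge0 ?blkw_ge0 // -(size_block j).
exact: (sym_sum_le sf (uniq_block j)).
Qed.

Lemma savg_norm j f : rabs (savg j f) <= C / Phi (2 ^ j)%N * rnorm f.
Proof.
rewrite rabsM rabs_emb ger0_norm ?invr_ge0 ?blkw_ge0 // mulrC.
rewrite ler_pdivrMr ?blkw_gt0 //.
have := sym_coord_sum_le sf f (uniq_block j); rewrite size_block -/(blkw j).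
by move=> h; apply: le_trans h _; rewrite le_eqVlt; apply/orP; left; apply/eqP; ring.
Qed.

(** The indices of a block are comparable to its size. *)
Lemma block_weight_le n :
  Phi (2 ^ block_of n)%N / blkw (block_of n) <= 2 * weight Phi n.
Proof.
have /andP[h1 h2] := block_of_bounds n; have [_ pos mono _] := qc.
rewrite /weight mulrCA ler_pM ?qc_ge0 ?invr_ge0 ?blkw_ge0 ?mono //.
rewrite -[leLHS]mul1r ler_pdivrMr ?blkw_gt0 // mulrAC ler_pdivlMr ?ltr0n // mul1r.
by rewrite -natrM ler_nat -expnS ltnW.
Qed.

Lemma block_Phi_le n : (Phi (2 ^ block_of n)%N)^-1 <= 2 * (Phi n.+1)^-1.
Proof.
have /andP[h1 h2] := block_of_bounds n; have [_ pos mono _] := qc.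
have p1 : 0 < Phi (2 ^ block_of n)%N by rewrite pos // expn_gt0.
rewrite -[leLHS]mul1r ler_pdivrMr // mulrAC ler_pdivlMr ?pos // mul1r.
apply: le_trans (qc_mull 2 _ qc); apply: mono.
by rewrite -expnS ltnW.
Qed.

Variables (y : nat -> X) (ys : nat -> X -> K^o).
Hypothesis ys_lin : forall j, islin (ys j).
Hypothesis ys_y : forall i j, ys i (y j) = (i == j)%:R.
Hypothesis y_norm : forall j, rnorm (y j) <= D.
Hypothesis ys_norm : forall j f, rabs (ys j f) <= D * rnorm f.
Hypothesis ys_osc : forall j n, ys j (osc n) = 0.
Hypothesis oscs_y : forall n j, oscs n (y j) = 0.

(** The block sums of [dkk] are multiples of y, while its oscillations are those
    of e; [dkks] is the biorthogonal sequence. *)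
Definition dkk n : X := let j := block_of n in
  osc n + emb (Phi (2 ^ j)%N / blkw j) *: y j.

Definition dkks n : X -> K^o := fun f => let j := block_of n in
  oscs n f + emb (Phi (2 ^ j)%N)^-1 * ys j f.

Lemma dkks_lin n : islin (dkks n).
Proof. by apply: islin_add; [exact: oscs_lin | exact: islin_scale]. Qed.

Lemma Phi_pow_gt0 j : 0 < Phi (2 ^ j)%N.
Proof. by case: qc => _ pos _ _; rewrite pos // expn_gt0. Qed.

Lemma dkks_dkk m n : dkks m (dkk n) = (m == n)%:R.
Proof.
rewrite /dkks /dkk (islinD (oscs_lin m)) (islinZ (oscs_lin m)) oscs_y mulr0 addr0.
rewrite (islinD (ys_lin _)) (islinZ (ys_lin _)) ys_osc add0r ys_y oscs_osc.
rewrite -[RHS]addr0 -addrA; congr (_ + _).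
case: eqP => [->|_]; rewrite ?mulr0 ?oppr0 ?addr0 // !mulr1 rmorphM /= mulrA.
by rewrite embV_neq0 ?gt_eqF ?Phi_pow_gt0 // mul1r addNr.
Qed.

Lemma sum_dkk_block j : \sum_(n <- block j) dkk n = emb (Phi (2 ^ j)%N) *: y j.
Proof.
under eq_big_seq => m do
  (rewrite mem_block => /eqP mi; rewrite /dkk mi; over).
rewrite big_split /= sum_osc add0r big_const_seq count_predT iter_addr_0.
rewrite size_block -scaler_nat -emb_blkwE scalerA -rmorphM /= mulrCA divff ?mulr1 //.
by rewrite gt_eqF // blkw_gt0.
Qed.

Lemma dkk_near n : rnorm (dkk n - e n) <= 2 * (1 + D) * weight Phi n.
Proof.
rewrite /dkk /osc; set j := block_of n.
have -> : e n - eavg j + emb (Phi (2 ^ j)%N / blkw j) *: y j - e n =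
    emb (Phi (2 ^ j)%N / blkw j) *: y j - eavg j.
  by rewrite -addrA addrC addrA subrK addrC.
apply: le_trans (rnormB _ _) _; rewrite rnormZ rabs_emb ger0_norm; last first.
  by rewrite divr_ge0 ?blkw_ge0 ?qc_ge0.
have h := block_weight_le n; rewrite -/j in h.
have h0 : 0 <= Phi (2 ^ j)%N / blkw j by rewrite divr_ge0 ?blkw_ge0 ?qc_ge0.
have := ler_wpM2l h0 (y_norm j); have := eavg_norm j.
have : (1 + D) * (Phi (2 ^ j)%N / blkw j) <= (1 + D) * (2 * weight Phi n).
  by rewrite ler_wpM2l // addr_ge0.
lra.
Qed.

(** Upper democracy with signs: the perturbation [dkk n - e n] is summable
    against the Hardy sum of the weights. *)
Lemma dkk_democracy s (eps : nat -> K) : uniq s -> (forall n, rabs (eps n) = 1) ->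
  rnorm (\sum_(n <- s) eps n *: dkk n) <=
    (1 + 2 * (1 + D) * (CW + 1)) * Phi (size s).
Proof.
move=> us e1; have -> : \sum_(n <- s) eps n *: dkk n =
    \sum_(n <- s) eps n *: e n + \sum_(n <- s) eps n *: (dkk n - e n).
  by rewrite -big_split /=; apply: eq_bigr => n _; rewrite -scalerDr subrKC.
apply: le_trans (rnormD _ _) _; rewrite mulrDl mul1r lerD //.
  by case: sf => _ _ E1 _; exact: E1.
apply: le_trans (rnorm_sum _ _ _) _.
apply: (@le_trans _ _ (2 * (1 + D) * \sum_(n <- s) weight Phi n)).
  rewrite mulr_sumr; apply: ler_sum => n _.
  by rewrite rnormZ e1 mul1r dkk_near.
rewrite -[leRHS]mulrA ler_wpM2l ?mulr_ge0 ?addr_ge0 //.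
exact: sum_weight_uniq_le.
Qed.

Lemma dkks_near n f : rabs (dkks n f) <=
  rabs (es n f) + 2 * (C + D) * rnorm f / Phi n.+1.
Proof.
rewrite /dkks /oscs; set j := block_of n.
have h := block_Phi_le n; rewrite -/j in h.
have r0 := rnorm_ge0 f.
have h1 := savg_norm j f.
have h2 : rabs (emb (Phi (2 ^ j)%N)^-1 * ys j f) <= D / Phi (2 ^ j)%N * rnorm f.
  rewrite rabsM rabs_emb ger0_norm ?invr_ge0 ?qc_ge0 // mulrC mulrAC.
  by rewrite ler_wpM2r ?invr_ge0 ?qc_ge0.
have h3 : (C + D) * rnorm f * (Phi (2 ^ j)%N)^-1 <=
    (C + D) * rnorm f * (2 * (Phi n.+1)^-1).
  by rewrite ler_wpM2l // mulr_ge0 // addr_ge0.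
apply: le_trans (rabsD _ _) _; have := rabsD (es n f) (- savg j f); rewrite rabsN.
lra.
Qed.

(** Lower democracy in weak form: large coordinates either come from the
    symmetric family, or from a block term, which bounds their position. *)
Lemma dkk_weak f : gauge_le (weak_val Phi) (fun n => dkks n f)
  ((2 * C + 4 * (C + D)) * rnorm f).
Proof.
have [Phi0 pos mono _] := qc; have r0 := rnorm_ge0 f.
have A0 : 0 <= (2 * C + 4 * (C + D)) * rnorm f.
  by rewrite mulr_ge0 // addr_ge0 // mulr_ge0 // addr_ge0.
move=> s us; apply: weak_val_le => // t ht.
have [t0|t0] := leP t 0.
  by apply: le_trans A0; rewrite mulr_ge0_le0 // qc_ge0.
pose p n := t / 2 <= rabs (es n f).
have u1 : uniq [seq n <- s | p n] by exact: filter_uniq.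
have u2 : uniq [seq n <- s | ~~ p n] by exact: filter_uniq.
have e1 : Phi (size [seq n <- s | p n]) * (t / 2) <= C * rnorm f.
  apply: (sym_weak_le qc C0 sf) => // n.
  by rewrite mem_filter => /andP[].
have e2 : Phi (size [seq n <- s | ~~ p n]) * (t / 2) <= 2 * (C + D) * rnorm f.
  set s2 := [seq n <- s | ~~ p n] in u2 *.
  have [s20|s20] := posnP (size s2).
    by rewrite s20 Phi0 mul0r mulr_ge0 // mulr_ge0 // addr_ge0.
  have [n ns2 nb] : exists2 n, n \in s2 & (size s2 <= n.+1)%N.
    apply: contrapT => hn.
    have /(uniq_leq_size u2) : {subset s2 <= iota 0 (size s2).-1}.
      move=> n ns; rewrite mem_iota add0n /= ltnNge; apply/negP => h.
      by apply: hn; exists n => //; rewrite -(prednK s20) ltnS.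
    by rewrite size_iota; case: (size s2) s20 => // ? _; rewrite ltnn.
  move: (ns2); rewrite mem_filter /p -ltNge => /andP[pn /ht hn].
  have := dkks_near n f.
  have : t / 2 <= 2 * (C + D) * rnorm f / Phi n.+1 ->
      Phi n.+1 * (t / 2) <= 2 * (C + D) * rnorm f.
    by rewrite ler_pdivlMr ?pos // mulrC.
  have : Phi (size s2) * (t / 2) <= Phi n.+1 * (t / 2).
    by rewrite ler_wpM2r ?mono // divr_ge0 // ltW.
  move=> h1 h2 h3; apply: le_trans h1 (h2 _); lra.
have : Phi (size s) <= Phi (size [seq n <- s | p n]) + Phi (size [seq n <- s | ~~ p n]).
  apply: le_trans (qc_subadd _ _ qc); rewrite !size_filter.
  by rewrite count_predC.
move=> /(fun h => ler_wpM2r (ltW t0) h); lra.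
Qed.

End DKK.

(** * Bases between the Lorentz and the weak Lorentz space *)

Section SortedLists.
Context {R : realType}.

Lemma sort_decreasing (I : eqType) (f : I -> R) (s : seq I) :
  exists2 s', perm_eq s' s & pairwise (fun i j => f j <= f i) s'.
Proof.
exists (sort (fun i j => f j <= f i) s); first by rewrite perm_sort.
rewrite -sorted_pairwise; last by move=> i j l h1 h2; exact: le_trans h2 h1.
by apply: sort_sorted => i j; exact: le_total.
Qed.

(** In a decreasing list the first i + 1 moduli are at least the one at i. *)
Lemma weak_sorted_le (k : scalar_kind) (Phi : nat -> R) (a : nat -> (scalar_field R k)^o)
    r s i : quasiconcave Phi -> gauge_le (weak_val Phi) a r -> uniq s ->
  pairwise (fun i j => rabs (a j) <= rabs (a i)) s -> (i < size s)%N ->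
  Phi i.+1 * rabs (a (nth 0%N s i)) <= r.
Proof.
move=> qc ar us ps si.
have st : size (take i.+1 s) = i.+1 by rewrite size_take_min; apply/minn_idPl.
apply: le_trans (ar (take i.+1 s) (take_uniq _ us)).
rewrite -{1}st; apply: le_weak_val => // n /(nthP 0%N) [j]; rewrite st => ji <-.
rewrite nth_take //; have [->//|ne] := eqVneq j i.
by apply: (pairwiseP 0%N ps); rewrite ?inE ?(leq_ltn_trans _ si) // ltn_neqAle ne.
Qed.

End SortedLists.

Section Sandwich.
Context {R : realType} {k : scalar_kind} {X : completeNormedModType (scalar_field R k)}.
Local Notation K := (scalar_field R k).
Variables (Phi : nat -> R) (CW C1 C2 : R) (B : biorth_basis X).
Hypotheses (qc : quasiconcave Phi) (CW0 : 0 <= CW) (C10 : 0 <= C1) (C20 : 0 <= C2).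
Hypothesis hW : forall m, \sum_(0 <= i < m) weight Phi i <= CW * Phi m.
Hypothesis dem : forall s (eps : nat -> K), uniq s -> (forall n, rabs (eps n) = 1) ->
  rnorm (\sum_(n <- s) eps n *: bvec B n) <= C1 * Phi (size s).
Hypothesis wk : forall f,
  gauge_le (weak_val Phi) (fun n => bcoord B n f) (C2 * rnorm f).

Let mono m n : (m <= n)%N -> Phi m <= Phi n.
Proof. by case: qc => _ _ h _; exact: h. Qed.

Let pos m : (0 < m)%N -> 0 < Phi m.
Proof. by case: qc => _ h _ _; exact: h. Qed.

Lemma sum_bvec_sorted (a : nat -> K) s : uniq s -> exists s',
  [/\ perm_eq s' s, uniq s', pairwise (fun i j => rabs (a j) <= rabs (a i)) s' &
    rnorm (\sum_(n <- s) a n *: bvec B n) <=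
      C1 * lorentz_sum Phi [seq rabs (a n) | n <- s']].
Proof.
move=> us; have [s' ss ps] := sort_decreasing (fun n => rabs (a n)) s.
have us' : uniq s' by rewrite (perm_uniq ss).
exists s'; split=> //; rewrite -(perm_big _ ss) /=.
exact: (abel_lorentz qc C10 dem).
Qed.

Lemma sum_bvec_lorentz (a : nat -> K^o) r s : gauge_le (lorentz_sum Phi) a r ->
  uniq s -> rnorm (\sum_(n <- s) a n *: bvec B n) <= C1 * r.
Proof.
move=> ar us; have [s' [ss us' _ h]] := sum_bvec_sorted a us.
by apply: le_trans h _; rewrite ler_wpM2l // ar.
Qed.

(** The i-th largest modulus is at most r / [Phi i], against a weight [Phi i] / i:
    their products sum up to the harmonic sum, which is the logarithm. *)
Lemma sum_bvec_weak (a : nat -> K^o) r s m : gauge_le (weak_val Phi) a r ->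
  uniq s -> (size s <= m)%N ->
  rnorm (\sum_(n <- s) a n *: bvec B n) <= C1 * r * (2 * ln (1 + m%:R)).
Proof.
move=> ar us sm; have [s' [ss us' ps h]] := sum_bvec_sorted a us.
have r0 : 0 <= r by apply: le_trans (ar [::] isT); rewrite /weak_val /= mulr0.
apply: le_trans h _; rewrite -mulrA ler_wpM2l //.
apply: (@le_trans _ _ (\sum_(0 <= i < m) r * (i.+1%:R)^-1)).
  rewrite (lorentz_sumE _ _ 0%N) -(perm_size ss) in sm *.
  rewrite [leRHS](big_cat_nat (leq0n _) sm) /= -[leLHS]addr0 lerD //; last first.
    by apply: sumr_ge0 => i _; rewrite mulr_ge0 ?invr_ge0.
  rewrite big_nat [leRHS]big_nat; apply: ler_sum => i /= si.
  rewrite /weight mulrAC ler_wpM2r ?invr_ge0 //.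
  exact: (weak_sorted_le qc ar us' ps).
by rewrite -mulr_sumr ler_wpM2l // harmonic_le_ln.
Qed.

Lemma bcoord_lin n : islin (bcoord B n).
Proof. by move=> a x y; rewrite linearP. Qed.

Lemma bcoord_bounded : exists2 c, 0 <= c &
  forall n f, rabs (bcoord B n f) <= c * rnorm f.
Proof.
have [c c0 hc] := gauge_le_coord (k := k) (weak_axioms qc).
exists (c * C2); first exact: mulr_ge0.
by move=> n f; rewrite -mulrA; apply: hc (wk f).
Qed.

Lemma fset_bounded (A : {fset nat}) : exists N, forall n, n \in A -> (n < N)%N.
Proof.
exists (\max_(n <- A) n).+1 => n nA; rewrite ltnS.
by rewrite (big_rem n nA) leq_maxl.
Qed.

Lemma bcoord_span (A : {fset nat}) (a : nat -> K) n :
  bcoord B n (\sum_(i <- A) a i *: bvec B i) = if n \in A then a n else 0.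
Proof.
rewrite (islin_sum (bcoord_lin n)).
have bE i : bcoord B n (a i *: bvec B i) = a i * (i == n)%:R.
  by rewrite (islinZ (bcoord_lin n)) bcoord_biorthogonal.
under eq_bigr do rewrite bE.
case: ifPn => nA.
  rewrite (bigD1_seq n) ?fset_uniq //= eqxx mulr1 big1 ?addr0 // => i /negPf ->.
  by rewrite mulr0.
rewrite big_seq big1 // => i iA; case: eqP => [ni|]; last by rewrite mulr0.
by rewrite -ni iA in nA.
Qed.

(** The coordinates of a vector are approximated by those of finite linear
    combinations of the basis, because the coordinate map is bounded. *)
Lemma coords_carrier f : ss_carrier (weak_space k qc) (fun n => bcoord B n f).
Proof.
split=> [|e e0]; first by exists (C2 * rnorm f).
have : closed_span (bvec B) setT f by rewrite bvec_total.
move=> /closure_rnormP /(_ (e / (C2 + 1))) [|g [A [a [_ gE]]] fg].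
  by rewrite divr_gt0 // ltr_wpDl.
exists (fun n => bcoord B n g).
  have [N NP] := fset_bounded A; exists N => n Nn.
  rewrite gE bcoord_span; case: ifPn => // /NP.
  by rewrite ltnNge Nn.
have -> : (fun n => bcoord B n f : K^o) - (fun n => bcoord B n g) =
    (fun n => bcoord B n (f - g)).
  by apply/funext => n; rewrite (islinB (bcoord_lin n)).
apply: gauge_leS (wk (f - g)).
apply: le_trans (ler_wpM2l C20 (ltW fg)) _.
by rewrite mulrCA ger_pMr // ler_pdivrMr ?mul1r ?ltr_wpDl // lerDl.
Qed.

(** The tails are Cauchy because a finitely supported approximation of a does
    not contribute to them. *)
Lemma lorentz_series (a : nat -> K^o) : ss_carrier (lorentz_space k qc) a ->
  cvgn (series (fun n => a n *: bvec B n)) /\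
  rnorm (limn (series (fun n => a n *: bvec B n))) <=
    C1 * ss_norm (lorentz_space k qc) a.
Proof.
move=> [[r ar] ad].
have cv : cvgn (series (fun n => a n *: bvec B n)).
  apply: cauchy_rnorm_cvg => e e0.
  have [|g [N gN] hg] := ad (e / (C1 + 1)); first by rewrite divr_gt0 // ltr_wpDl.
  exists N.
  suff main i j : (N <= i)%N -> (i <= j)%N ->
      rnorm (series (fun n => a n *: bvec B n) j -
             series (fun n => a n *: bvec B n) i) <= e.
    move=> i j Ni Nj; have [ij|/ltnW ji] := leqP i j; last exact: main.
    by rewrite rnormBC; exact: main.
  move=> Ni ij; rewrite /series /= (big_cat_nat (leq0n i) ij) /= addrAC subrr add0r.
  have -> : \sum_(i <= n < j) a n *: bvec B n =
      \sum_(n <- index_iota i j) (a - g) n *: bvec B n.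
    rewrite big_nat [RHS]big_nat; apply: eq_bigr => n /andP[iln _].
    by rewrite -[(a - g) n]/(a n - g n) gN ?subr0 // (leq_trans Ni).
  apply: le_trans (sum_bvec_lorentz hg (iota_uniq _ _)) _.
  by rewrite mulrCA ger_pMr // ler_pdivrMr ?mul1r ?ltr_wpDl // lerDl.
split=> //; apply/ler_addgt0Pr => e e0.
have /cvg_rnormP /(_ e e0) [N /(_ N (leqnn _)) hN] := cv.
have := rnormD (limn (series (fun n => a n *: bvec B n)) -
  series (fun n => a n *: bvec B n) N) (series (fun n => a n *: bvec B n) N).
rewrite subrK => /le_trans; apply; rewrite addrC lerD //.
by apply: sum_bvec_lorentz (iota_uniq _ _); apply: gauge_le_gauge ar.
Qed.

Lemma sandwich_squeeze_symmetric : squeeze_symmetric B.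
Proof.
exists (lorentz_space k qc), (weak_space k qc); split.
- exact: gauge_space_symmetric.
- exact: gauge_space_symmetric.
- by exists C1 => a; exact: lorentz_series.
- exists C2 => f; split; first exact: coords_carrier.
  exact: gauge_leP (wk f).
- split.
    exists (CW + 1); first by rewrite ltr_wpDl.
    by move=> m _; rewrite -EFinM lee_fin weak_fundamental lorentz_fundamental_le.
  exists 1 => // m _; rewrite mul1e lee_fin weak_fundamental.
  exact: lorentz_fundamental_ge.
Qed.

Lemma phi_u_ge0 m : (0 <= phi_u B m)%E.
Proof.
apply: ereal_sup_ubound; exists fset0 => //=.
by rewrite big_seq_fset0 rnorm0.
Qed.

Lemma phi_u_le m : (phi_u B m <= (C1 * Phi m)%:E)%E.
Proof.
apply: ge_ereal_sup => _ [A /= Am <-]; rewrite lee_fin.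
have -> : \sum_(n <- A) bvec B n = \sum_(n <- A) (1 : K) *: bvec B n.
  by apply: eq_bigr => n _; rewrite scale1r.
apply: le_trans (dem (fset_uniq A) (fun=> rabs1)) _.
by rewrite ler_wpM2l // mono.
Qed.

Lemma le_phi_u m : ((Phi m)%:E <= C2%:E * phi_u B m)%E.
Proof.
have h : Phi m <= C2 * rnorm (\sum_(n < m) bvec B n).
  apply: le_trans (wk _ (iota_uniq 0 m)).
  rewrite -[leLHS]mulr1 -{1}(size_iota 0 m); apply: le_weak_val => // n.
  rewrite mem_iota add0n /= => nm.
  rewrite (islin_sum (bcoord_lin n)) (bigD1 (Ordinal nm)) //= big1 => [|i ni].
    by rewrite addr0 bcoord_biorthogonal eqxx rabs1.
  rewrite bcoord_biorthogonal; case: eqP => // i_n.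
  by rewrite -val_eqE /= i_n eqxx in ni.
apply: (@le_trans _ _ (C2%:E * (rnorm (\sum_(n < m) bvec B n))%:E)%E).
  by rewrite -EFinM lee_fin.
rewrite lee_wpmul2l ?lee_fin //; apply: ereal_sup_ubound.
pose A := [fset n in iota 0 m]%fset.
have pA : perm_eq A (iota 0 m).
  by apply: uniq_perm; rewrite ?fset_uniq ?iota_uniq // => n; rewrite inE.
exists A; first by rewrite /= (perm_size pA) size_iota.
by rewrite (perm_big _ pA) /= -[iota 0 m]/(iota 0 m) -{1}[m]subn0 big_mkord.
Qed.

Lemma sandwich_phi_u : equivalent (phi_u B) (fun m => (Phi m)%:E).
Proof.
split.
  exists (C1 + 1); first by rewrite ltr_wpDl.
  move=> m _; apply: le_trans (phi_u_le m) _.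
  by rewrite -EFinM lee_fin mulrDl mul1r lerDl qc_ge0.
exists (C2 + 1); first by rewrite ltr_wpDl.
move=> m _; apply: le_trans (le_phi_u m) _.
by rewrite lee_wpmul2r ?phi_u_ge0 // lee_fin lerDl.
Qed.

(** The i-th largest coordinate is at most C2 |f| / [Phi i]. *)
Lemma sum_coords_dual_le C3 s f : 0 <= C3 ->
  (forall m, \sum_(0 <= i < m) (Phi i.+1)^-1 <= C3 * (m%:R / Phi m)) -> uniq s ->
  \sum_(n <- s) rabs (bcoord B n f) <=
    C2 * rnorm f * (C3 * ((size s)%:R / Phi (size s))).
Proof.
move=> C30 hC3 us.
have [s' ss ps] := sort_decreasing (fun n => rabs (bcoord B n f)) s.
have us' : uniq s' by rewrite (perm_uniq ss).
rewrite -(perm_big _ ss) -(perm_size ss) /=.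
have r0 : 0 <= C2 * rnorm f by rewrite mulr_ge0 // rnorm_ge0.
apply: (@le_trans _ _ (\sum_(0 <= i < size s') C2 * rnorm f * (Phi i.+1)^-1)).
  rewrite (big_nth 0%N) big_nat [leRHS]big_nat; apply: ler_sum => i /= si.
  rewrite ler_pdivlMr ?pos // mulrC.
  exact: (weak_sorted_le (a := fun n => bcoord B n f) qc (wk f) us' ps).
by rewrite -mulr_sumr ler_wpM2l.
Qed.

Lemma dual_norm_ge0 (g : X -> K^o) : (0 <= dual_norm g)%E.
Proof.
apply: (@le_trans _ _ (rabs (g 0))%:E); first by rewrite lee_fin rabs_ge0.
by apply: ereal_sup_ubound; exists 0 => //=; rewrite rnorm0.
Qed.

Lemma sandwich_bidemocratic C3 : 0 <= C3 ->
  (forall m, \sum_(0 <= i < m) (Phi i.+1)^-1 <= C3 * (m%:R / Phi m)) ->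
  bidemocratic B.
Proof.
move=> C30 hC3.
have dual_le m : (0 < m)%N -> (phi_u_dual B m <= (C2 * C3 * (m%:R / Phi m))%:E)%E.
  move=> m0; apply: ge_ereal_sup => _ [A /= Am <-]; apply: ge_ereal_sup.
  move=> _ [f /= f1 <-]; rewrite lee_fin -/(rabs _) fct_sumE.
  apply: le_trans (rabs_sum _ _ _) _.
  apply: le_trans (sum_coords_dual_le f C30 hC3 (fset_uniq A)) _.
  have n0 j : 0 <= j%:R / Phi j by rewrite divr_ge0 // qc_ge0.
  apply: (@le_trans _ _ (C2 * (C3 * (m%:R / Phi m)))); last by rewrite mulrA.
  apply: ler_pM.
  - by rewrite mulr_ge0 // rnorm_ge0.
  - exact: mulr_ge0.
  - by apply: ler_piMr.
  by rewrite ler_wpM2l //; case: (qc_dual qc) => _ _ h _; exact: h.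
have dual_ge0 m : (0 <= phi_u_dual B m)%E.
  apply: le_trans (dual_norm_ge0 (fun=> 0)) _.
  apply: ereal_sup_ubound; exists fset0 => //=.
  by rewrite big_seq_fset0.
apply: (@le_lt_trans _ _ (C1 * (C2 * C3))%:E); last exact: ltry.
apply: ge_ereal_sup => _ [m /= m0 <-].
have mR : 0 < m%:R :> R by rewrite ltr0n.
apply: (@le_trans _ _ ((m%:R^-1)%:E *
    ((C1 * Phi m)%:E * (C2 * C3 * (m%:R / Phi m))%:E))%E).
  apply: lee_wpmul2l; first by rewrite lee_fin invr_ge0.
  by apply: lee_pmul; [exact: phi_u_ge0 | exact: dual_ge0 | exact: phi_u_le |
    exact: dual_le].
rewrite -!EFinM lee_fin le_eqVlt; apply/orP; left; apply/eqP.
by field; rewrite !gt_eqF // pos.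
Qed.

Lemma coord_proj_finite (A : set nat) f m :
  (forall n, (m <= n)%N -> bcoord B n f = 0) ->
  coord_proj B A f =
  \sum_(n <- [seq n <- iota 0 m | n \in A]) bcoord B n f *: bvec B n.
Proof.
move=> f0; set r := [seq n <- iota 0 m | n \in A].
have ur : uniq r by rewrite filter_uniq // iota_uniq.
rewrite /coord_proj (fsbigE _ _ ur).
- rewrite big_filter_cond [RHS]big_filter; apply: eq_bigl => n.
  by rewrite andbb.
- by move=> n /=; rewrite mem_filter => /andP[/set_mem].
- move=> n An; rewrite mem_filter mem_iota add0n /= (mem_set An) /= -leqNgt => mn.
  by rewrite f0 ?scale0r.
Qed.

(** Bounded coordinate functionals vanish on a closed span as soon as they
    vanish on its generators. *)
Lemma bcoord_closed_span m f n : closed_span (bvec B) `I_m f -> (m <= n)%N ->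
  bcoord B n f = 0.
Proof.
move=> fm mn; have [c c0 hc] := bcoord_bounded; apply: rabs_eq0.
apply/eqP; rewrite eq_le rabs_ge0 andbT; apply/ler_addgt0Pr => e e0; rewrite add0r.
move: fm => /closure_rnormP /(_ (e / (c + 1))) [|g [A [a [Am gE]]] fg].
  by rewrite divr_gt0 // ltr_wpDl.
have g0 : bcoord B n g = 0.
  rewrite gE bcoord_span; case: ifPn => // /Am /=.
  by rewrite ltnNge mn.
have := hc n (f - g); rewrite (islinB (bcoord_lin n)) g0 subr0 => /le_trans; apply.
apply: le_trans (ler_wpM2l c0 (ltW fg)) _.
by rewrite mulrCA ger_pMr // ler_pdivrMr ?mul1r ?ltr_wpDl // lerDl.
Qed.

Lemma sandwich_uncond_le :
  lesssim (uncond_parameter B) (fun m => (ln (1 + m%:R))%:E).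
Proof.
exists (C1 * C2 * 2 + 1); first by rewrite ltr_wpDl // !mulr_ge0.
move=> m m0; apply: ge_ereal_sup => _ [f [A [f1 fm ->]]].
rewrite -EFinM lee_fin (@coord_proj_finite A f m); last first.
  by move=> n; exact: bcoord_closed_span.
set s := [seq n <- _ | _].
have us : uniq s by rewrite filter_uniq // iota_uniq.
have sm : (size s <= m)%N by rewrite size_filter -[leqRHS](size_iota 0 m) count_size.
apply: le_trans (sum_bvec_weak (wk f) us sm) _.
have ln0 : 0 <= ln (1 + m%:R) :> R by rewrite ln_ge0 // lerDl.
have : C1 * (C2 * rnorm f) * (2 * ln (1 + m%:R)) <= C1 * C2 * (2 * ln (1 + m%:R)).
  by rewrite ler_wpM2r ?mulr_ge0 // ler_wpM2l // -[leRHS]mulr1 ler_wpM2l.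
lra.
Qed.

(** Conditionality along greedy sets, at every dyadic scale of log m. *)
Hypothesis cond : exists c D : R, [/\ 0 < c, 0 <= D & forall l : nat,
  exists (f : X) (A : {fset nat}),
    [/\ greedy_set B f A, closed_span (bvec B) `I_(2 ^ 2 ^ (l + 4)) f,
        rnorm f <= D & c * (2 ^ l)%:R <= rnorm (coord_proj B [set` A] f) + D]].

Lemma sandwich_not_quasi_greedy : ~ quasi_greedy B.
Proof.
have [c [D [c0 D0 hl]]] := cond; move=> [Q hQ].
pose M := (`|Q| * D + D) / c.
have M0 : 0 <= M by rewrite divr_ge0 ?addr_ge0 ?mulr_ge0 // ltW.
have [l Ml] : exists l, M < (2 ^ l)%:R.
  exists (Num.bound M); apply: lt_le_trans (archi_boundP M0) _.
  by rewrite ler_nat ltnW // ltn_expl.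
have [f [A [gA _ fD low]]] := hl l.
have h1 := hQ f A gA.
have h2 : Q * rnorm f <= `|Q| * D.
  apply: le_trans (ler_wpM2r (rnorm_ge0 f) (ler_norm Q)) _.
  by rewrite ler_wpM2l.
move: Ml; rewrite /M ltr_pdivrMr // [_ * c]mulrC; lra.
Qed.

Lemma uncond_ge1 m : (0 < m)%N -> (1 <= uncond_parameter B m)%E.
Proof.
move=> m0; set x := bvec B 0%N.
have x0 : x != 0.
  apply/eqP => x0; have := bcoord_biorthogonal B 0 0; rewrite -/x x0.
  by rewrite (islin0 (bcoord_lin 0)) eqxx => /eqP; rewrite eq_sym oner_eq0.
have nx := rnorm_gt0 x0.
pose f := emb (rnorm x)^-1 *: x.
have f1 : rnorm f = 1.
  by rewrite rnormZ rabs_emb ger0_norm ?invr_ge0 ?rnorm_ge0 // mulVf // gt_eqF.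
apply: ereal_sup_ubound; exists f, setT; split=> //; first by rewrite f1.
  apply: subset_closure; exists [fset 0%N]%fset, (fun=> emb (rnorm x)^-1).
  split=> [n /=|]; first by rewrite inE => /eqP ->.
  by rewrite big_seq_fset1.
have fE n : bcoord B n f = if n == 0%N then emb (rnorm x)^-1 else 0.
  rewrite (islinZ (bcoord_lin n)) bcoord_biorthogonal eq_sym.
  by case: eqP; rewrite ?mulr1 ?mulr0.
have f0 n : (1 <= n)%N -> bcoord B n f = 0 by case: n => // n _; rewrite fE.
rewrite (coord_proj_finite _ f0).
by rewrite /= in_setT big_seq1 fE eqxx -/x -/f f1.
Qed.

Lemma closed_span_le m m' f : (m <= m')%N ->
  closed_span (bvec B) `I_m f -> closed_span (bvec B) `I_m' f.
Proof.
move=> mm; apply: closure_subset => g [A [a [Am gE]]]; exists A, a; split=> //.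
by move=> n /Am /= nm; exact: leq_trans mm.
Qed.

Lemma coord_projZ (A : set nat) (a : K) f m :
  (forall n, (m <= n)%N -> bcoord B n f = 0) ->
  coord_proj B A (a *: f) = a *: coord_proj B A f.
Proof.
move=> f0; rewrite (coord_proj_finite _ f0) (@coord_proj_finite A (a *: f) m).
  rewrite scaler_sumr; apply: eq_bigr => n _.
  by rewrite (islinZ (bcoord_lin n)) scalerA.
by move=> n mn; rewrite (islinZ (bcoord_lin n)) f0 ?mulr0.
Qed.

Lemma closed_spanZ m (a : K) f :
  closed_span (bvec B) `I_m f -> closed_span (bvec B) `I_m (a *: f).
Proof.
move=> /closure_rnormP hf; apply/closure_rnormP => e e0.
have [|g [A [b [Am gE]]] fg] := hf (e / (rabs a + 1)).
  by rewrite divr_gt0 // ltr_wpDl // rabs_ge0.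
exists (a *: g).
  exists A, (fun n => a * b n); split=> //; rewrite gE scaler_sumr.
  by apply: eq_bigr => n _; rewrite scalerA.
rewrite -scalerBr rnormZ.
have a0 : 0 <= rabs a by exact: rabs_ge0.
have r0 := rnorm_ge0 (f - g).
move: fg; rewrite ltr_pdivlMr ?ltr_wpDl //.
have [r1|r1] := ltP 0 (rnorm (f - g)); first by nra.
have -> : rnorm (f - g) = 0 by apply/eqP; rewrite eq_le r1.
by rewrite mulr0.
Qed.

Lemma ln_nat_le m : (0 < m)%N -> ln (1 + m%:R) <= (trunc_log 2 m).+1%:R :> R.
Proof.
move=> m0; have /andP[_ h] := trunc_log_bounds (isT : (1 < 2)%N) m0.
rewrite -[leRHS]expRK ler_ln ?posrE ?expR_gt0 ?ltr_pwDl //.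
apply: (@le_trans _ _ (2 ^ (trunc_log 2 m).+1)%:R).
  by rewrite nat1r ler_nat.
rewrite natrX -[X in expR X]mulr1 expRM_natl lerXn2r ?nnegrE ?expR_ge0 //.
exact: expR_ge1Dx.
Qed.

(** For m >= 2^16 the scale l is chosen so that 2^(l + 4) is the largest power
    of 2 not above log2 m; for the smaller m it suffices that the parameter is
    at least 1. *)
Lemma sandwich_le_uncond :
  lesssim (fun m => (ln (1 + m%:R))%:E) (uncond_parameter B).
Proof.
have [c [D [c0 D0 hl]]] := cond.
exists (16 + 32 * (2 * D + 1) / c).
  by rewrite ltr_wpDr // divr_ge0 ?(ltW c0) //; lra.
have E0 : 0 <= 32 * (2 * D + 1) / c by rewrite divr_ge0 ?(ltW c0) //; lra.
move=> m m0; have U1 := uncond_ge1 m0; have lnm := ln_nat_le m0.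
have [p16|p16] := ltnP (trunc_log 2 m) 16.
  apply: (@le_trans _ _ (16 + 32 * (2 * D + 1) / c)%:E).
    rewrite lee_fin; apply: le_trans lnm _.
    by rewrite (@le_trans _ _ 16) ?lerDl // ler_nat.
  by rewrite -[leLHS]mule1 lee_wpmul2l // lee_fin addr_ge0.
set p := trunc_log 2 m in lnm p16.
have p0 : (0 < p)%N by apply: leq_trans p16.
have /andP[q1 q2] := trunc_log_bounds (isT : (1 < 2)%N) p0.
set q := trunc_log 2 p in q1 q2.
have q4 : (4 <= q)%N by apply: trunc_log_max.
have [f [A [_ fm fD low]]] := hl (q - 4)%N.
rewrite subnK // in fm.
have {}fm : closed_span (bvec B) `I_m f.
  apply: closed_span_le fm.
  have /andP[h _] := trunc_log_bounds (isT : (1 < 2)%N) m0.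
  by apply: leq_trans h; rewrite leq_exp2l.
pose t := (D + 1)^-1.
have t0 : 0 < t by rewrite invr_gt0 ltr_wpDl.
have hU : ((t * rnorm (coord_proj B [set` A] f))%:E <= uncond_parameter B m)%E.
  apply: ereal_sup_ubound; exists (emb t *: f), [set` A]; split.
  - rewrite rnormZ rabs_emb ger0_norm ?(ltW t0) // /t mulrC ler_pdivrMr ?ltr_wpDl //.
    by rewrite mul1r (le_trans fD) // lerDl.
  - exact: closed_spanZ.
  - rewrite (@coord_projZ _ _ f m) => [|n]; last exact: bcoord_closed_span.
    by rewrite rnormZ rabs_emb ger0_norm ?(ltW t0).
(* 32 * 2 ^ (q - 4) = 2 ^ (q + 1) exceeds log2 m, by maximality of q. *)
have lnq : ln (1 + m%:R) <= 32 * (2 ^ (q - 4))%:R :> R.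
  apply: le_trans lnm _; rewrite -natrM ler_nat (leq_trans q2) //.
  by rewrite -[32%N]/(2 ^ 5)%N -expnD leq_exp2l //; move: q4; clear; lia.
have h2 : ln (1 + m%:R) <=
    32 / c * ((D + 1) * (t * rnorm (coord_proj B [set` A] f)) + D) :> R.
  apply: le_trans lnq _.
  rewrite mulrA [(D + 1) * t]divff ?gt_eqF ?ltr_wpDl // mul1r -mulrA ler_wpM2l //.
  by rewrite mulrC ler_pdivlMr // mulrC.
move: U1 hU h2; case: (uncond_parameter B m) => [u| |] //; last first.
  by move=> _ _ _; rewrite gt0_muley ?leey // lte_fin ltr_wpDr.
rewrite !lee_fin => u1 hu h2; apply: le_trans h2 _.
apply: (@le_trans _ _ (32 / c * ((D + 1) * u + D * u))).
  rewrite ler_wpM2l ?divr_ge0 ?(ltW c0) // lerD ?ler_wpM2l ?addr_ge0 //.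
  by rewrite -[leLHS]mulr1 ler_wpM2l.
rewrite -mulrDl mulrA [32 / c * _]mulrAC; have : 0 <= 16 * u by lra.
have -> : D + 1 + D = 2 * D + 1 by ring.
lra.
Qed.

End Sandwich.

(** * The Hahn-Banach theorem and biorthogonalization *)

Section HahnBanach.
Context {R : realType} {k : scalar_kind} {X : normedModType (scalar_field R k)}.
Local Notation K := (scalar_field R k).

(** Graphs of partial real-linear functionals dominated by the norm; the
    domination alone makes such a linear relation single-valued. *)
Definition dominated_graph (z : X) (G : set (X * R)) : Prop :=
  [/\ forall r x s y t, G (x, s) -> G (y, t) -> G (emb r *: x + y, r * s + t),
      forall x s, G (x, s) -> s <= rnorm x &
      forall p, G p -> G (z, rnorm z)].

(** The empty graph is allowed so that the empty chain has an upper bound; a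
    maximal graph contains the norming functional on the line of z. *)
Lemma dominated_graph_maximal (z : X) : exists G, [/\ dominated_graph z G,
  G (z, rnorm z) & forall G', dominated_graph z G' -> G `<=` G' -> G' `<=` G].
Proof.
have [|G [PG maxG]] := @Zorn_bigcup _ (dominated_graph z).
  move=> F FP Ftot; split=> [r x s y t [G1 F1 h1] [G2 F2 h2]|x s [G FG h]|p [G FG h]].
  - have [G12|G21] := Ftot _ _ F1 F2.
      by have [lin _ _] := FP _ F2; exists G2 => //; apply: lin => //; exact: G12.
    by have [lin _ _] := FP _ F1; exists G1 => //; apply: lin => //; exact: G21.
  - by have [_ dom _] := FP _ FG; exact: dom h.
  - by have [_ _ hz] := FP _ FG; exists G => //; exact: hz h.
have max G' : dominated_graph z G' -> G `<=` G' -> G' `<=` G.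
  move=> PG' GG'; apply: contrapT => nG.
  exact: (maxG G' (conj GG' nG) PG').
exists G; split=> //; have [[p Gp]|nG] := pselect (exists p, G p).
  by case: PG => _ _ hz; exact: hz Gp.
pose L : set (X * R) := [set p | exists r, p = (emb r *: z, r * rnorm z)].
have PL : dominated_graph z L.
  split=> [r x s y t [a [-> ->]] [b [-> ->]]|x s [a [-> ->]]|p _].
  - exists (r * a + b); rewrite rmorphD rmorphM /= scalerDl scalerA.
    by congr (_, _); rewrite mulrDl mulrA.
  - by rewrite rnormZ rabs_emb ler_wpM2r ?rnorm_ge0 // ler_norm.
  - by exists 1; rewrite rmorph1 scale1r mul1r.
have Lz : L (z, rnorm z) by exists 1; rewrite rmorph1 scale1r mul1r.
by apply: (max L) => // p Gp; case: nG; exists p.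
Qed.

(** The one-dimensional extension step: the value c at the new vector has to
    separate the numbers t - |y - x| from the numbers |y + x| - t. *)
Lemma dominated_graph_extend (z x : X) (G : set (X * R)) :
  dominated_graph z G -> G (z, rnorm z) ->
  exists c, exists2 G', dominated_graph z G' & G `<=` G' /\ G' (x, c).
Proof.
move=> [lin dom _] Gz.
have G0 : G (0, 0).
  by have := lin (-1) _ _ _ _ Gz Gz; rewrite rmorphN1 scaleN1r addNr mulN1r addNr.
pose E := [set p.2 - rnorm (p.1 - x) | p in G].
have hE y t : G (y, t) -> ubound E (rnorm (y + x) - t).
  move=> Gy _ [[y' t'] /= Gy' <-].
  have := dom _ _ (lin 1 _ _ _ _ Gy Gy'); rewrite rmorph1 scale1r mul1r => h.
  have := rnormD (y + x) (y' - x).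
  by rewrite addrACA subrr addr0; lra.
have supE : has_sup E.
  split; first by exists (0 - rnorm (0 - x)), (0, 0).
  by exists (rnorm (0 + x) - 0); exact: hE.
pose c := sup E.
have lo y t : G (y, t) -> t - c <= rnorm (y - x).
  move=> Gy; have : t - rnorm (y - x) <= c.
    by apply: ub_le_sup; [case: supE | exists (y, t)].
  lra.
have up y t : G (y, t) -> t + c <= rnorm (y + x).
  move=> Gy; have : c <= rnorm (y + x) - t by apply: ge_sup; [case: supE | exact: hE].
  lra.
have Gs r y t : G (y, t) -> G (emb r *: y, r * t).
  by move=> Gy; have := lin r _ _ _ _ Gy G0; rewrite !addr0.
exists c; exists [set p | exists y t r, G (y, t) /\ p = (y + emb r *: x, t + r * c)].
  split=> [r x1 s1 x2 s2|x1 s1|p _].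
  - move=> [y1 [t1 [r1 [G1 [-> ->]]]]] [y2 [t2 [r2 [G2 [-> ->]]]]].
    exists (emb r *: y1 + y2), (r * t1 + t2), (r * r1 + r2); split; first exact: lin.
    congr (_, _); last by ring.
    by rewrite rmorphD rmorphM /= scalerDr scalerDl scalerA addrACA.
  - move=> [y [t [r [Gy [-> ->]]]]].
    have [r0|r0|->] := ltgtP r 0; last first.
    + by rewrite rmorph0 scale0r mul0r !addr0; exact: dom.
    + have := up _ _ (Gs r^-1 _ _ Gy).
      have -> : y + emb r *: x = emb r *: (emb r^-1 *: y + x).
        by rewrite scalerDr scalerA -rmorphM /= divff ?gt_eqF // rmorph1 scale1r.
      rewrite rnormZ rabs_emb gtr0_norm // => h.
      have := ler_wpM2l (ltW r0) h; rewrite mulrDr mulrA divff ?gt_eqF // mul1r.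
      by [].
    + have := lo _ _ (Gs (- r)^-1 _ _ Gy).
      have rN : 0 < - r by rewrite oppr_gt0.
      have -> : y + emb r *: x = emb (- r) *: (emb (- r)^-1 *: y - x).
        rewrite scalerBr scalerA -rmorphM /= divff ?gt_eqF // rmorph1 scale1r.
        by rewrite rmorphN scaleNr opprK.
      rewrite rnormZ rabs_emb gtr0_norm // => h.
      have := ler_wpM2l (ltW rN) h; rewrite mulrBr mulrA divff ?gt_eqF // mul1r.
      by rewrite mulNr opprK.
  - by exists z, (rnorm z), 0; rewrite rmorph0 scale0r mul0r !addr0.
split=> [[y t] Gy|]; first by exists y, t, 0; rewrite rmorph0 scale0r mul0r !addr0.
by exists 0, 0, 1; rewrite rmorph1 scale1r mul1r !add0r.
Qed.

Lemma real_hahn_banach (z : X) : exists psi : X -> R,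
  [/\ forall r x y, psi (emb r *: x + y) = r * psi x + psi y,
      forall x, `|psi x| <= rnorm x & psi z = rnorm z].
Proof.
have [G [PG Gz maxG]] := dominated_graph_maximal z.
have [lin dom _] := PG.
have Gfun x s t : G (x, s) -> G (x, t) -> s = t.
  move=> Gs Gt.
  have h1 := dom _ _ (lin (-1) _ _ _ _ Gs Gt).
  have h2 := dom _ _ (lin (-1) _ _ _ _ Gt Gs).
  move: h1 h2; rewrite rmorphN1 scaleN1r addNr rnorm0; lra.
have /choice[psi psiP] x : exists s, G (x, s).
  have [c [G' PG' [GG' G'x]]] := dominated_graph_extend x PG Gz.
  by exists c; exact: (maxG G').
exists psi; split=> [r x y|x|].
- by apply: Gfun (psiP _) _; exact: lin.
- rewrite ler_norml dom // andbT lerNl.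
  have h0 : G (0, 0).
    by have := lin (-1) _ _ _ _ Gz Gz; rewrite rmorphN1 scaleN1r addNr mulN1r addNr.
  have := dom _ _ (lin (-1) _ _ _ _ (psiP x) h0).
  by rewrite rmorphN1 scaleN1r !addr0 mulN1r rnormN.
- exact: Gfun (psiP _) Gz.
Qed.

End HahnBanach.

Definition bounded_functional (R : realType) (k : scalar_kind)
    (X : normedModType (scalar_field R k)) (g : X -> (scalar_field R k)^o) : Prop :=
  islin g /\ exists2 C : R, 0 <= C & forall x, rabs (g x) <= C * rnorm x.

(** Over the complex scalars, a real functional psi of which z is a norming
    vector gives the functional psi x - i psi(i x), which has real part psi. *)
Lemma hahn_banach (R : realType) (k : scalar_kind)
    (X : normedModType (scalar_field R k)) (z : X) : z != 0 ->
  exists2 g : X -> (scalar_field R k)^o, bounded_functional g & g z = 1.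
Proof.
move=> z0; have nz := rnorm_gt0 z0.
suff [g bg gz] : exists2 g : X -> (scalar_field R k)^o, bounded_functional g & g z != 0.
  exists (fun x => (g z)^-1 * g x); last by rewrite mulVf.
  case: bg => lg [C C0 hC]; split; first exact: islin_scale.
  exists (rabs (g z)^-1 * C); first by rewrite mulr_ge0 // rabs_ge0.
  by move=> x; rewrite rabsM -mulrA ler_wpM2l // rabs_ge0.
have [psi [lin dom psiz]] := real_hahn_banach z.
case: k X z z0 nz psi lin dom psiz => X z z0 nz psi lin dom psiz.
  exists psi; last by rewrite psiz gt_eqF.
  by split=> //; exists 1 => // x; rewrite mul1r; exact: dom.
pose i := ('i%C : R[i]).
have psi0 : psi 0 = 0 by have := dom 0; rewrite rnorm0 normr_le0 => /eqP.
have psiD x y : psi (x + y) = psi x + psi y.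
  by have := lin 1 x y; rewrite rmorph1 scale1r mul1r.
have psiZ r x : psi (emb r *: x) = r * psi x.
  by have := lin r x 0; rewrite psi0 !addr0.
have ri : rabs (k := complex_scalars) i = 1.
  by rewrite /rabs normc_def /= expr0n /= expr1n add0r sqrtr1.
exists (fun x => (psi x +i* - psi (i *: x))%C); last first.
  by apply/eqP => /(congr1 (@complex.Re R)) /= h; rewrite psiz in h; rewrite h ltxx in nz.
split.
  move=> a x y; case: a => a b.
  have -> : (a +i* b)%C = emb (k := complex_scalars) a + emb (k := complex_scalars) b * i.
    by rewrite /emb /i; simpc.
  have ii : i *: (i *: x) = emb (k := complex_scalars) (-1) *: x.
    by rewrite scalerA /emb /i; simpc.
  have e1 : psi ((emb (k := complex_scalars) a + emb (k := complex_scalars) b * i) *: x + y)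
      = a * psi x + b * psi (i *: x) + psi y.
    by rewrite psiD scalerDl psiD psiZ -scalerA psiZ.
  have e2 : psi (i *: ((emb (k := complex_scalars) a + emb (k := complex_scalars) b * i) *: x + y))
      = a * psi (i *: x) - b * psi x + psi (i *: y).
    rewrite scalerDr psiD scalerDl scalerDr psiD; congr (_ + _ + _).
      by rewrite scalerA mulrC -scalerA psiZ.
    rewrite scalerA mulrC -!scalerA psiZ ii psiZ; ring.
  rewrite e1 e2 /emb /i; simpc.
  by congr (_ +i* _)%C; ring.
exists 2 => // x.
have h : rabs (k := complex_scalars) (psi x +i* - psi (i *: x))%C <=
    `|psi x| + `|psi (i *: x)|.
  have -> : (psi x +i* - psi (i *: x))%C =
      emb (k := complex_scalars) (psi x) + emb (k := complex_scalars) (- psi (i *: x)) * i.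
    by rewrite /emb /i; simpc.
  apply: le_trans (rabsD _ _) _.
  by rewrite rabsM ri mulr1 !rabs_emb normrN.
apply: le_trans h _; have := dom x; have := dom (i *: x).
rewrite rnormZ ri; lra.
Qed.

Section GramSchmidt.
Context {R : realType} {k : scalar_kind} {X : normedModType (scalar_field R k)}.
Local Notation K := (scalar_field R k).

Definition subspace (V : set X) : Prop :=
  V 0 /\ forall (a : K) x y, V x -> V y -> V (a *: x + y).

Lemma subspaceD V x y : subspace V -> V x -> V y -> V (x + y).
Proof. by move=> [_ h] Vx Vy; have := h 1 x y Vx Vy; rewrite scale1r. Qed.

Lemma subspaceZ V a x : subspace V -> V x -> V (a *: x).
Proof. by move=> [V0 h] Vx; have := h a x 0 Vx V0; rewrite addr0. Qed.

Lemma subspaceB V x y : subspace V -> V x -> V y -> V (x - y).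
Proof. by move=> sV Vx Vy; apply: subspaceD => //; rewrite -scaleN1r; exact: subspaceZ. Qed.

Lemma subspace_sum V (I : eqType) (s : seq I) (F : I -> X) : subspace V ->
  (forall i, i \in s -> V (F i)) -> V (\sum_(i <- s) F i).
Proof.
move=> sV VF; rewrite big_seq; apply: big_ind => //; first by case: sV.
by move=> x y; exact: subspaceD.
Qed.

Lemma subspace_ker (g : X -> K^o) : islin g -> subspace [set x | g x = 0].
Proof.
move=> lg; split=> /= [|a x y gx gy]; first exact: islin0.
by rewrite lg gx gy mulr0 addr0.
Qed.

(** Biorthogonalization: z_n is the normalized remainder of d_n, its functional
    a norming functional corrected on z_0, ..., z_(n-1). A vector d_n depending
    on the previous ones contributes z_n = 0. *)
Lemma gram_schmidt (d : nat -> X) : exists (z : nat -> X) (zs : nat -> X -> K^o),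
  [/\ forall n, bounded_functional (zs n),
      forall n, rnorm (z n) <= 1,
      forall n, z n = 0 \/ zs n (z n) = 1,
      forall i j, i != j -> zs i (z j) = 0 &
      forall V, subspace V -> (forall n, V (z n)) <-> (forall n, V (d n))].
Proof.
have normed (w : X) : exists zf : X * (X -> K^o),
    [/\ bounded_functional zf.2, rnorm zf.1 <= 1,
        (zf.1 = 0 /\ zf.2 = fun=> 0) \/ zf.2 zf.1 = 1 &
        zf.1 = emb (rnorm w)^-1 *: w /\ w = emb (rnorm w) *: zf.1].
  have [->|w0] := eqVneq w 0.
    exists (0, fun=> 0) => /=; rewrite rnorm0 rmorph0 !scaler0; split=> //; last by left.
    split; first by move=> a x y; rewrite mulr0 addr0.
    by exists 0 => // x; rewrite rabs0 mul0r.
  have [g bg gz] := hahn_banach w0.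
  have nw := rnorm_gt0 w0.
  have ww : w = emb (rnorm w) *: (emb (rnorm w)^-1 *: w).
    by rewrite scalerA -rmorphM /= divff ?gt_eqF // rmorph1 scale1r.
  exists (emb (rnorm w)^-1 *: w, fun x => emb (rnorm w) * g x) => /=; split=> //.
  - case: bg => lg [C C0 hC]; split; first exact: islin_scale.
    exists (rnorm w * C); first by rewrite mulr_ge0 // rnorm_ge0.
    move=> x; rewrite rabsM rabs_emb ger0_norm ?rnorm_ge0 // -mulrA.
    by rewrite ler_wpM2l // rnorm_ge0.
  - by rewrite rnormZ rabs_emb ger0_norm ?invr_ge0 ?rnorm_ge0 // mulVf // gt_eqF.
  - right; rewrite (islinZ bg.1) gz mulr1 -rmorphM /= divff ?rmorph1 //.
    by rewrite gt_eqF.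
have /choice[nf nfP] := normed.
pose rem n (L : seq (X * (X -> K^o))) := d n - \sum_(p <- L) p.2 (d n) *: p.1.
pose step n L := let p := nf (rem n L) in
  (p.1, fun x => p.2 x - \sum_(q <- L) p.2 q.1 * q.2 x).
pose fix gs n : seq (X * (X -> K^o)) :=
  if n is n'.+1 then rcons (gs n') (step n' (gs n')) else [::].
pose g n := step n (gs n).
have gsE n : gs n = [seq g i | i <- iota 0 n].
  elim: n => // n IH; rewrite -[n.+1]addn1 iotaD map_cat /= -IH add0n cats1.
  by rewrite addn1.
pose z n := (g n).1; pose zs n := (g n).2.
pose w n := d n - \sum_(i <- iota 0 n) zs i (d n) *: z i.
have remE n : rem n (gs n) = w n by rewrite /rem gsE big_map.
have zE n : z n = (nf (w n)).1 by rewrite /z /g /step remE.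
have zsE n x : zs n x = (nf (w n)).2 x -
    \sum_(i <- iota 0 n) (nf (w n)).2 (z i) * zs i x.
  by rewrite /zs /g /step /= remE gsE big_map.
have inv n : [/\ bounded_functional (zs n),
    (z n = 0 /\ zs n = fun=> 0) \/ zs n (z n) = 1,
    forall i, (i < n)%N -> zs i (z n) = 0 &
    forall i, (i < n)%N -> zs n (z i) = 0].
  elim/ltn_ind: n => n IH.
  have [bn _ alt [znE _]] := nfP (w n).
  have delta (c : nat -> K) i : (i < n)%N ->
      \sum_(j <- iota 0 n) c j * zs i (z j) = c i * zs i (z i).
    move=> im; rewrite (bigD1_seq i) ?iota_uniq ?mem_iota //= big1_seq ?addr0 //.
    move=> j /andP[ji]; rewrite mem_iota add0n /= => jn.
    have [ij|ij] := ltnP i j.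
      by have [_ _ h _] := IH j jn; rewrite h ?mulr0.
    have [_ _ _ h] := IH i im; rewrite h ?mulr0 //.
    by rewrite ltn_neqAle ji.
  have delta' (c : nat -> K) i : (i < n)%N ->
      \sum_(j <- iota 0 n) c j * zs j (z i) = c i * zs i (z i).
    move=> im; rewrite (bigD1_seq i) ?iota_uniq ?mem_iota //= big1_seq ?addr0 //.
    move=> j /andP[ji]; rewrite mem_iota add0n /= => jn.
    have [ij|ij] := ltnP i j.
      by have [_ _ _ h] := IH j jn; rewrite h ?mulr0.
    have [_ _ h _] := IH i im; rewrite h ?mulr0 //.
    by rewrite ltn_neqAle ji.
  have zw i : (i < n)%N -> zs i (w n) = 0.
    move=> im; have [[li _] alti _ _] := IH i im.
    rewrite (islinB li) (islin_sum li).
    under eq_bigr do rewrite (islinZ li).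
    rewrite delta //; case: alti => [[_ ->]|->]; first by rewrite mul0r subrr.
    by rewrite mulr1 subrr.
  have zn i : (i < n)%N -> zs i (z n) = 0.
    move=> im; have [[li _] _ _ _] := IH i im.
    by rewrite zE znE (islinZ li) zw // mulr0.
  split=> //.
  - split.
      have -> : zs n = fun x => (nf (w n)).2 x -
          \sum_(i <- iota 0 n) (nf (w n)).2 (z i) * zs i x by apply/funext => x.
      apply: islin_sub; first by case: bn.
      move=> a x y; rewrite mulr_sumr -big_split /= big_seq [RHS]big_seq.
      apply: eq_bigr => i; rewrite mem_iota add0n /= => im.
      by have [[li _] _ _ _] := IH i im; rewrite li; ring.
    have [D D0 hD] : exists2 D : R, 0 <= D & forall x,
        rabs (\sum_(i <- iota 0 n) (nf (w n)).2 (z i) * zs i x) <= D * rnorm x.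
      have : forall i, i \in iota 0 n -> (i < n)%N.
        by move=> i; rewrite mem_iota.
      elim: (iota 0 n) => [|i s IHs] si.
        by exists 0 => // x; rewrite big_nil rabs0 mul0r.
      have [|D D0 hD] := IHs; first by move=> j js; apply: si; rewrite inE js orbT.
      have [[_ [D' D'0 hD']] _ _ _] := IH i (si i (mem_head _ _)).
      exists (rabs ((nf (w n)).2 (z i)) * D' + D).
        by rewrite addr_ge0 // mulr_ge0 // rabs_ge0.
      move=> x; rewrite big_cons; apply: le_trans (rabsD _ _) _.
      by rewrite mulrDl lerD // rabsM -mulrA ler_wpM2l // rabs_ge0.
    case: bn => _ [C C0 hC]; exists (C + D); first exact: addr_ge0.
    move=> x; rewrite zsE; apply: le_trans (rabsD _ _) _.
    by rewrite rabsN mulrDl lerD.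
  - case: alt => [[z0 f0]|f1]; [left|right].
      rewrite zE; split=> //; apply/funext => x; rewrite zsE f0 big1 ?subr0 // => i _.
      by rewrite mul0r.
    rewrite zsE -zE in f1 *; rewrite f1 big1_seq ?subr0 // => i.
    by rewrite mem_iota add0n /= => im; rewrite zn // mulr0.
  - move=> i im; rewrite zsE delta' //.
    have [_ alti _ _] := IH i im; case: alti => [[-> _]|->].
      by rewrite (islin0 bn.1) mul0r subrr.
    by rewrite mulr1 subrr.
exists z, zs; split=> [n|n|n|i j|V sV].
- by case: (inv n).
- by rewrite zE; case: (nfP (w n)).
- by case: (inv n) => _ [[? _]|?] _ _; [left|right].
- rewrite neq_ltn => /orP[ij|ij]; first by case: (inv j) => _ _ h _; exact: h.
  by case: (inv i) => _ _ _ h; exact: h.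
have dE n : d n = w n + \sum_(i <- iota 0 n) zs i (d n) *: z i by rewrite subrK.
split=> [Vz n|Vd n].
  rewrite dE; apply: subspaceD => //.
    by have [_ _ _ [_ ->]] := nfP (w n); apply: subspaceZ => //; rewrite -zE.
  by apply: subspace_sum => // i _; exact: subspaceZ.
elim/ltn_ind: n => n IH.
have [_ _ _ [h _]] := nfP (w n); rewrite zE h; apply: subspaceZ => //.
apply: subspaceB => //; apply: subspace_sum => // i; rewrite mem_iota add0n /= => im.
by apply: subspaceZ => //; exact: IH.
Qed.

End GramSchmidt.

(** * The symmetric family in a complemented copy of S *)

Section BoundedLinear.
Context {R : realType} {k : scalar_kind}.
Local Notation K := (scalar_field R k).

Lemma continuous_rnorm_bounded (X Y : normedModType K) (f : {linear X -> Y}) :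
  continuous f -> exists2 D : R, 0 <= D & forall x, rnorm (f x) <= D * rnorm x.
Proof.
move=> /linear_bounded_continuous/linear_boundedP/pinfty_ex_gt0 [r r0 hr].
exists (to_real r); first exact/ltW/to_real_gt0.
move=> x; rewrite -(ler_emb (k := k)) rmorphM /= !emb_rnorm (to_realK (ltW r0)).
exact: hr.
Qed.

Lemma rnorm_bounded_continuous (X Y : normedModType K) (f : {linear X -> Y}) (D : R) :
  (forall x, rnorm (f x) <= D * rnorm x) -> continuous f.
Proof.
move=> hf; apply/linear_bounded_continuous/linear_boundedP.
exists (emb D); split.
  rewrite realE; apply/orP; have [D0|/ltW D0] := leP 0 D; [left|right];
  by rewrite -(rmorph0 (emb : R -> K)) ler_emb.
move=> r Dr x; apply: (@le_trans _ _ (emb D * `|x|)).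
  by rewrite -!emb_rnorm -rmorphM /= ler_emb.
by rewrite ler_wpM2r // ltW.
Qed.

End BoundedLinear.

(** The symmetry of a sequence space is stated with bijections of the integers:
    the list s becomes the image of an initial segment. *)
Lemma extend_to_bijection (s : seq nat) N : uniq s -> (forall n, n \in s -> (n < N)%N) ->
  exists sg : nat -> nat, [/\ bijective sg,
    forall i, (i < size s)%N -> sg i = nth 0%N s i &
    forall i, (sg i < N)%N = (i < N)%N].
Proof.
move=> us sN; pose t := s ++ [seq n <- iota 0 N | n \notin s].
have ut : uniq t.
  rewrite cat_uniq us filter_uniq ?iota_uniq // andbT.
  by apply/hasPn => n; rewrite mem_filter => /andP[].
have tE n : (n \in t) = (n < N)%N.
  rewrite mem_cat mem_filter mem_iota add0n /=.
  by case: (boolP (n \in s)) => // /sN ->.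
have st : size t = N.
  rewrite -(size_iota 0 N); apply/eqP; rewrite -uniq_size_uniq ?iota_uniq // => n.
  by rewrite tE mem_iota.
exists (fun n => if (n < N)%N then nth 0%N t n else n); split.
- exists (fun n => if (n < N)%N then index n t else n) => n.
    case nN: (n < N)%N; last by rewrite nN.
    by rewrite -tE mem_nth ?st // index_uniq // st.
  case nN: (n < N)%N; last by rewrite nN.
  by rewrite -{1}st index_mem tE nN nth_index // tE.
- move=> i si; have iN : (i < N)%N.
    by rewrite -st size_cat (leq_trans si) // leq_addr.
  by rewrite iN nth_cat si.
- by move=> i; case: ifP => // iN; rewrite -tE mem_nth // st.
Qed.

Lemma rotation_perm m t : perm_eq [seq ((i + t) %% m)%N | i <- iota 0 m] (iota 0 m).
Proof.
have [->//|m0] := posnP m.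
have ut : uniq [seq ((i + t) %% m)%N | i <- iota 0 m].
  rewrite map_inj_in_uniq ?iota_uniq // => i j; rewrite !mem_iota !add0n => /andP[_ im] /andP[_ jm].
  by move=> /eqP; rewrite eqn_modDr !modn_small // => /eqP.
apply: uniq_perm => //; first exact: iota_uniq.
have sub : {subset [seq ((i + t) %% m)%N | i <- iota 0 m] <= iota 0 m}.
  by move=> _ /mapP[i _ ->]; rewrite mem_iota add0n /= ltn_pmod.
by have [|_ h] := uniq_min_size ut sub; rewrite ?size_map.
Qed.

Section SymmetricImage.
Context {R : realType} {k : scalar_kind} {X : normedModType (scalar_field R k)}.
Local Notation K := (scalar_field R k).
Variables (S : sequence_space R k) (T : (nat -> K^o) -> X) (c C : R).
Hypothesis symS : symmetric_space S.
Hypothesis linT : forall (a : K) f g, ss_carrier S f -> ss_carrier S g ->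
  T (a *: f + g) = a *: T f + T g.
Hypotheses (c0 : 0 < c) (C0 : 0 < C).
Hypothesis isoT : forall f, ss_carrier S f ->
  c * ss_norm S f <= rnorm (T f) <= C * ss_norm S f.

Local Notation unit n := (@unit_vec R k n : nat -> K^o).
Local Notation Lam := (fundamental S).

Lemma carrier0 : ss_carrier S 0.
Proof. by apply: ss_c00; exists 0%N. Qed.

Lemma carrier_unit n : ss_carrier S (unit n).
Proof.
apply: ss_c00; exists n.+1 => j nj; rewrite /unit_vec.
by rewrite gtn_eqF.
Qed.

Lemma T0 : T 0 = 0.
Proof.
have := linT (-1) carrier0 carrier0.
by rewrite scaler0 addr0 scaleN1r addNr.
Qed.

Lemma carrierZ (a : K) f : ss_carrier S f -> ss_carrier S (a *: f).
Proof. by move=> hf; have := ss_linear a hf carrier0; rewrite addr0. Qed.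

Lemma ss_norm_rabs (a : K) f : ss_carrier S f -> ss_norm S (a *: f) = rabs a * ss_norm S f.
Proof. exact: ss_normZ. Qed.

Lemma carrierB f g : ss_carrier S f -> ss_carrier S g -> ss_carrier S (f - g).
Proof. by move=> hf hg; have := ss_linear (-1) hg hf; rewrite scaleN1r addrC. Qed.

Lemma TB f g : ss_carrier S f -> ss_carrier S g -> T (f - g) = T f - T g.
Proof.
by move=> hf hg; have := linT (-1) hg hf; rewrite !scaleN1r addrC => ->; rewrite addrC.
Qed.

Lemma carrier_sum (I : Type) (s : seq I) (a : I -> K) (h : I -> nat) :
  ss_carrier S (\sum_(i <- s) a i *: unit (h i)) /\
  T (\sum_(i <- s) a i *: unit (h i)) = \sum_(i <- s) a i *: T (unit (h i)).
Proof.
elim: s => [|i s [IH1 IH2]]; first by rewrite !big_nil T0; split=> //; exact: carrier0.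
rewrite !big_cons; split; first by apply: ss_linear => //; exact: carrier_unit.
by rewrite linT ?IH2 //; exact: carrier_unit.
Qed.

Let e n := T (unit n).

Lemma symmetric_sum_norm (a eps : nat -> K) (sg : nat -> nat) N :
  (forall n, rabs (eps n) = 1) -> bijective sg ->
  ss_norm S (\sum_(0 <= i < N) (eps i * a i) *: unit (sg i)) =
  ss_norm S (\sum_(0 <= i < N) a i *: unit i).
Proof.
move=> e1 sb; rewrite !big_mkord; apply: symS => // n.
exact/rabs_eq1.
Qed.

Lemma sum_signed_norm s (eps : nat -> K) : uniq s -> (forall n, rabs (eps n) = 1) ->
  ss_norm S (\sum_(n <- s) eps n *: unit n) = Lam (size s).
Proof.
move=> us e1.
have [N sN] : exists N, forall n, n \in s -> (n < N)%N.
  by exists (\max_(n <- s) n).+1 => n ns; rewrite ltnS (big_rem n ns) leq_maxl.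
have [sg [sb sE _]] := extend_to_bijection us sN.
rewrite (big_nth 0%N) big_nat.
under eq_bigr => i /= si.
  rewrite -(sE _ si) -[eps _]mulr1; over.
rewrite -big_nat (@symmetric_sum_norm (fun=> 1) (fun i => eps (sg i))) //.
rewrite /fundamental big_mkord; congr (ss_norm S _).
by apply: eq_bigr => i _; rewrite scale1r.
Qed.

Lemma sum_signed_le s (eps : nat -> K) : uniq s -> (forall n, rabs (eps n) = 1) ->
  rnorm (\sum_(n <- s) eps n *: e n) <= C * Lam (size s).
Proof.
move=> us e1; have [h1 h2] := carrier_sum s eps id.
by have /andP[_] := isoT h1; rewrite h2 sum_signed_norm.
Qed.

Lemma sum_ge s : uniq s -> c * Lam (size s) <= rnorm (\sum_(n <- s) e n).
Proof.
move=> us; have [h1 h2] := carrier_sum s (fun=> 1) id.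
have /andP[+ _] := isoT h1; rewrite h2 sum_signed_norm //; last by move=> _; exact: rabs1.
by under [in X in _ <= rnorm X -> _]eq_bigr do rewrite scale1r.
Qed.

(** Averaging over the rotations of s, and over the two signs off s, sends a
    finitely supported g to a multiple of the indicator of s; since all the
    rearrangements of g have the norm of g, the sum of the coordinates over s is
    controlled. *)
Lemma coord_sum_c00 s (eps : nat -> K) g : uniq s -> (0 < size s)%N -> c00 g ->
  (forall n, rabs (eps n) = 1) ->
  rabs (\sum_(n <- s) eps n * g n) * (c * Lam (size s)) <=
    (size s)%:R * (C * ss_norm S g).
Proof.
move=> us s0 [N0 gN0] e1; set m := size s in s0 *.
have [N [sN gN]] : exists N, (forall n, n \in s -> (n < N)%N) /\
    (forall n, (N <= n)%N -> g n = 0).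
  exists (maxn N0 (\max_(n <- s) n).+1); split=> n.
    by move=> ns; rewrite leq_max ltnS (big_rem n ns) leq_maxl orbT.
  by rewrite geq_max => /andP[/gN0].
have mN : (m <= N)%N.
  rewrite -(size_iota 0 N); apply: uniq_leq_size => // n /sN.
  by rewrite mem_iota.
have [sg [sb sE sgN]] := extend_to_bijection us sN.
pose a i := g (sg i).
have normg : ss_norm S g = ss_norm S (\sum_(0 <= i < N) a i *: unit i).
  rewrite -(@symmetric_sum_norm a (fun=> 1) sg N) //; last by move=> _; exact: rabs1.
  congr (ss_norm S _); apply/funext => n; have [tg gt tg'] := sb.
  rewrite -(tg' n) big_mkord.
  rewrite (@sum_unit_vec R k N (fun i => 1 * a i) sg (tg n) (bij_inj sb)).
  case: ifPn; first by rewrite mul1r.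
  by rewrite -leqNgt => h; rewrite gN // leqNgt sgN -leqNgt.
pose l t := [seq nth 0%N s ((i + t) %% m) | i <- iota 0 m].
have pl t : perm_eq (l t) s.
  rewrite /l (map_comp (nth 0%N s) (fun i => (i + t) %% m)%N).
  by rewrite -[X in perm_eq _ X](mkseq_nth 0%N s) perm_map // rotation_perm.
pose ceps i := eps (sg i).
have rot t : rnorm (\sum_(0 <= i < m) (ceps i * a i) *: e (nth 0%N s ((i + t) %% m)))
    <= C * ss_norm S g.
  have [||tau [tb tE _]] := @extend_to_bijection (l t) N.
  - by rewrite (perm_uniq (pl t)).
  - by move=> j; rewrite (perm_mem (pl t)); exact: sN.
  have st : size (l t) = m by rewrite size_map size_iota.
  pose eta (b : K) i := if (i < m)%N then ceps i else b.
  (* The signs b = 1 and b = -1 off s give vectors whose mean is supported on s. *)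
  have bound b : rabs b = 1 ->
      rnorm (\sum_(0 <= i < N) (eta b i * a i) *: e (tau i)) <= C * ss_norm S g.
    move=> b1; have [h1 h2] := carrier_sum (index_iota 0 N) (fun i => eta b i * a i) tau.
    rewrite -h2; have /andP[_ h] := isoT h1; apply: le_trans h _.
    have etab1 i : rabs (eta b i) = 1.
      by rewrite /eta; case: ifP => _; [exact: e1 | exact: b1].
    by rewrite (symmetric_sum_norm a N etab1 tb) normg.
  have split_sum b : \sum_(0 <= i < N) (eta b i * a i) *: e (tau i) =
      \sum_(0 <= i < m) (ceps i * a i) *: e (nth 0%N s ((i + t) %% m)) +
      b *: \sum_(m <= i < N) a i *: e (tau i).
    rewrite (big_cat_nat (leq0n m) mN) /=; congr (_ + _).
      rewrite big_nat [RHS]big_nat; apply: eq_bigr => i /= im.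
      by rewrite /eta im tE ?st // (nth_map 0%N) ?size_iota // nth_iota.
    rewrite scaler_sumr big_nat [RHS]big_nat; apply: eq_bigr => i /andP[mi _].
    by rewrite /eta ltnNge mi scalerA.
  have := bound 1 rabs1; have := bound (-1); rewrite rabsN rabs1 => /(_ erefl).
  rewrite !split_sum scale1r scaleN1r; set u := \sum_(0 <= i < m) _.
  set v := \sum_(m <= i < N) _ => h1 h2.
  have : rnorm (emb 2 *: u) <= rnorm (u - v) + rnorm (u + v).
    apply: le_trans (rnormD _ _); rewrite le_eqVlt; apply/orP; left; apply/eqP.
    congr rnorm; rewrite addrCA subrK.
    by rewrite rmorph_nat scaler_nat mulr2n.
  rewrite rnormZ rabs_emb ger0_norm //; lra.
have sumE : \sum_(0 <= t < m) \sum_(0 <= i < m)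
      (ceps i * a i) *: e (nth 0%N s ((i + t) %% m)) =
    (\sum_(n <- s) eps n * g n) *: (\sum_(n <- s) e n).
  rewrite exchange_big /= [in RHS](big_nth 0%N) scaler_suml.
  rewrite big_nat [RHS]big_nat; apply: eq_bigr => i /= im.
  rewrite -scaler_sumr /ceps /a (sE _ im); congr (_ *: _).
  rewrite -[RHS](perm_big _ (pl i)) /= /l big_map /index_iota subn0.
  by apply: eq_bigr => t _; rewrite addnC.
have h1 : rnorm ((\sum_(n <- s) eps n * g n) *: (\sum_(n <- s) e n)) <=
    m%:R * (C * ss_norm S g).
  rewrite -sumE; apply: le_trans (rnorm_sum _ _ _) _.
  apply: le_trans (ler_sum _ (fun t _ => rot t)) _.
  by rewrite big_const_nat subn0 iter_addr_0 -[_ *+ _]mulr_natl.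
apply: le_trans h1; rewrite rnormZ ler_wpM2l ?rabs_ge0 //.
exact: sum_ge.
Qed.

Lemma Lam_gt0 m : (0 < m)%N -> 0 < Lam m.
Proof.
move=> m0; have h : ss_carrier S (\sum_(n < m) unit n).
  have [h _] := carrier_sum (index_enum 'I_m) (fun=> 1) (fun i : 'I_m => nat_of_ord i).
  by under eq_bigr do rewrite -[unit _](scale1r); exact: h.
rewrite /fundamental lt_def ss_norm_ge0 // andbT; apply/eqP => /(ss_norm_eq0 h).1.
move=> /(congr1 (fun f => f 0%N)).
have -> : \sum_(n < m) unit n = \sum_(n < m) (1 : K) *: unit n.
  by apply: eq_bigr => i _; rewrite scale1r.
rewrite (@sum_unit_vec R k m (fun=> 1) id 0) // m0 => /eqP.
by rewrite oner_eq0.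
Qed.

(** By density of the finitely supported sequences, from [coord_sum_c00] applied
    with the inverse phases of the coordinates. *)
Lemma coord_sum_carrier : exists2 D : R, 0 <= D & forall s h, uniq s ->
  ss_carrier S h ->
  \sum_(n <- s) rabs (h n) <= D * ss_norm S h * ((size s)%:R / Lam (size s)).
Proof.
have [kappa0 quasi0] := ss_quasi_triangle S.
pose kap := `|kappa0|.
have quasi f g : ss_carrier S f -> ss_carrier S g ->
    ss_norm S (f + g) <= kap * (ss_norm S f + ss_norm S g).
  move=> hf hg; apply: le_trans (quasi0 _ _ hf hg) _.
  by rewrite ler_wpM2r ?ler_norm // addr_ge0 // ss_norm_ge0.
have kap_ge0 : 0 <= kap by exact: normr_ge0.
exists (kap * C / c); first by rewrite divr_ge0 ?mulr_ge0 // ltW.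
move=> s h us hh.
have [s0|s0] := posnP (size s).
  by move/size0nil: s0 => ->; rewrite big_nil mul0r mulr0.
have L0 := Lam_gt0 s0.
pose q : R := (size s)%:R / Lam (size s).
have q0 : 0 <= q by rewrite divr_ge0 // ltW.
have [A A0 hA] : exists2 A : R, 0 <= A & forall f, ss_carrier S f ->
    \sum_(n <- s) rabs (f n) <= A * ss_norm S f.
  elim: (s) => [|n s' [A A0 hA]].
    by exists 0 => // f _; rewrite big_nil mul0r.
  have [B hB] := ss_coord_bounded S n.
  exists (`|B| + A); first by rewrite addr_ge0.
  move=> f hf; rewrite big_cons mulrDl lerD ?hA //.
  apply: le_trans (hB f hf) _; rewrite ler_wpM2r ?ler_norm //.
  exact: ss_norm_ge0.
apply/ler_addgt0Pr => d d0.
pose M := A + kap * C / c * q + 1.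
have M0 : 0 < M.
  rewrite /M ltr_wpDl // addr_ge0 // mulr_ge0 // divr_ge0 ?mulr_ge0 //; exact: ltW.
have [|g cg hg] := ss_c00_dense hh (_ : 0 < d / M); first by rewrite divr_gt0.
have hgc : ss_carrier S g by exact: ss_c00.
have gnorm : ss_norm S g <= kap * (ss_norm S h + d / M).
  have -> : g = h + (-1) *: (h - g) by rewrite scaleN1r opprB subrKC.
  apply: le_trans (quasi _ _ hh (carrierZ _ (carrierB hh hgc))) _.
  rewrite (ss_norm_rabs _ (carrierB hh hgc)) rabsN rabs1 mul1r.
  by rewrite ler_wpM2l // lerD2l.
have h1 : \sum_(n <- s) rabs (g n) <= C / c * q * ss_norm S g.
  pose eps n : K := (phase (g n))^-1.
  have e1 n : rabs (eps n) = 1 by rewrite rabsV rabs_phase invr1.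
  have := @coord_sum_c00 s eps g us s0 cg e1.
  under eq_bigr do rewrite phaseVE.
  rewrite -rmorph_sum /= rabs_emb ger0_norm; last first.
    by apply: sumr_ge0 => n _; exact: rabs_ge0.
  rewrite -ler_pdivlMr ?mulr_gt0 // => h1; apply: le_trans h1 _.
  rewrite le_eqVlt; apply/orP; left; apply/eqP; rewrite /q; field.
  by rewrite !gt_eqF.
have h2 : \sum_(n <- s) rabs ((h - g) n) <= A * (d / M).
  by apply: le_trans (hA _ (carrierB hh hgc)) _; rewrite ler_wpM2l.
have h3 : \sum_(n <- s) rabs (h n) <=
    \sum_(n <- s) rabs (g n) + \sum_(n <- s) rabs ((h - g) n).
  rewrite -big_split /=; apply: ler_sum => n _.
  have -> : h n = g n + (h - g) n :> K by rewrite -[(h - g) n]/(h n - g n) subrKC.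
  exact: rabsD.
have Cq0 : 0 <= C / c * q by rewrite mulr_ge0 // divr_ge0 // ltW.
have h4 := ler_wpM2l Cq0 gnorm.
have h5 : (A + kap * C / c * q) * (d / M) <= d.
  rewrite mulrCA ger_pMr // ler_pdivrMr // mul1r /M lerDl //.
rewrite -/q.
have -> : kap * C / c * ss_norm S h * q = C / c * q * (kap * ss_norm S h) by ring.
have h6 : C / c * q * (kap * (ss_norm S h + d / M)) =
   C / c * q * (kap * ss_norm S h) + kap * C / c * q * (d / M) by ring.
rewrite h6 in h4; rewrite mulrDl in h5; lra.
Qed.

Definition sign_sums (m : nat) : set R :=
  [set r | exists s (eps : nat -> K), [/\ uniq s, (size s <= m)%N,
     forall n, rabs (eps n) = 1 & r = rnorm (\sum_(n <- s) eps n *: e n)]].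

(** The upper super-democracy function of the images of the unit vectors: an
    exactly quasi-concave function equivalent to the fundamental function. *)
Definition superdem (m : nat) : R := sup (sign_sums m).

(** A sum over s is the mean of the two sums over a larger set, with the signs +
    and - on the additional indices: this replaces the monotonicity of the
    fundamental function, which a quasi-norm does not give. *)
Lemma sign_sums_le m r : sign_sums m r -> r <= C * Lam m.
Proof.
move=> [s [eps [us sm e1 ->]]].
have [N sN] : exists N, forall n, n \in s -> (n < N)%N.
  by exists (\max_(n <- s) n).+1 => n ns; rewrite ltnS (big_rem n ns) leq_maxl.
pose x := iota N (m - size s).
have sx n : n \in s -> (n < N)%N /\ n \notin x.
  by move=> /sN nN; split=> //; rewrite mem_iota negb_and -ltnNge nN.
have bound (b : K) : rabs b = 1 ->
    rnorm (\sum_(n <- s) eps n *: e n + b *: \sum_(n <- x) e n) <= C * Lam m.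
  move=> b1; pose eta n := if (n < N)%N then eps n else b.
  have -> : \sum_(n <- s) eps n *: e n + b *: \sum_(n <- x) e n =
      \sum_(n <- s ++ x) eta n *: e n.
    rewrite big_cat /= scaler_sumr; congr (_ + _).
      by rewrite big_seq [RHS]big_seq; apply: eq_bigr => n /sN nN; rewrite /eta nN.
    rewrite big_seq [RHS]big_seq; apply: eq_bigr => n; rewrite mem_iota.
    by move=> /andP[Nn _]; rewrite /eta ltnNge Nn.
  have -> : m = size (s ++ x) by rewrite size_cat size_iota subnKC.
  apply: sum_signed_le => [|n]; last by rewrite /eta; case: ifP.
  rewrite cat_uniq us iota_uniq andbT; apply/hasPn => n nx.
  by apply/negP => /sx [_]; rewrite nx.
have := bound 1 rabs1; have := bound (-1); rewrite rabsN rabs1 => /(_ erefl).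
rewrite scale1r scaleN1r; set u := \sum_(n <- s) _; set v := \sum_(n <- x) _.
move=> h1 h2; have : rnorm (emb 2 *: u) <= rnorm (u - v) + rnorm (u + v).
  apply: le_trans (rnormD _ _); rewrite le_eqVlt; apply/orP; left; apply/eqP.
  congr rnorm; rewrite addrCA subrK.
  by rewrite rmorph_nat scaler_nat mulr2n.
rewrite rnormZ rabs_emb ger0_norm //; lra.
Qed.

Lemma sign_sums0 m : sign_sums m 0.
Proof.
by exists [::], (fun=> 1); split=> //= [n|]; rewrite ?rabs1 // big_nil rnorm0.
Qed.

Lemma le_superdem m r : sign_sums m r -> r <= superdem m.
Proof.
by move=> h; apply: ub_le_sup h; exists (C * Lam m) => r'; exact: sign_sums_le.
Qed.

Lemma superdem_le m t : (forall r, sign_sums m r -> r <= t) -> superdem m <= t.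
Proof. by move=> h; apply: ge_sup => //; exists 0; exact: sign_sums0. Qed.

Lemma superdem_fundamental m : c * Lam m <= superdem m <= C * Lam m.
Proof.
apply/andP; split; last exact/superdem_le/sign_sums_le.
apply: (@le_trans _ _ (rnorm (\sum_(n <- iota 0 m) e n))).
  by rewrite -{1}(size_iota 0 m); exact/sum_ge/iota_uniq.
apply: le_superdem; exists (iota 0 m), (fun=> 1); split=> //.
- exact: iota_uniq.
- by rewrite size_iota.
- by move=> _; exact: rabs1.
- by congr rnorm; apply: eq_bigr => n _; rewrite scale1r.
Qed.

(** For [Phi m / m]: a sum over n + 1 indices is the mean of the sums
    over its subsets of n indices, multiplied by (n + 1) / n. *)
Lemma superdem_qc : quasiconcave superdem.
Proof.
have mono m n : (m <= n)%N -> superdem m <= superdem n.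
  move=> mn; apply: superdem_le => r [s [eps [us sm e1 rE]]].
  by apply: le_superdem; exists s, eps; split=> //; exact: leq_trans mn.
have ge0 m : 0 <= superdem m by apply/le_superdem/sign_sums0.
have pos m : (0 < m)%N -> 0 < superdem m.
  move=> m0; have /andP[h _] := superdem_fundamental m.
  by apply: lt_le_trans h; rewrite mulr_gt0 // Lam_gt0.
have step n : (0 < n)%N -> superdem n.+1 / n.+1%:R <= superdem n / n%:R.
  move=> n0; have nR : 0 < n%:R :> R by rewrite ltr0n.
  rewrite ler_pdivrMr // mulrAC ler_pdivlMr //.
  rewrite mulrC -ler_pdivlMl //; apply: superdem_le => _ [s [eps [us sn e1 ->]]].
  rewrite ler_pdivlMl //; set v := \sum_(n <- s) _.
  have [sn'|sn'] := leqP (size s) n.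
    have h : rnorm v <= superdem n by apply: le_superdem; exists s, eps.
    apply: (@le_trans _ _ (n%:R * superdem n)); first by rewrite ler_wpM2l // ltW.
    by rewrite mulrC ler_wpM2l // ler_nat.
  have ss : size s = n.+1 by apply/eqP; rewrite eqn_leq sn sn'.
  have -> : n%:R * rnorm v = rnorm (\sum_(x <- s) \sum_(n <- rem x s) eps n *: e n).
    have -> : \sum_(x <- s) \sum_(n <- rem x s) eps n *: e n = emb n%:R *: v.
      rewrite big_seq; under eq_bigr => x xs.
        have -> : \sum_(n <- rem x s) eps n *: e n = v - eps x *: e x.
          by rewrite /v (big_rem x xs) /= addrAC subrr add0r.
        over.
      rewrite -big_seq big_split /= sumrN -/v big_const_seq count_predT iter_addr_0.
      by rewrite ss mulrSr addrK rmorph_nat scaler_nat.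
    by rewrite rnormZ rabs_emb ger0_norm.
  apply: le_trans (rnorm_sum _ _ _) _.
  apply: (@le_trans _ _ (\sum_(x <- s) superdem n)).
    rewrite big_seq [leRHS]big_seq; apply: ler_sum => x xs.
    apply: le_superdem; exists (rem x s), eps; split=> //; first exact: rem_uniq.
    by rewrite size_rem // ss.
  by rewrite big_const_seq count_predT iter_addr_0 ss -[_ *+ _]mulr_natr.
split=> // [|m n /andP[m0]].
  apply/eqP; rewrite eq_le ge0 andbT; apply: superdem_le => _ [s [eps [_ + _ ->]]].
  by rewrite leqn0 size_eq0 => /eqP ->; rewrite big_nil rnorm0.
elim: n => [|n IH]; first by rewrite leqn0 => /eqP mE; rewrite mE in m0.
rewrite leq_eqVlt => /orP[/eqP ->//|]; rewrite ltnS => mn.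
by apply: le_trans (step n (leq_trans m0 mn)) (IH mn).
Qed.

End SymmetricImage.

Section SequentiallyClosed.
Context {R : realType} {k : scalar_kind} {X : normedModType (scalar_field R k)}.

Definition rclosed (V : set X) : Prop :=
  forall x, (forall d : R, 0 < d -> exists2 y, V y & rnorm (x - y) < d) -> V x.

End SequentiallyClosed.

Section ComplementedFamily.
Context {R : realType} {k : scalar_kind} {X : normedModType (scalar_field R k)}.
Local Notation K := (scalar_field R k).

(** The unit vectors of S give the family, their coordinates composed with the
    inverse isomorphism and the projection give the functionals. *)
Lemma complemented_sym_family (S : sequence_space R k) :
  symmetric_space S -> complemented_subspace S X ->
  exists (Phi : nat -> R) (C c1 c2 : R) (e : nat -> X) (es : nat -> X -> K^o)
      (P : {linear X -> X}) (DP : R),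
    [/\ quasiconcave Phi, 0 <= C, sym_family e es Phi C,
        [/\ 0 < c1, 0 < c2 &
          forall m, c1 * fundamental S m <= Phi m <= c2 * fundamental S m] &
        [/\ 0 <= DP, forall x, rnorm (P x) <= DP * rnorm x,
            forall x, P (P x) = P x, forall n, P (e n) = e n &
            (forall n x, P x = 0 -> es n x = 0) /\
            forall V, subspace V -> rclosed V -> (forall n, V (e n)) ->
              forall x, V (P x)]].
Proof.
move=> symS [T [P [linT [c [C [c0 C0 isoT]]] cP idP rP]]].
have [DP DP0 hP] := continuous_rnorm_bounded cP.
pose e n := T (@unit_vec R k n).
have /choice[h hh] x : exists h, ss_carrier S h /\ T h = P x.
  have : range P (P x) by exists x.
  by rewrite rP => -[h hc hE]; exists h.
have T_inj f g : ss_carrier S f -> ss_carrier S g -> T f = T g -> f = g.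
  move=> hf hg fg; have hfg := carrierB hf hg.
  apply/eqP; rewrite -subr_eq0; apply/eqP/(ss_norm_eq0 hfg).1.
  apply/eqP; rewrite eq_le ss_norm_ge0 // andbT.
  have /andP[+ _] := isoT _ hfg; rewrite (TB linT hf hg) fg subrr rnorm0.
  by rewrite pmulr_rle0.
have Pe n : P (e n) = e n.
  have : (T @` ss_carrier S) (e n) by exists (@unit_vec R k n) => //; exact: carrier_unit.
  by rewrite -rP => -[x _ <-]; rewrite idP.
have h_e n : h (e n) = @unit_vec R k n.
  by have [h1 h2] := hh (e n); apply: T_inj => //; [exact: carrier_unit | rewrite h2 Pe].
have hlin (a : K) x y : h (a *: x + y) = a *: h x + h y.
  have [h1 h2] := hh x; have [h3 h4] := hh y; have [h5 h6] := hh (a *: x + y).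
  by apply: T_inj => //; [exact: ss_linear | rewrite h6 linT // h2 h4 linearP].
have [D D0 hD] := coord_sum_carrier symS linT c0 C0 isoT.
have qc := superdem_qc symS linT c0 isoT.
have fund := superdem_fundamental symS linT isoT.
exists (superdem T), (D / c * DP * C), c, C, e, (fun n x => h x n), P, DP.
split=> //.
- by rewrite mulr_ge0 ?(ltW C0) // mulr_ge0 // divr_ge0 // ltW.
- split=> [n a x y|i j|s eps us e1|s f us].
  + by rewrite hlin.
  + by rewrite h_e.
  + apply: (le_superdem symS linT isoT).
    by exists s, eps.
  + have [h1 h2] := hh f.
    have [s0|s0] := posnP (size s).
      by move/size0nil: s0 => ->; rewrite big_nil mul0r mulr0.
    apply: le_trans (hD s _ us h1) _.
    have L0 := Lam_gt0 linT s0.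
    have F0 : 0 < superdem T (size s) by case: qc => _ pos _ _; exact: pos.
    have /andP[_ FL] := fund (size s).
    have /andP[hl _] := isoT _ h1.
    have hn : ss_norm S (h f) <= DP * rnorm f / c.
      by rewrite ler_pdivlMr // mulrC (le_trans hl) // h2.
    have hL : (fundamental S (size s))^-1 <= C / superdem T (size s).
      by rewrite -[leLHS]mul1r ler_pdivrMr // mulrAC ler_pdivlMr // mul1r.
    apply: (@le_trans _ _ (D * (DP * rnorm f / c) * ((size s)%:R * (C / superdem T (size s))))).
      apply: ler_pM.
      + by rewrite mulr_ge0 // ss_norm_ge0.
      + by rewrite mulr_ge0 // invr_ge0 ltW.
      + by rewrite ler_wpM2l.
      + by rewrite ler_wpM2l.
    rewrite le_eqVlt; apply/orP; left; apply/eqP; field.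
    by rewrite !gt_eqF.
- split=> //; split=> [n x Px0|V sV cV Ve x].
    have [h1 h2] := hh x; have -> : h x = 0; last by [].
    apply: T_inj => //; first exact: carrier0.
    by rewrite h2 Px0 (T0 linT).
  have [h1 h2] := hh x; apply: cV => d d0.
  have [|g cg hg] := ss_c00_dense h1 (_ : 0 < d / (2 * C)); first by rewrite divr_gt0 // mulr_gt0.
  have gc : ss_carrier S g by exact: ss_c00.
  have [N gN] := cg.
  have gE : g = \sum_(i <- index_iota 0 N) g i *: (@unit_vec R k i : nat -> K^o).
    apply/funext => n; rewrite big_mkord (@sum_unit_vec R k N g id n) //.
    by case: ltnP => [_ //|/gN ->].
  exists (T g).
    have [_ TE] := carrier_sum linT (index_iota 0 N) g id.
    rewrite gE TE; apply: subspace_sum => // i _.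
    by apply: subspaceZ => //; exact: Ve.
  rewrite -h2 -(TB linT) //.
  have /andP[_ h3] := isoT _ (carrierB h1 gc); apply: le_lt_trans h3 _.
  apply: (@le_lt_trans _ _ (C * (d / (2 * C)))); first by rewrite ler_pM2l.
  have -> : C * (d / (2 * C)) = d / 2 by field; rewrite gt_eqF.
  lra.
Qed.

End ComplementedFamily.

(** * Transfer of the regularity properties *)

Section Regularity.
Context {R : realType}.
Variables (L Phi : nat -> R) (c1 c2 : R).
Hypotheses (c10 : 0 < c1) (c20 : 0 < c2).
Hypothesis LPhi : forall m, c1 * L m <= Phi m <= c2 * L m.

Lemma pow2_ge (t : R) : exists r, t <= (2 ^ r)%:R.
Proof.
exists (Num.bound `|t|); apply: le_trans (ler_norm t) _.
apply: le_trans (ltW (archi_boundP (normr_ge0 t))) _.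
by rewrite ler_nat ltnW // ltn_expl.
Qed.

(** Iterating the regularity absorbs the equivalence constants. *)
Lemma LRP_transfer : (forall m, 0 <= L m) -> LRP L -> LRP Phi.
Proof.
move=> L0 [b b0 hb].
have iter r m : (0 < m)%N -> (2 ^ r)%:R * L m <= L (b ^ r * m)%N.
  elim: r m => [|r IH] m m0; first by rewrite mul1r mul1n.
  rewrite !expnS natrM -mulrA -mulnA.
  apply: le_trans (hb _ _); last by rewrite muln_gt0 expn_gt0 b0.
  by rewrite ler_wpM2l // IH.
have [r hr] := pow2_ge (2 * c2 / c1).
exists (b ^ r)%N => [|m m0]; first by rewrite expn_gt0 b0.
have /andP[_ h1] := LPhi m; have /andP[h2 _] := LPhi (b ^ r * m)%N.
apply: le_trans h2; apply: (@le_trans _ _ (2 * (c2 * L m))); first by rewrite ler_wpM2l.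
rewrite ler_pdivrMr // in hr.
apply: (@le_trans _ _ (c1 * ((2 ^ r)%:R * L m))); last by rewrite ler_pM2l // iter.
by rewrite !mulrA ler_wpM2r // [c1 * _]mulrC.
Qed.

Lemma URP_transfer : (forall m, 0 <= L m) -> URP L -> URP Phi.
Proof.
move=> L0 [b b0 hb].
have iter r m : (0 < m)%N -> (2 ^ r)%:R * L (b ^ r * m)%N <= (b ^ r)%:R * L m.
  elim: r m => [|r IH] m m0; first by rewrite !mul1r mul1n.
  rewrite !expnS !natrM -mulnA.
  have m0' : (0 < b ^ r * m)%N by rewrite muln_gt0 expn_gt0 b0.
  apply: (@le_trans _ _ ((2 ^ r)%:R * (b%:R * L (b ^ r * m)%N))).
    by rewrite [2 * _]mulrC -mulrA ler_wpM2l // hb.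
  by rewrite mulrCA -mulrA ler_wpM2l // IH.
have [r hr] := pow2_ge (2 * c2 / c1).
exists (b ^ r)%N => [|m m0]; first by rewrite expn_gt0 b0.
have /andP[h1 _] := LPhi m; have /andP[_ h2] := LPhi (b ^ r * m)%N.
rewrite ler_pdivrMr // in hr.
have h3 := iter r m m0.
have bR : 0 <= (b ^ r)%:R :> R by exact: ler0n.
have h4 := ler_wpM2l bR h1.
have h5 := ler_wpM2r (L0 (b ^ r * m)%N) hr.
have h6 := ler_wpM2l (ltW c10) h3.
lra.
Qed.

End Regularity.

(** * Bounded biorthogonal systems built on a symmetric family *)

Section BoundedSystems.
Context {R : realType} {k : scalar_kind} {X : normedModType (scalar_field R k)}.
Local Notation K := (scalar_field R k).

Definition bounded_system (I : eqType) (y : I -> X) (ys : I -> X -> K^o) (D : R) :=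
  [/\ forall i, islin (ys i), forall i j, ys i (y j) = (i == j)%:R,
      forall i, rnorm (y i) <= D & forall i f, rabs (ys i f) <= D * rnorm f].

Variables (Phi : nat -> R) (C : R).
Hypotheses (qc : quasiconcave Phi) (C0 : 0 <= C).
Variables (e : nat -> X) (es : nat -> X -> K^o).
Hypothesis sf : sym_family e es Phi C.

Let pos m : (0 < m)%N -> 0 < Phi m.
Proof. by case: qc => _ h _ _; exact: h. Qed.

Let le_lin i : islin (es i). Proof. by case: sf. Qed.
Let biorth i j : es i (e j) = (i == j)%:R. Proof. by case: sf. Qed.

Lemma Phi_ratio_le m : (0 < m)%N -> Phi m / m%:R <= Phi 1%N.
Proof. by move=> m0; case: qc => _ _ _ h; have := h 1%N m; rewrite m0 divr1; apply. Qed.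

(** Exchange of the normalized indicator of N vectors with an additional
    vector r. Whatever the norm of the functional of r, the result is bounded
    once N exceeds that norm, because that functional only enters the N
    coordinate functionals divided by N. *)
Lemma exchange_system (r : X) (rs : X -> K^o) :
  rnorm r <= 1 -> bounded_functional rs -> r = 0 \/ rs r = 1 ->
  (forall i, es i r = 0) -> (forall i, rs (e i) = 0) ->
  exists (y : nat -> X) (ys : nat -> X -> K^o),
    [/\ bounded_system y ys (2 * Phi 1%N + 1 + (2 * (C / Phi 1%N) + 1 + C)),
        forall x, (forall i, es i x = 0) -> rs x = 0 -> forall i, ys i x = 0 &
        forall V, subspace V -> (forall i, V (y i)) <-> (forall i, V (e i)) /\ V r].
Proof.
move=> r1 [lrs [Q Q0 hQ]] alt esr rse.
have P1 : 0 <= Phi 1%N by exact/ltW/pos.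
have Cge0 := C0.
have CP1 : 0 <= C / Phi 1%N by rewrite divr_ge0.
case: alt => [r0|rsr].
  exists e, es; split=> // [|V sV].
    split=> // [i|i f].
      by have := sym_norm_le sf i; lra.
    apply: le_trans (sym_coord_le sf i f) _.
    by rewrite ler_wpM2r ?rnorm_ge0 //; lra.
  by split=> [Ve|[]//]; split=> //; rewrite r0; case: sV.
(* Q bounds the norm of rs. *)
pose N := (Num.bound Q).+1.
have QN : Q <= N%:R.
  by apply: le_trans (ltW (archi_boundP Q0)) _; rewrite ler_nat /N.
have N0 : (0 < N)%N by [].
have NR : 0 < N%:R :> R by rewrite ltr0n.
have PN := pos N0.
have KN : emb N%:R != 0 :> K by rewrite rmorph_nat pnatr_eq0.
have KP : emb (Phi N) != 0 :> K by rewrite -(rmorph0 (emb : R -> K)) (inj_eq emb_inj) gt_eqF.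
have us : uniq (index_iota 0 N) by exact: iota_uniq.
pose A := \sum_(i <- index_iota 0 N) e i.
pose As f : K := \sum_(i <- index_iota 0 N) es i f.
have lAs : islin As by exact: islin_bigsum.
have delta i : \sum_(j <- index_iota 0 N) (i == j)%:R = (i < N)%N%:R :> K.
  case: ltnP => iN.
    rewrite (bigD1_seq i) ?mem_index_iota //= eqxx big1 ?addr0 // => j.
    by rewrite eq_sym => /negPf ->.
  rewrite big_seq big1 // => j; rewrite mem_index_iota => /andP[_ jN].
  by rewrite gtn_eqF // (leq_trans jN).
have esA i : es i A = (i < N)%N%:R.
  by rewrite /A (islin_sum (le_lin i)) -delta; apply: eq_bigr => j _; rewrite biorth.
have Ase j : As (e j) = (j < N)%N%:R.
  by rewrite /As -delta; apply: eq_bigr => i _; rewrite biorth eq_sym.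
have AsA : As A = emb N%:R.
  rewrite /As; under eq_big_seq => i.
    rewrite mem_index_iota => /andP[_ iN]; rewrite esA iN; over.
  by rewrite big_const_nat subn0 iter_addr_0 rmorph_nat.
have Asr : As r = 0 by rewrite /As big1.
have rsA : rs A = 0 by rewrite /A (islin_sum lrs) big1.
pose y i := if i is i'.+1 then
  (if (i' < N)%N then e i' - emb N%:R^-1 *: A + r else e i') else emb (Phi N)^-1 *: A.
pose ys i f : K := if i is i'.+1 then
  (if (i' < N)%N then es i' f - emb N%:R^-1 * As f + emb N%:R^-1 * rs f else es i' f)
  else emb (Phi N / N%:R) * As f.
have A_norm : rnorm A <= Phi N.
  by have := sym_sum_le sf us; rewrite size_iota subn0.
have As_norm f : rabs (As f) <= C * rnorm f * (N%:R / Phi N).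
  by have := sym_coord_sum_le sf f us; rewrite size_iota subn0.
exists y, ys; split.
- split.
  + case=> [|i]; rewrite /ys; first exact: islin_scale.
    case: (i < N)%N; last exact: le_lin.
    apply: islin_add; last exact: islin_scale.
    by apply: islin_sub => //; exact: islin_scale.
  + have NV : emb N%:R^-1 * emb N%:R = 1 :> K by rewrite fmorphV mulVf.
    have PV : emb (Phi N)^-1 * emb (Phi N) = 1 :> K by rewrite fmorphV mulVf.
    have As_y j : As (y j.+1) = if (j < N)%N then 0 else (j < N)%N%:R.
      rewrite /y; case: ifP => jN; last by rewrite Ase jN.
      rewrite (islinD lAs) (islinB lAs) (islinZ lAs) AsA Ase jN Asr NV.
      by rewrite subrr addr0.
    have rs_y j : rs (y j.+1) = (j < N)%N%:R.
      rewrite /y; case: ifP => jN; last by rewrite rse.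
      by rewrite (islinD lrs) (islinB lrs) (islinZ lrs) rsA rse rsr mulr0 subrr add0r.
    case=> [|i]; case=> [|j].
    * rewrite /ys /y (islinZ lAs) AsA rmorphM /=; move: NV PV => NV PV.
      rewrite mulrACA mulrC [emb (Phi N) * _]mulrC PV mulrC mul1r NV //.
    * by rewrite /ys As_y; case: ifP => jN; rewrite ?jN /= mulr0.
    * rewrite /ys; case: ifP => iN; last by rewrite /y (islinZ (le_lin i)) esA iN mulr0.
      rewrite /y (islinZ (le_lin i)) (islinZ lAs) (islinZ lrs) esA iN AsA rsA.
      by rewrite !mulr0 addr0 mulr1 mulrCA NV mulr1 subrr.
    * rewrite /ys; case: ifP => iN; last first.
        rewrite /y; case: ifP => jN; last by rewrite biorth.
        rewrite (islinD (le_lin i)) (islinB (le_lin i)) (islinZ (le_lin i)) esA iN.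
        by rewrite mulr0 subr0 esr addr0 biorth.
      rewrite As_y rs_y /y; case: ifP => jN.
        rewrite (islinD (le_lin i)) (islinB (le_lin i)) (islinZ (le_lin i)) esA iN esr.
        by rewrite biorth addr0 mulr0 subr0 subrK.
      by rewrite subrK biorth.
  + have h1 : 0 <= 2 * (C / Phi 1%N) + 1 + C by lra.
    case=> [|i]; rewrite /y.
      rewrite rnormZ rabs_emb ger0_norm ?invr_ge0 ?(ltW PN) // mulrC.
      have : rnorm A / Phi N <= 1 by rewrite ler_pdivrMr // mul1r.
      lra.
    case: ifP => iN; last by have := sym_norm_le sf i; lra.
    apply: le_trans (rnormD _ _) _.
    have h2 := rnormB (e i) (emb N%:R^-1 *: A).
    have h3 := sym_norm_le sf i.
    have h4 : rnorm (emb N%:R^-1 *: A) <= Phi 1%N.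
      rewrite rnormZ rabs_emb ger0_norm ?invr_ge0 // mulrC.
      by apply: le_trans (Phi_ratio_le N0); rewrite ler_wpM2r // invr_ge0.
    lra.
  + move=> i f; have f0 := rnorm_ge0 f.
    have leD t : t <= 2 * (C / Phi 1%N) + 1 + C ->
        t * rnorm f <= (2 * Phi 1%N + 1 + (2 * (C / Phi 1%N) + 1 + C)) * rnorm f.
      by move=> ht; rewrite ler_wpM2r //; lra.
    case: i => [|i]; rewrite /ys.
      apply: le_trans (leD C _); last by lra.
      rewrite rabsM rabs_emb ger0_norm ?divr_ge0 ?(ltW PN) //.
      apply: le_trans (ler_wpM2l _ (As_norm f)) _; first by rewrite divr_ge0 ?(ltW PN).
      rewrite le_eqVlt; apply/orP; left; apply/eqP; field.
      by rewrite !gt_eqF.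
    case: ifP => iN.
      apply: le_trans (leD (C / Phi 1%N + C / Phi 1%N + 1) _); last by lra.
      apply: le_trans (rabsD _ _) _; rewrite mulrDl mul1r lerD //.
        apply: le_trans (rabsD _ _) _; rewrite rabsN mulrDl lerD //.
          exact: (sym_coord_le sf).
        rewrite rabsM rabs_emb ger0_norm ?invr_ge0 //.
        have iNR : 0 <= N%:R^-1 :> R by rewrite invr_ge0.
        apply: le_trans (ler_wpM2l iNR (As_norm f)) _.
        have -> : N%:R^-1 * (C * rnorm f * (N%:R / Phi N)) = C * rnorm f / Phi N.
          by field; rewrite !gt_eqF.
        rewrite mulrAC ler_wpM2r // ler_wpM2l // lef_pV2 ?posrE ?pos //.
        by case: qc => _ _ mono _; exact: mono.
      rewrite rabsM rabs_emb ger0_norm ?invr_ge0 // mulrC ler_pdivrMr //.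
      by apply: le_trans (hQ f) _; rewrite mulrC ler_wpM2l.
    apply: le_trans (leD (C / Phi 1%N) _); last by lra.
    exact: (sym_coord_le sf).
- move=> x ex rx [|i]; rewrite /ys /As.
    by rewrite big1 ?mulr0.
  by case: ifP; rewrite ?big1 ?ex ?rx // !mulr0 subr0 addr0.
- move=> V sV; split=> [Vy|[Ve Vr]].
    have VA : V A.
      have -> : A = emb (Phi N) *: y 0%N.
        by rewrite /y scalerA fmorphV divff // scale1r.
      exact: subspaceZ.
    have Vr : V r.
      have -> : r = emb N%:R^-1 *: \sum_(i <- index_iota 0 N) y i.+1.
        under eq_big_seq => i.
          rewrite mem_index_iota => /andP[_ iN]; rewrite /y iN; over.
        rewrite big_split big_split /= -/A sumrN !big_const_nat subn0 !iter_addr_0.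
        have NK : emb N%:R^-1 *+ N = 1 :> K.
          by rewrite -[LHS]mulr_natr fmorphV /= rmorph_nat mulVf // pnatr_eq0.
        by rewrite scalerMnl NK scale1r subrr add0r -scalerMnr scalerMnl NK scale1r.
      apply: subspaceZ => //; apply: subspace_sum => // i _; exact: Vy.
    split=> // i; have := Vy i.+1; rewrite /y; case: ifP => // iN Vyi.
    have -> : e i = (e i - emb N%:R^-1 *: A + r) - r + emb N%:R^-1 *: A.
      by rewrite addrK subrK.
    apply: subspaceD => //; first exact: subspaceB.
    exact: subspaceZ.
  have VA : V A by apply: subspace_sum => // i _; exact: Ve.
  case=> [|i]; rewrite /y; first exact: subspaceZ.
  case: ifP => iN; last exact: Ve.
  by apply: subspaceD => //; apply: subspaceB => //; exact: subspaceZ.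
Qed.

End BoundedSystems.

Section Halves.
Context {R : realType} {k : scalar_kind}.
Local Notation K := (scalar_field R k).

Definition half_block (j : nat) : seq nat :=
  index_iota (2 ^ j).-1 ((2 ^ j).-1 + 2 ^ j.-1).

(** The block 0 is a singleton, and its only sign is +. *)
Definition half_sign (n : nat) : K :=
  if n \in half_block (block_of n) then 1 else -1.

Lemma half_sign_sqr n : half_sign n * half_sign n = 1.
Proof. by rewrite /half_sign; case: ifP => _; rewrite ?mulrNN mulr1. Qed.

Lemma rabs_half_sign n : rabs (half_sign n) = 1.
Proof. by rewrite /half_sign; case: ifP => _; rewrite ?rabsN rabs1. Qed.

Lemma block_halves j : (0 < j)%N -> block j =
  half_block j ++ index_iota ((2 ^ j).-1 + 2 ^ j.-1) (2 ^ j.+1).-1.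
Proof.
case: j => // j _; rewrite /block /half_block /= /index_iota.
have h : ((2 ^ j.+2).-1 - (2 ^ j.+1).-1 = 2 ^ j + ((2 ^ j.+2).-1 - ((2 ^ j.+1).-1 + 2 ^ j)))%N.
  by rewrite !expnS; have := expn_gt0 2 j; lia.
by rewrite h iotaD addKn.
Qed.

Lemma half_blockP j n : (0 < j)%N -> n \in half_block j -> block_of n = j.
Proof.
move=> j0 nj; apply/eqP; rewrite -mem_block block_halves // mem_cat nj.
by [].
Qed.

Lemma sum_half_sign (V : lmodType K) (F : nat -> V) j : (0 < j)%N ->
  \sum_(n <- block j) half_sign n *: F n =
  (\sum_(n <- half_block j) F n) *+ 2 - \sum_(n <- block j) F n.
Proof.
move=> j0; set s2 := index_iota ((2 ^ j).-1 + 2 ^ j.-1) (2 ^ j.+1).-1.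
have bE : block j = half_block j ++ s2 by exact: block_halves.
have -> : \sum_(n <- block j) half_sign n *: F n =
    \sum_(n <- half_block j) F n - \sum_(n <- s2) F n.
  rewrite bE big_cat -sumrN /=; congr (_ + _); rewrite big_seq [RHS]big_seq;
    apply: eq_bigr => n nh.
    by rewrite /half_sign (half_blockP j0 nh) nh scale1r.
  have nb : block_of n = j by apply/eqP; rewrite -mem_block bE mem_cat nh orbT.
  rewrite /half_sign nb; case: ifPn => [|_]; last by rewrite scaleN1r.
  move: nh; rewrite !mem_index_iota => /andP[h1 _] /andP[_].
  by rewrite ltnNge h1.
by rewrite bE big_cat /= mulr2n opprD addrA addrK.
Qed.

Lemma sum_half_sign0 j : \sum_(n <- block j) half_sign n = (j == 0%N)%:R.
Proof.
have [->|j0] := posnP j.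
  by rewrite /block /index_iota /= big_cons big_nil addr0 /half_sign.
have := @sum_half_sign K^o (fun=> 1) j j0.
under eq_bigr do rewrite -[_ *: _]/(_ * _) mulr1.
move=> ->; rewrite !big_const_seq !count_predT !iter_addr_0 size_block size_iota.
rewrite addKn -mulrnA -{2}(prednK j0) expnSr subrr //.
Qed.

End Halves.

Section ConditionalSystem.
Context {R : realType} {k : scalar_kind} {X : normedModType (scalar_field R k)}.
Local Notation K := (scalar_field R k).
Variables (Phi : nat -> R) (C : R).
Hypotheses (qc : quasiconcave Phi) (C0 : 0 <= C).
Variables (e : nat -> X) (es : nat -> X -> K^o).
Hypothesis sf : sym_family e es Phi C.

Local Notation sgn := (@half_sign R k).

Let pos m : (0 < m)%N -> 0 < Phi m.
Proof. by case: qc => _ h _ _; exact: h. Qed.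

Let le_lin i : islin (es i). Proof. by case: sf. Qed.
Let biorth i j : es i (e j) = (i == j)%:R. Proof. by case: sf. Qed.

(** On each block of size J the family is stretched by the factor J / Phi(J)
    along the indicator of the block, and shrunk by 1 / Phi(J) along the vector
    of signs: the sum of the new vectors has norm of order J, their signed sum
    is bounded, and all vectors and functionals stay bounded. *)
Lemma conditional_system : exists (y : nat -> X) (ys : nat -> X -> K^o) (D : R),
  [/\ bounded_system y ys D,
      forall x, (forall i, es i x = 0) -> forall i, ys i x = 0,
      forall V, subspace V -> (forall i, V (y i)) <-> (forall i, V (e i)) &
      forall j, (0 < j)%N -> rnorm (\sum_(n <- block j) sgn n *: y n) <= 1 /\
        (2 ^ j)%:R <= C * (2 * rnorm (\sum_(n <- half_block j) y n) + 1)].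
Proof.
have Cge0 := C0.
have P1 : 0 < Phi 1%N by exact: pos.
have J0 j : 0 < (2 ^ j)%:R :> R by rewrite ltr0n expn_gt0.
have PJ0 j : 0 < Phi (2 ^ j)%N by rewrite pos // expn_gt0.
(* The vectors are stretched by a along u and by b along v, and the functionals
   by the inverse factors: 1 + p J = a and 1 + p' J = 1 / a for blocks of size J,
   and likewise for q, q' and b. On the singleton block 0, where u and v are
   proportional, nothing is changed. *)
pose a j : R := if j == 0%N then 1 else (2 ^ j)%:R / Phi (2 ^ j)%N.
pose b j : R := if j == 0%N then 1 else (Phi (2 ^ j)%N)^-1.
have a0 j : 0 < a j by rewrite /a; case: eqP => // _; rewrite divr_gt0.
have b0 j : 0 < b j by rewrite /b; case: eqP => // _; rewrite invr_gt0.
pose p j : R := (a j - 1) / (2 ^ j)%:R.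
pose q j : R := (b j - 1) / (2 ^ j)%:R.
pose p' j : R := ((a j)^-1 - 1) / (2 ^ j)%:R.
pose q' j : R := ((b j)^-1 - 1) / (2 ^ j)%:R.
pose u j := \sum_(n <- block j) e n.
pose v j := \sum_(n <- block j) sgn n *: e n.
pose us j f : K := \sum_(n <- block j) es n f.
pose vs j f : K := \sum_(n <- block j) sgn n * es n f.
have lus j : islin (us j) by exact: islin_bigsum.
have lvs j : islin (vs j) by apply: islin_bigsum => i; exact: islin_scale.
pose z j : K := \sum_(n <- block j) sgn n.
have zE j : z j = (j == 0%N)%:R by exact: sum_half_sign0.
have pz0 j (t : R) : (j = 0%N -> t = 0) -> emb t * z j = 0.
  rewrite zE; case: eqP => [j0 /(_ j0) ->|_ _]; last by rewrite mulr0.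
  by rewrite rmorph0 mul0r.
have pz j : emb (p j) * z j = 0.
  by apply: pz0 => ->; rewrite /p /a eqxx subrr mul0r.
have qz j : emb (q j) * z j = 0.
  by apply: pz0 => ->; rewrite /q /b eqxx subrr mul0r.
have delta m j (c : nat -> K) : \sum_(n <- block j) c n * (m == n)%:R =
    (block_of m == j)%:R * c m.
  rewrite -mem_block; have [mj|mj] := boolP (m \in block j).
    rewrite (bigD1_seq m) ?uniq_block //= eqxx mulr1 mul1r big1 ?addr0 // => n.
    by rewrite eq_sym => /negPf ->; rewrite mulr0.
  rewrite mul0r big_seq big1 // => n nj; case: eqP => [mn|]; last by rewrite mulr0.
  by rewrite mn nj in mj.
have es_u m j : es m (u j) = (block_of m == j)%:R.
  rewrite /u (islin_sum (le_lin m)) -[RHS]mulr1 -(delta m j (fun=> 1)).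
  by apply: eq_bigr => n _; rewrite biorth mul1r.
have es_v m j : es m (v j) = (block_of m == j)%:R * sgn m.
  rewrite /v (islin_sum (le_lin m)) -(delta m j sgn).
  by apply: eq_bigr => n _; rewrite (islinZ (le_lin m)) biorth.
have us_e i n : us i (e n) = (block_of n == i)%:R.
  rewrite /us -[RHS]mulr1 -(delta n i (fun=> 1)).
  by apply: eq_bigr => m _; rewrite biorth mul1r eq_sym.
have vs_e i n : vs i (e n) = (block_of n == i)%:R * sgn n.
  rewrite /vs -(delta n i sgn).
  by apply: eq_bigr => m _; rewrite biorth eq_sym.
have cst j (c : K) : \sum_(n <- block j) c = emb (2 ^ j)%:R * c.
  by rewrite big_const_seq count_predT iter_addr_0 size_block rmorph_nat mulr_natl.
have us_u i j : us i (u j) = (i == j)%:R * emb (2 ^ j)%:R.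
  rewrite /us; under eq_big_seq => n do
    (rewrite mem_block => /eqP ni; rewrite es_u ni; over).
  by rewrite cst mulrC; case: eqP => [->|]; rewrite ?mul0r.
have us_v i j : us i (v j) = (i == j)%:R * z j.
  rewrite /us; under eq_big_seq => n do
    (rewrite mem_block => /eqP ni; rewrite es_v ni; over).
  by rewrite -mulr_sumr; case: eqP => [->|]; rewrite ?mul0r.
have vs_u i j : vs i (u j) = (i == j)%:R * z j.
  rewrite /vs; under eq_big_seq => n do
    (rewrite mem_block => /eqP ni; rewrite es_u ni; over).
  by rewrite -mulr_suml mulrC; case: eqP => [->|]; rewrite ?mul0r.
have vs_v i j : vs i (v j) = (i == j)%:R * emb (2 ^ j)%:R.
  rewrite /vs; under eq_big_seq => n do
    (rewrite mem_block => /eqP ni; rewrite es_v ni mulrCA half_sign_sqr mulr1; over).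
  by rewrite cst mulrC; case: eqP => [->|]; rewrite ?mul0r.
pose y n := let j := block_of n in e n + emb (p j) *: u j + (emb (q j) * sgn n) *: v j.
pose ys n f : K := let j := block_of n in
  es n f + emb (p' j) * us j f + emb (q' j) * sgn n * vs j f.
have un j : rnorm (u j) <= Phi (2 ^ j)%N.
  by have := sym_sum_le sf (uniq_block j); rewrite size_block.
have vn j : rnorm (v j) <= Phi (2 ^ j)%N.
  case: sf => _ _ E1 _; have := E1 _ _ (uniq_block j) rabs_half_sign.
  by rewrite size_block.
have usn j f : rabs (us j f) <= C * rnorm f * ((2 ^ j)%:R / Phi (2 ^ j)%N).
  by have := sym_coord_sum_le sf f (uniq_block j); rewrite size_block.
have vsn j f : rabs (vs j f) <= C * rnorm f * ((2 ^ j)%:R / Phi (2 ^ j)%N).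
  case: sf => _ _ _ E2; have := E2 _ f (uniq_block j); rewrite size_block.
  apply: le_trans; apply: le_trans (rabs_sum _ _ _) _.
  by apply: ler_sum => n _; rewrite rabsM rabs_half_sign mul1r.
have pe j : p j + p' j + p' j * p j * (2 ^ j)%:R = 0.
  by rewrite /p /p'; field; rewrite !gt_eqF.
have qe j : q j + q' j + q' j * q j * (2 ^ j)%:R = 0.
  by rewrite /q /q'; field; rewrite !gt_eqF.
have pa j : 1 + p j * (2 ^ j)%:R = a j by rewrite /p divfK ?gt_eqF // subrKC.
have qb j : 1 + q j * (2 ^ j)%:R = b j by rewrite /q divfK ?gt_eqF // subrKC.
have sum_y j : \sum_(n <- block j) y n = emb (a j) *: u j.
  rewrite /y; under eq_big_seq => n do
    (rewrite mem_block => /eqP ni; rewrite ni; over).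
  rewrite !big_split /= -/(u j) -[X in _ + X]scaler_suml -mulr_sumr -/(z j) qz scale0r addr0.
  rewrite -pa rmorphD rmorph1 scalerDl scale1r; congr (_ + _).
  rewrite big_const_seq count_predT iter_addr_0 size_block -scaler_nat scalerA.
  by rewrite rmorphM /= rmorph_nat mulrC.
have sum_sy j : \sum_(n <- block j) sgn n *: y n = emb (b j) *: v j.
  rewrite /y; under eq_big_seq => n do
    (rewrite mem_block => /eqP ni; rewrite ni !scalerDr !scalerA
      [sgn n * (_ * _)]mulrCA half_sign_sqr mulr1; over).
  rewrite !big_split /= -/(v j) -[X in _ + X + _]scaler_suml -mulr_suml -/(z j).
  rewrite mulrC pz scale0r addr0.
  rewrite -qb rmorphD rmorph1 scalerDl scale1r; congr (_ + _).
  rewrite big_const_seq count_predT iter_addr_0 size_block -scaler_nat scalerA.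
  by rewrite rmorphM /= rmorph_nat mulrC.
pose D := (Phi 1%N + 2 * (1 + Phi 1%N)) + (C / Phi 1%N + 2 * (C * (1 + (Phi 1%N)^-1))).
have CP : 0 <= C / Phi 1%N by rewrite divr_ge0 // ltW.
have CP' : 0 <= C * (1 + (Phi 1%N)^-1) by rewrite mulr_ge0 // addr_ge0 // invr_ge0 ltW.
have PJle j : Phi (2 ^ j)%N / (2 ^ j)%:R <= Phi 1%N.
  by apply: Phi_ratio_le => //; rewrite expn_gt0.
have Jinv j : (2 ^ j)%:R^-1 <= 1 :> R by rewrite invf_le1 // ler1n expn_gt0.
have Pinv j : (Phi (2 ^ j)%N)^-1 <= (Phi 1%N)^-1.
  rewrite lef_pV2 ?posrE //; case: qc => _ _ mono _; apply: mono.
  by rewrite expn_gt0.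
have pP j : `|p j| * Phi (2 ^ j)%N <= 1 + Phi 1%N.
  rewrite /p /a; case: eqP => [->|_].
    by rewrite subrr mul0r normr0 mul0r addr_ge0 // ltW.
  rewrite normrM [X in _ * X * _]gtr0_norm ?invr_gt0 //.
  apply: (@le_trans _ _ (((2 ^ j)%:R / Phi (2 ^ j)%N + 1) / (2 ^ j)%:R * Phi (2 ^ j)%N)).
    rewrite ler_wpM2r ?(ltW (PJ0 j)) // ler_wpM2r ?invr_ge0 //.
    apply: le_trans (ler_normB _ _) _.
    by rewrite normr1 lerD2r ger0_norm // divr_ge0 // ltW.
  have -> : ((2 ^ j)%:R / Phi (2 ^ j)%N + 1) / (2 ^ j)%:R * Phi (2 ^ j)%N =
      1 + Phi (2 ^ j)%N / (2 ^ j)%:R by field; rewrite !gt_eqF.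
  by rewrite lerD2l.
have qP j : `|q j| * Phi (2 ^ j)%N <= 1 + Phi 1%N.
  rewrite /q /b; case: eqP => [->|_].
    by rewrite subrr mul0r normr0 mul0r addr_ge0 // ltW.
  rewrite normrM [X in _ * X * _]gtr0_norm ?invr_gt0 //.
  apply: (@le_trans _ _ (((Phi (2 ^ j)%N)^-1 + 1) / (2 ^ j)%:R * Phi (2 ^ j)%N)).
    rewrite ler_wpM2r ?(ltW (PJ0 j)) // ler_wpM2r ?invr_ge0 //.
    apply: le_trans (ler_normB _ _) _.
    by rewrite normr1 lerD2r ger0_norm // invr_ge0 ltW.
  have -> : ((Phi (2 ^ j)%N)^-1 + 1) / (2 ^ j)%:R * Phi (2 ^ j)%N =
      (2 ^ j)%:R^-1 + Phi (2 ^ j)%N / (2 ^ j)%:R by field; rewrite !gt_eqF.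
  by rewrite lerD.
have pP' j : `|p' j| * ((2 ^ j)%:R / Phi (2 ^ j)%N) <= 1 + (Phi 1%N)^-1.
  rewrite /p' /a; case: eqP => [->|_].
    by rewrite invr1 subrr mul0r normr0 mul0r addr_ge0 // invr_ge0 ltW.
  rewrite normrM [X in _ * X * _]gtr0_norm ?invr_gt0 //.
  apply: (@le_trans _ _ ((Phi (2 ^ j)%N / (2 ^ j)%:R + 1) / (2 ^ j)%:R *
      ((2 ^ j)%:R / Phi (2 ^ j)%N))).
    rewrite ler_wpM2r ?divr_ge0 ?(ltW (PJ0 j)) // ler_wpM2r ?invr_ge0 //.
    apply: le_trans (ler_normB _ _) _.
    by rewrite normr1 lerD2r invf_div ger0_norm // divr_ge0 // ltW.
  have -> : (Phi (2 ^ j)%N / (2 ^ j)%:R + 1) / (2 ^ j)%:R *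
      ((2 ^ j)%:R / Phi (2 ^ j)%N) = (2 ^ j)%:R^-1 + (Phi (2 ^ j)%N)^-1.
    by field; rewrite !gt_eqF.
  by rewrite lerD.
have qP' j : `|q' j| * ((2 ^ j)%:R / Phi (2 ^ j)%N) <= 1 + (Phi 1%N)^-1.
  rewrite /q' /b; case: eqP => [->|_].
    by rewrite invr1 subrr mul0r normr0 mul0r addr_ge0 // invr_ge0 ltW.
  rewrite normrM [X in _ * X * _]gtr0_norm ?invr_gt0 //.
  apply: (@le_trans _ _ ((Phi (2 ^ j)%N + 1) / (2 ^ j)%:R *
      ((2 ^ j)%:R / Phi (2 ^ j)%N))).
    rewrite ler_wpM2r ?divr_ge0 ?(ltW (PJ0 j)) // ler_wpM2r ?invr_ge0 //.
    apply: le_trans (ler_normB _ _) _.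
    by rewrite normr1 lerD2r invrK ger0_norm // ltW.
  have -> : (Phi (2 ^ j)%N + 1) / (2 ^ j)%:R *
      ((2 ^ j)%:R / Phi (2 ^ j)%N) = 1 + (Phi (2 ^ j)%N)^-1.
    by field; rewrite !gt_eqF.
  by rewrite lerD.
exists y, ys, D; split.
- split.
  + move=> n; apply: islin_add; last exact: islin_scale.
    by apply: islin_add => //; exact: islin_scale.
  + move=> m n; rewrite /ys /y; set i := block_of m; set j := block_of n.
    rewrite !(islinD (le_lin m)) !(islinZ (le_lin m)) es_u es_v biorth.
    rewrite !(islinD (lus i)) !(islinZ (lus i)) us_e us_u us_v.
    rewrite !(islinD (lvs i)) !(islinZ (lvs i)) vs_e vs_u vs_v -/i -/j.
    rewrite [j == i]eq_sym; have [ij|ij] := eqVneq i j; last first.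
      by rewrite !mul0r !mulr0 !addr0 !mulr0 !addr0.
    rewrite ij !mul1r.
    have e1 : emb (p j) + emb (p' j) + emb (p' j) * emb (p j) * emb (2 ^ j)%:R = 0 :> K.
      by rewrite -!rmorphM -!rmorphD /= pe rmorph0.
    have e2 : emb (q j) + emb (q' j) + emb (q' j) * emb (q j) * emb (2 ^ j)%:R = 0 :> K.
      by rewrite -!rmorphM -!rmorphD /= qe rmorph0.
    rewrite -[RHS]addr0 -[X in _ = _ + X](addr0 (0 : K)) -[X in _ = _ + (X + _)]e1.
    rewrite -[X in _ = _ + (_ + X)](mulr0 (sgn m * sgn n)) -[X in _ = _ + (_ + _ * X)]e2.
    have pz' := pz j; have qz' := qz j.
    have -> : emb (q j) * sgn n * z j = 0 by rewrite mulrAC qz' mul0r.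
    have -> : emb (p j) * z j = 0 by [].
    by rewrite -[true%:R]/(1 : K); ring.
  + move=> n; rewrite /y; set j := block_of n.
    have h1 := sym_norm_le sf n.
    have h2 : rnorm (emb (p j) *: u j) <= 1 + Phi 1%N.
      rewrite rnormZ rabs_emb; apply: le_trans (pP j).
      by rewrite ler_wpM2l.
    have h3 : rnorm ((emb (q j) * sgn n) *: v j) <= 1 + Phi 1%N.
      rewrite rnormZ rabsM rabs_half_sign mulr1 rabs_emb; apply: le_trans (qP j).
      by rewrite ler_wpM2l.
    have h4 := rnormD (e n + emb (p j) *: u j) ((emb (q j) * sgn n) *: v j).
    have h5 := rnormD (e n) (emb (p j) *: u j).
    rewrite /D; lra.
  + move=> n f; rewrite /ys; set j := block_of n.
    have f0 := rnorm_ge0 f.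
    have h1 := sym_coord_le sf n f.
    have Cf : 0 <= C * rnorm f by rewrite mulr_ge0.
    have h2 : rabs (emb (p' j) * us j f) <= C * rnorm f * (1 + (Phi 1%N)^-1).
      rewrite rabsM rabs_emb; apply: le_trans (ler_wpM2l (normr_ge0 _) (usn j f)) _.
      by rewrite mulrCA ler_wpM2l.
    have h3 : rabs (emb (q' j) * sgn n * vs j f) <= C * rnorm f * (1 + (Phi 1%N)^-1).
      rewrite !rabsM rabs_half_sign mulr1 rabs_emb.
      apply: le_trans (ler_wpM2l (normr_ge0 _) (vsn j f)) _.
      by rewrite mulrCA ler_wpM2l.
    have h4 := rabsD (es n f + emb (p' j) * us j f) (emb (q' j) * sgn n * vs j f).
    have h5 := rabsD (es n f) (emb (p' j) * us j f).
    have h6 : 0 <= (Phi 1%N + 2 * (1 + Phi 1%N)) * rnorm f.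
      by rewrite mulr_ge0 //; lra.
    rewrite /D mulrDl; lra.
- move=> x ex n; rewrite /ys /us /vs ex add0r !big1 ?mulr0 ?addr0 // => m _.
  by rewrite ex mulr0.
- move=> V sV; split=> [Vy|Ve] n.
    have Vu j : V (u j).
      have -> : u j = emb (a j)^-1 *: \sum_(n <- block j) y n.
        by rewrite sum_y scalerA -rmorphM /= mulVf ?gt_eqF // rmorph1 scale1r.
      by apply: subspaceZ => //; apply: subspace_sum => // m _; exact: Vy.
    have Vv j : V (v j).
      have -> : v j = emb (b j)^-1 *: \sum_(n <- block j) sgn n *: y n.
        by rewrite sum_sy scalerA -rmorphM /= mulVf ?gt_eqF // rmorph1 scale1r.
      apply: subspaceZ => //; apply: subspace_sum => // m _.
      by apply: subspaceZ => //; exact: Vy.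
    have -> : e n = y n - (emb (q (block_of n)) * sgn n) *: v (block_of n) -
        emb (p (block_of n)) *: u (block_of n) by rewrite /y addrK addrK.
    by do 2 (apply: subspaceB => //; last exact: subspaceZ); exact: Vy.
  have Vu j : V (u j) by apply: subspace_sum => // m _; exact: Ve.
  have Vv j : V (v j).
    by apply: subspace_sum => // m _; apply: subspaceZ => //; exact: Ve.
  rewrite /y; apply: subspaceD => //; last exact: subspaceZ.
  by apply: subspaceD => //; exact: subspaceZ.
- move=> j j0; have jN : (j == 0%N) = false by rewrite eqn0Ngt j0.
  have h1 : rnorm (\sum_(n <- block j) sgn n *: y n) <= 1.
    rewrite sum_sy rnormZ rabs_emb gtr0_norm // /b jN mulrC ler_pdivrMr //.
    by rewrite mul1r.
  split=> //.
  have h2 : (2 ^ j)%:R <= C * rnorm (\sum_(n <- block j) y n).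
    rewrite sum_y rnormZ rabs_emb gtr0_norm // /a jN mulrCA mulrAC ler_pdivlMr //.
    rewrite ler_wpM2l //; have := sym_sum_ge qc C0 sf (uniq_block j).
    by rewrite size_block.
  apply: le_trans h2 _; rewrite ler_wpM2l //.
  have := sum_half_sign y j0; set w := \sum_(n <- half_block j) y n => hs.
  have -> : \sum_(n <- block j) y n = emb 2 *: w - \sum_(n <- block j) sgn n *: y n.
    by rewrite hs opprB addrCA rmorph_nat scaler_nat subrr addr0.
  apply: le_trans (rnormB _ _) _; rewrite rnormZ rabs_emb ger0_norm //.
  by rewrite lerD2l.
Qed.

End ConditionalSystem.

(** * From biorthogonal systems to bases *)

Section Spans.
Context {R : realType} {k : scalar_kind} {X : normedModType (scalar_field R k)}.
Local Notation K := (scalar_field R k).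

Lemma sum_uniq_extend (I : eqType) (s t : seq I) (F : I -> X) :
  uniq s -> uniq t -> {subset s <= t} ->
  \sum_(n <- s) F n = \sum_(n <- t) (if n \in s then F n else 0).
Proof.
move=> us ut st; rewrite -big_mkcond -[RHS]big_filter; apply: perm_big.
apply: uniq_perm => //; first exact: filter_uniq.
by move=> n; rewrite mem_filter; case: (boolP (n \in s)) => // /st ->.
Qed.

Lemma closed_span_subspace (x : nat -> X) I : subspace (closed_span x I).
Proof.
split.
  apply: subset_closure; exists fset0, (fun=> 0); split=> [n //|].
  by rewrite big_seq_fset0.
move=> c f g /closure_rnormP hf /closure_rnormP hg; apply/closure_rnormP => d d0.
have c1 : 0 < rabs c + 1 by rewrite ltr_wpDl // rabs_ge0.
have [|f' [A [a [AI fE]]] hf'] := hf (d / (2 * (rabs c + 1))).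
  by rewrite divr_gt0 // mulr_gt0.
have [|g' [B [b [BI gE]]] hg'] := hg (d / 2); first by rewrite divr_gt0.
exists (c *: f' + g').
  exists (A `|` B)%fset,
    (fun n => c * (if n \in A then a n else 0) + (if n \in B then b n else 0)).
  split=> [n /=|]; first by rewrite inE => /orP[/AI|/BI].
  rewrite fE gE (sum_uniq_extend _ (fset_uniq A) (fset_uniq (A `|` B)%fset)); last first.
    by move=> n nA; rewrite inE nA.
  rewrite [X in _ + X](sum_uniq_extend _ (fset_uniq B) (fset_uniq (A `|` B)%fset)); last first.
    by move=> n nA; rewrite inE nA orbT.
  rewrite scaler_sumr -big_split /=; apply: eq_bigr => n _.
  rewrite scalerDl -scalerA; congr (_ + _); first by case: ifP; rewrite ?scale0r.
  by case: ifP; rewrite ?scale0r.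
have -> : c *: f + g - (c *: f' + g') = c *: (f - f') + (g - g').
  by rewrite scalerBr opprD addrACA.
apply: le_lt_trans (rnormD _ _) _; rewrite rnormZ.
have : rabs c * rnorm (f - f') <= (rabs c + 1) * rnorm (f - f').
  by rewrite ler_wpM2r ?rnorm_ge0 // lerDl.
have : (rabs c + 1) * rnorm (f - f') < d / 2.
  rewrite mulrC -ltr_pdivlMr //; apply: lt_le_trans hf' _.
  by rewrite invfM mulrA.
lra.
Qed.

Lemma closed_span_rclosed (x : nat -> X) I : rclosed (closed_span x I).
Proof.
move=> f hf; apply: (@closed_closure _ _ f); exact/closure_rnormP.
Qed.

Lemma mem_closed_span (x : nat -> X) (I : set nat) n : I n -> closed_span x I (x n).
Proof.
move=> In; apply: subset_closure; exists [fset n]%fset, (fun=> 1); split.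
  by move=> j /=; rewrite inE => /eqP ->.
by rewrite big_seq_fset1 scale1r.
Qed.

End Spans.

Section BasisOfSystem.
Context {R : realType} {k : scalar_kind} {X : completeNormedModType (scalar_field R k)}.
Local Notation K := (scalar_field R k).

Lemma basis_of_biorthogonal (x : nat -> X) (xs : nat -> X -> K^o) :
  (forall n, bounded_functional (xs n)) ->
  (forall i j, xs i (x j) = (i == j)%:R) ->
  (forall V, subspace V -> rclosed V -> (forall n, V (x n)) -> forall f, V f) ->
  exists B : biorth_basis X, (forall n, bvec B n = x n) /\
    forall n f, bcoord B n f = xs n f.
Proof.
move=> bxs xsx dense.
have hl n : linear (xs n : X -> K^o).
  by case: (bxs n) => lxs _ a u v; exact: lxs.
pose L n : {linear X -> K^o} :=
  HB.pack (xs n : X -> K^o) (GRing.isLinear.Build _ _ _ _ (xs n) (hl n)).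
have cL n : continuous (L n).
  case: (bxs n) => _ [C _ hC].
  exact: (@rnorm_bounded_continuous R k X K^o (L n) C hC).
have bL n j : L n (x j) = (j == n)%:R by rewrite eq_sym -xsx.
have tot : closed_span x setT = setT.
  apply/seteqP; split=> // f _; apply: dense => [||n].
  - exact: closed_span_subspace.
  - exact: closed_span_rclosed.
  - exact: mem_closed_span.
by exists (BiorthBasis cL bL tot).
Qed.

Variables (Phi : nat -> R) (C D : R).
Hypotheses (qc : quasiconcave Phi) (C0 : 0 <= C) (D0 : 0 <= D).
Variables (e : nat -> X) (es : nat -> X -> K^o).
Hypothesis sf : sym_family e es Phi C.
Variables (y : nat -> X) (ys : nat -> X -> K^o).
Hypothesis bs : bounded_system y ys D.
Hypothesis ys_osc : forall j n, ys j (osc e n) = 0.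
Hypothesis oscs_y : forall n j, oscs es n (y j) = 0.
Hypothesis dense : forall V : set X, subspace V -> rclosed V ->
  (forall n, V (osc e n)) -> (forall j, V (y j)) -> forall f, V f.

Local Notation x := (dkk Phi e y).
Local Notation xs := (dkks Phi es ys).

Let ys_lin j : islin (ys j). Proof. by case: bs. Qed.
Let ys_y i j : ys i (y j) = (i == j)%:R. Proof. by case: bs. Qed.
Let y_norm j : rnorm (y j) <= D. Proof. by case: bs. Qed.
Let ys_norm j f : rabs (ys j f) <= D * rnorm f. Proof. by case: bs. Qed.

Lemma y_dkk j : y j = emb (Phi (2 ^ j)%N)^-1 *: \sum_(n <- block j) x n.
Proof.
rewrite sum_dkk_block scalerA embV_neq0 ?scale1r // gt_eqF //.
exact: Phi_pow_gt0.
Qed.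

(** The block sums recover the y_j, and then the oscillations of e. *)
Lemma dkk_basis : exists B : biorth_basis X, (forall n, bvec B n = x n) /\
  forall n f, bcoord B n f = xs n f.
Proof.
apply: basis_of_biorthogonal => [n|i j|V sV cV Vx].
- split; first exact: (dkks_lin sf ys_lin n).
  exists (C / Phi 1%N + 2 * (C + D) / Phi n.+1).
    have P0 m : 0 <= Phi m by exact: qc_ge0.
    by rewrite addr_ge0 // divr_ge0 // mulr_ge0 // addr_ge0.
  move=> f; apply: le_trans (dkks_near qc C0 D0 sf ys_norm n f) _.
  by have := sym_coord_le sf n f; lra.
- exact: (dkks_dkk qc sf).
- have Vy j : V (y j).
    rewrite y_dkk; apply: subspaceZ => //; exact: subspace_sum.
  apply: dense => // n.
  have -> : osc e n = x n - emb (Phi (2 ^ block_of n)%N / blkw (block_of n)) *: y (block_of n).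
    by rewrite /dkk addrK.
  by apply: subspaceB => //; exact: subspaceZ.
Qed.

Lemma dkks_y n j : xs n (y j) = emb (Phi (2 ^ j)%N)^-1 * (block_of n == j)%:R.
Proof.
by rewrite /dkks oscs_y add0r ys_y; case: eqP => [->|]; rewrite ?mulr0.
Qed.

Variable B : biorth_basis X.
Hypothesis B_vec : forall n, bvec B n = x n.
Hypothesis B_coord : forall n f, bcoord B n f = xs n f.

Let mono m n : (m <= n)%N -> Phi m <= Phi n.
Proof. by case: qc => _ _ h _; exact: h. Qed.

(** The witnesses of conditionality: with the signs + on the first half of the
    block of conditional vectors and - on the second half, the coordinates are
    decreasing in modulus, so that the first half is a greedy set. *)
Lemma dkk_conditional (Cc : R) : 0 <= Cc ->
  (forall j, (0 < j)%N ->
    rnorm (\sum_(n <- block j) @half_sign R k n *: y n.*2) <= 1 /\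
    (2 ^ j)%:R <= Cc * (2 * rnorm (\sum_(n <- half_block j) y n.*2) + 1)) ->
  exists c D : R, [/\ 0 < c, 0 <= D & forall l : nat,
    exists (f : X) (A : {fset nat}),
    [/\ greedy_set B f A, closed_span (bvec B) `I_(2 ^ 2 ^ (l + 4)) f,
        rnorm f <= D & c * (2 ^ l)%:R <= rnorm (coord_proj B [set` A] f) + D]].
Proof.
move=> Cc0 hc; exists (2 * (Cc + 1))^-1, 1; split=> //.
  by rewrite invr_gt0 mulr_gt0 // ltr_wpDl.
move=> l; have [hf hw] := hc l.+1 isT.
pose f := \sum_(n <- block l.+1) @half_sign R k n *: y n.*2.
pose L := flatten [seq block n.*2 | n <- half_block l.+1].
have dbl_inj : injective double by exact: double_inj.
have memL i : i \in L -> exists2 n, n \in half_block l.+1 & block_of i = n.*2.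
  move=> /flattenP[_ /mapP[n nh ->]]; rewrite mem_block => /eqP ->.
  by exists n.
have Lmem i n : n \in half_block l.+1 -> block_of i = n.*2 -> i \in L.
  move=> nh bi; apply/flattenP; exists (block n.*2); first exact: map_f.
  by rewrite mem_block bi.
have uL : uniq L.
  rewrite /L; have : uniq (half_block l.+1) by exact: iota_uniq.
  elim: (half_block l.+1) => //= n s IH /andP[ns us].
  rewrite cat_uniq uniq_block IH // andbT; apply/hasPn => i.
  move=> /flattenP[_ /mapP[n' ns' ->]]; rewrite !mem_block => /eqP ->.
  by apply/eqP => /dbl_inj nn; rewrite -nn ns' in ns.
pose A := [fset i in L]%fset.
have memA i : (i \in A) = (i \in L) by rewrite inE.
have coordf i : bcoord B i f =
    \sum_(n <- block l.+1) @half_sign R k n * (emb (Phi (2 ^ n.*2)%N)^-1 * (block_of i == n.*2)%:R).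
  rewrite B_coord (islin_sum (dkks_lin sf ys_lin i)); apply: eq_bigr => n _.
  by rewrite (islinZ (dkks_lin sf ys_lin i)) dkks_y.
have coord_in i n : n \in block l.+1 -> block_of i = n.*2 ->
    bcoord B i f = @half_sign R k n * emb (Phi (2 ^ n.*2)%N)^-1.
  move=> nb bi; rewrite coordf (bigD1_seq n) ?uniq_block //= bi eqxx mulr1.
  rewrite big1 ?addr0 // => n' nn; rewrite (inj_eq dbl_inj) eq_sym (negPf nn).
  by rewrite !mulr0.
have coord_out i : (forall n, n \in block l.+1 -> block_of i <> n.*2) ->
    bcoord B i f = 0.
  move=> h; rewrite coordf big_seq big1 // => n /h /eqP /negPf ->.
  by rewrite !mulr0.
have half_sub n : n \in half_block l.+1 -> n \in block l.+1.
  by rewrite block_halves // mem_cat => ->.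
have rcoord i n : n \in block l.+1 -> block_of i = n.*2 ->
    rabs (bcoord B i f) = (Phi (2 ^ n.*2)%N)^-1.
  move=> nb bi; rewrite (coord_in i n) // rabsM rabs_half_sign mul1r rabs_emb.
  by rewrite ger0_norm // invr_ge0 qc_ge0.
exists f, A; split=> //.
- move=> i j; rewrite !memA => /memL[n nh bi] jL; rewrite -rabs_le.
  rewrite (rcoord i n (half_sub _ nh) bi).
  have [[n' nb bj]|nj] := pselect (exists2 n', n' \in block l.+1 & block_of j = n'.*2).
    rewrite (rcoord j n' nb bj) lef_pV2 ?posrE; try exact: (Phi_pow_gt0 qc).
    apply: mono; rewrite leq_exp2l // leq_double.
    (* Here n' lies in the second half, hence after n. *)
    have n'h : n' \notin half_block l.+1 by apply: contra jL => h; exact: Lmem bj.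
    move: nh n'h nb; rewrite !mem_index_iota; clear; lia.
  rewrite coord_out ?rabs0 ?invr_ge0 ?qc_ge0 // => n' nb bj.
  by apply: nj; exists n'.
- have sV := closed_span_subspace (bvec B) `I_(2 ^ 2 ^ (l + 4)).
  apply: (subspace_sum sV) => n; rewrite mem_index_iota => /andP[_ nl].
  apply: (subspaceZ _ sV); rewrite y_dkk; apply: (subspaceZ _ sV).
  apply: (subspace_sum sV) => i; rewrite mem_index_iota => /andP[_ il].
  rewrite -B_vec; apply: mem_closed_span => /=.
  apply: (@leq_trans (2 ^ n.*2.+1)); first by apply: leq_trans il (leq_pred _).
  rewrite leq_exp2l //; have -> : (l + 4 = l.+2.+2)%N by rewrite !addnS addn0.
  move: nl; rewrite !expnS; have := expn_gt0 2 l; clear; lia.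
have projE : coord_proj B [set` A] f = \sum_(n <- half_block l.+1) y n.*2.
  rewrite /coord_proj -fsbig_seq ?fset_uniq //.
  have pA : perm_eq A L.
    by apply: uniq_perm; rewrite ?fset_uniq // => i; rewrite memA.
  rewrite (perm_big _ pA) /= /L big_flatten /= big_map.
  rewrite big_seq [RHS]big_seq; apply: eq_bigr => n nh.
  rewrite y_dkk scaler_sumr big_seq [RHS]big_seq; apply: eq_bigr => i.
  rewrite mem_block => /eqP bi; rewrite (coord_in i n (half_sub _ nh) bi) B_vec.
  by rewrite /half_sign (half_blockP (isT : 0 < l.+1)%N nh) nh mul1r.
rewrite projE mulrC ler_pdivrMr ?mulr_gt0 ?ltr_wpDl //.
set w := rnorm _ in hw *.
have w0 : 0 <= w by exact: rnorm_ge0.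
have h1 : (2 ^ l)%:R <= (2 ^ l.+1)%:R :> R by rewrite ler_nat leq_exp2l.
have := mulr_ge0 Cc0 w0; lra.
Qed.

End BasisOfSystem.

(** * A bounded system for the rest of the space *)

Section RemainderSystem.
Context {R : realType} {k : scalar_kind} {X : normedModType (scalar_field R k)}.
Local Notation K := (scalar_field R k).

Lemma separable_sequence : separable X ->
  exists d : nat -> X, forall x (r : R), 0 < r -> exists n, rnorm (x - d n) < r.
Proof.
move=> [D cD dD].
have near x (r : R) : 0 < r -> exists2 y, D y & rnorm (x - y) < r.
  move=> r0; have [||y [xy Dy]] := dD (ball x (emb r)).
  - exists x; apply: ballxx.
    by rewrite -(rmorph0 (emb : R -> K)) ltr_emb.
  - exact: ball_open.
  by exists y => //; move: xy; rewrite -ball_normE /= -emb_rnorm ltr_emb.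
have /pfcard_geP[D0|[g]] := cD.
  by have [y] := near 0 1 ltr01; rewrite D0.
exists g => x r /(near x) [y Dy xy].
by have [n _ gn] := @surj _ _ _ _ g y Dy; exists n; rewrite gn.
Qed.

Lemma pairing : exists (b : nat * nat -> nat) (g : nat -> nat * nat),
  cancel b g /\ cancel g b.
Proof.
have /pcard_eqP[f] := card_nat2.
have := @bij _ _ _ _ f; rewrite setTT_bijective => -[g fg gf].
by exists f, g.
Qed.

(** The symmetric family is split according to the residues modulo 3. *)
Lemma mod3_ind (V : nat -> Prop) : (forall n, V (3 * n)%N) ->
  (forall n, V (3 * n + 1)%N) -> (forall n, V (3 * n + 2)%N) -> forall n, V n.
Proof.
move=> V0 V1 V2 n; rewrite (divn_eq n 3) [(_ * 3)%N]mulnC.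
have : (n %% 3 < 3)%N by rewrite ltn_pmod.
case: (n %% 3)%N => [|[|[|//]]] _; by rewrite ?addn0.
Qed.

Lemma osc_ker (g : X -> K^o) (e : nat -> X) n : islin g -> (forall i, g (e i) = 0) ->
  g (osc e n) = 0.
Proof.
move=> lg ge; rewrite /osc /eavg (islinB lg) (islinZ lg) (islin_sum lg) ge.
by rewrite big1 ?mulr0 ?subr0.
Qed.

Lemma oscs_ker (es : nat -> X -> K^o) x n : (forall i, es i x = 0) -> oscs es n x = 0.
Proof. by move=> ex; rewrite /oscs /savg ex big1 ?mulr0 ?subr0. Qed.

Variables (Phi : nat -> R) (C : R).
Hypotheses (qc : quasiconcave Phi) (C0 : 0 <= C).
Variables (E : nat -> X) (Es : nat -> X -> K^o).
Hypothesis sf : sym_family E Es Phi C.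
Variables (P : {linear X -> X}) (DP : R).
Hypotheses (DP0 : 0 <= DP) (hP : forall x, rnorm (P x) <= DP * rnorm x).
Hypotheses (idP : forall x, P (P x) = P x) (PE : forall n, P (E n) = E n).
Hypothesis Es_ker : forall n x, P x = 0 -> Es n x = 0.
Hypothesis rangeP : forall V : set X, subspace V -> rclosed V ->
  (forall n, V (E n)) -> forall x, V (P x).
Hypothesis sepX : separable X.

Let Es_lin n : islin (Es n). Proof. by case: sf. Qed.
Let Es_E i j : Es i (E j) = (i == j)%:R. Proof. by case: sf. Qed.
Let e0 n := E (3 * n)%N.
Let es0 n := Es (3 * n)%N.

(** A sequence spanning, together with the oscillations of e0, the vectors e0
    and a complement of the whole symmetric family: the normalized block sums
    of e0 at even indices, a biorthogonalized dense sequence of the kernel of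
    the projection at odd ones. *)
Lemma remainder_sequence : exists (r : nat -> X) (rs : nat -> X -> K^o),
  [/\ forall m, rnorm (r m) <= 1 /\ bounded_functional (rs m),
      forall m, r m = 0 \/ rs m (r m) = 1,
      forall i j, i != j -> rs i (r j) = 0,
      (forall n m, (forall i, n <> 3 * i)%N -> Es n (r m) = 0 /\ rs m (E n) = 0) /\
      (forall n m, rs m (osc e0 n) = 0 /\ oscs es0 n (r m) = 0) &
      forall V : set X, subspace V -> rclosed V -> (forall n, V (osc e0 n)) ->
        (forall m, V (r m)) ->
        (forall n, V (e0 n)) /\ ((forall n, V (E n)) -> forall x, V x)].
Proof.
have sf0 : sym_family e0 es0 Phi C.
  apply: (sym_family_inj (h := fun n => 3 * n)%N) sf => i j /eqP.
  by rewrite eqn_pmul2l // => /eqP.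
have [d hd] := separable_sequence sepX.
have [z [zs [bz nz alt zz span]]] := gram_schmidt (fun n => d n - P (d n)).
pose zp m x := zs m (x - P x).
have sP : subspace [set x | P x = 0].
  split=> /= [|a x y Px Py]; first by rewrite linear0.
  by rewrite linearP Px Py scaler0 addr0.
have Pz m : P (z m) = 0.
  by apply: ((span _ sP).2 _ m) => n /=; rewrite linearB idP subrr.
have zpz i j : zp i (z j) = zs i (z j) by rewrite /zp Pz subr0.
have lzs m : islin (zs m) by case: (bz m).
have zpE m n : zp m (E n) = 0 by rewrite /zp PE subrr islin0.
have bzp m : bounded_functional (zp m).
  split=> [a x y|].
    rewrite /zp -lzs; congr (zs m _).
    by rewrite linearP scalerBr opprD addrACA.
  case: (bz m) => _ [Q Q0 hQ]; exists (Q * (1 + DP)); first by rewrite mulr_ge0 // addr_ge0.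
  move=> x; apply: le_trans (hQ _) _; rewrite -mulrA ler_wpM2l // mulrDl mul1r.
  by apply: le_trans (rnormB _ _) _; rewrite lerD2l.
have Esz n m : Es n (z m) = 0 by exact: Es_ker.
pose u j := emb (blkw j / Phi (2 ^ j)%N) *: eavg e0 j.
pose us j (x : X) : K := emb (Phi (2 ^ j)%N) * savg es0 j x.
have PJ j : 0 < Phi (2 ^ j)%N by exact: (Phi_pow_gt0 qc).
have uE j : u j = emb (Phi (2 ^ j)%N)^-1 *: \sum_(i <- block j) e0 i.
  rewrite /u /eavg scalerA -rmorphM /= mulrAC divff ?mul1r // gt_eqF //.
  exact: blkw_gt0.
have nu j : rnorm (u j) <= 1.
  rewrite uE rnormZ rabs_emb gtr0_norm ?invr_gt0 // mulrC ler_pdivrMr // mul1r.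
  by have := sym_sum_le sf0 (uniq_block j); rewrite size_block.
have bus j : bounded_functional (us j).
  split; first by apply: islin_scale; exact: (savg_lin sf0).
  exists C => // x; rewrite rabsM rabs_emb gtr0_norm //.
  have := savg_norm sf0 j x; rewrite mulrAC ler_pdivlMr // mulrC.
  by [].
have us_u i j : us i (u j) = (i == j)%:R.
  rewrite /us /u (islinZ (savg_lin sf0 i)) (savg_eavg sf0).
  case: eqP => [->|]; last by rewrite !mulr0.
  rewrite mulr1 -!rmorphM /= -(rmorph1 (emb : R -> K)); congr emb.
  by field; rewrite !gt_eqF // blkw_gt0.
have lus j : islin (us j) by case: (bus j).
have us_z i j : us i (z j) = 0 by rewrite /us /savg big1 ?mulr0 // => n _; exact: Esz.
have zp_u i j : zp i (u j) = 0.
  have lz : islin (zp i) by case: (bzp i).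
  rewrite uE (islinZ lz) (islin_sum lz) big1 ?mulr0 // => n _; exact: zpE.
pose r m := if odd m then z m./2 else u m./2.
pose rs m := if odd m then zp m./2 else us m./2.
exists r, rs; split.
- by move=> m; rewrite /r /rs; case: odd.
- by move=> m; rewrite /r /rs; case: odd; [rewrite zpz | right; rewrite us_u eqxx].
- move=> i j ij; rewrite /r /rs.
  have hij : odd i = odd j -> i./2 != j./2.
    move=> oij; apply: contra ij => /eqP hij; apply/eqP.
    by rewrite -(odd_double_half i) -(odd_double_half j) oij hij.
  case: (boolP (odd i)) hij => oi; case: (boolP (odd j)) => oj hij //.
  + by rewrite zpz zz // hij.
  + by rewrite us_u (negPf (hij erefl)).
- split=> [n m hn|n m].
    rewrite /r /rs; case: odd; first by rewrite Esz zpE.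
    split.
      rewrite uE (islinZ (Es_lin n)) (islin_sum (Es_lin n)) big1 ?mulr0 // => i _.
      by rewrite /e0 Es_E; case: eqP => // /hn.
    rewrite /us /savg big1 ?mulr0 // => i _.
    by rewrite /es0 Es_E; case: eqP => // /esym /hn.
  rewrite /r /rs; case: odd.
    split; last by apply: oscs_ker => i; exact: Esz.
    by apply: osc_ker => // [|i]; [case: (bzp m./2) | exact: zpE].
  split; first by rewrite /us (savg_osc sf0) mulr0.
  by rewrite /u (islinZ (oscs_lin sf0 n)) (oscs_eavg sf0) mulr0.
- move=> V sV cV Vosc Vr.
  have Vu j : V (u j) by have := Vr j.*2; rewrite /r odd_double doubleK.
  have Vz j : V (z j) by have := Vr j.*2.+1; rewrite /r /= odd_double uphalf_double.
  split=> [n|VE x].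
    have -> : e0 n = osc e0 n + emb (Phi (2 ^ block_of n)%N / blkw (block_of n)) *: u (block_of n).
      rewrite /u scalerA -rmorphM /=.
      have -> : Phi (2 ^ block_of n)%N / blkw (block_of n) *
          (blkw (block_of n) / Phi (2 ^ block_of n)%N) = 1.
        by field; rewrite !gt_eqF // blkw_gt0.
      by rewrite rmorph1 scale1r subrK.
    by apply: subspaceD => //; exact: subspaceZ.
  apply: (cV x) => t /(hd x) [n xn]; exists (d n) => //.
  have -> : d n = (d n - P (d n)) + P (d n) by rewrite subrK.
  by apply: subspaceD => //; [exact: ((span _ sV).1 Vz n) | exact: (rangeP sV cV VE)].
Qed.

(** The bounded system completing the oscillations of e0: conditional vectors
    built on the second third of the family at even indices; at odd indices, the
    rows of the last third, each exchanged with one vector of the remainder. *)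
Lemma remainder_system : exists (y : nat -> X) (ys : nat -> X -> K^o) (D : R),
  [/\ 0 <= D, bounded_system y ys D,
      (forall j n, ys j (osc e0 n) = 0) /\ (forall n j, oscs es0 n (y j) = 0),
      forall V : set X, subspace V -> rclosed V -> (forall n, V (osc e0 n)) ->
        (forall j, V (y j)) -> forall x, V x &
      forall j, (0 < j)%N ->
        rnorm (\sum_(n <- block j) @half_sign R k n *: y n.*2) <= 1 /\
        (2 ^ j)%:R <= C * (2 * rnorm (\sum_(n <- half_block j) y n.*2) + 1)].
Proof.
have [b [g [bg gb]]] := pairing.
have [r [rs [rb ralt rr [rE rosc] rspan]]] := remainder_sequence.
pose e1 n := E (3 * n + 1)%N; pose es1 n := Es (3 * n + 1)%N.
pose er m i := E (3 * b (m, i) + 2)%N; pose esr m i := Es (3 * b (m, i) + 2)%N.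
have sf1 : sym_family e1 es1 Phi C.
  by apply: (sym_family_inj (h := fun n => 3 * n + 1)%N) sf => i j; lia.
have sfr m : sym_family (er m) (esr m) Phi C.
  apply: (sym_family_inj (h := fun i => 3 * b (m, i) + 2)%N) sf => i j h.
  have : b (m, i) = b (m, j) by lia.
  by move=> /(can_inj bg) [].
have n1 n : (forall i, 3 * n + 1 <> 3 * i)%N by lia.
have nr p : (forall i, 3 * b p + 2 <> 3 * i)%N by lia.
have [yc [ysc [D1 [bc kerc spanc condc]]]] := conditional_system qc C0 sf1.
pose D2 := 2 * Phi 1%N + 1 + (2 * (C / Phi 1%N) + 1 + C).
have rowP m : exists yz : (nat -> X) * (nat -> X -> K^o),
    [/\ bounded_system yz.1 yz.2 D2,
      forall x, (forall i, esr m i x = 0) -> rs m x = 0 -> forall i, yz.2 i x = 0 &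
      forall V, subspace V -> (forall i, V (yz.1 i)) <->
        (forall i, V (er m i)) /\ V (r m)].
  have [h1 h2] := rb m.
  have [||y [ys hy]] := exchange_system qc C0 (sfr m) h1 h2 (ralt m).
  - by move=> i; case: (rE _ m (nr (m, i))).
  - by move=> i; case: (rE _ m (nr (m, i))).
  by exists (y, ys).
have /choice[row hrow] := rowP.
pose yr m i := (row m).1 i; pose ysr m i := (row m).2 i.
pose y j := if odd j then yr (g j./2).1 (g j./2).2 else yc j./2.
pose ys j := if odd j then ysr (g j./2).1 (g j./2).2 else ysc j./2.
have Dpos : 0 <= D1.
  by case: bc => _ _ h _; apply: le_trans (h 0%N); exact: rnorm_ge0.
have D2pos : 0 <= D2.
  by case: (hrow 0%N) => -[_ _ h _] _ _; apply: le_trans (h 0%N); exact: rnorm_ge0.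
(* A functional vanishing on the generators vanishes on the new vectors. *)
have ker_yc (f : X -> K^o) : islin f -> (forall i, f (e1 i) = 0) ->
    forall i, f (yc i) = 0.
  by move=> lf fe; apply/(spanc _ (subspace_ker lf)).2.
have ker_yr m (f : X -> K^o) : islin f -> (forall i, f (er m i) = 0) -> f (r m) = 0 ->
    forall i, f (yr m i) = 0.
  by move=> lf fe fr; case: (hrow m) => _ _ h; apply/(h _ (subspace_ker lf)).2.
have Es_neq n m : n != m -> Es n (E m) = 0 by move=> /negPf nm; rewrite Es_E nm.
have lrs m : islin (rs m) by case: (rb m) => _ [].
have Es1_yr n m i : es1 n (yr m i) = 0.
  apply: (ker_yr _ _ (Es_lin _)) => [j|]; first by apply: Es_neq; apply/eqP; lia.
  by case: (rE _ m (n1 n)).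
have Esr_yc m i n : esr m i (yc n) = 0.
  by apply: (ker_yc _ (Es_lin _)) => j; apply: Es_neq; apply/eqP; lia.
have Esr_yr m i m' j : m != m' -> esr m i (yr m' j) = 0.
  move=> mm; apply: (ker_yr _ _ (Es_lin _)) => [l|]; last by case: (rE _ m' (nr (m, i))).
  apply: Es_neq; apply: contra mm => /eqP h.
  move: h => /addIn /eqP; rewrite eqn_pmul2l // => /eqP /(can_inj bg) [-> _].
  by [].
have rs_yc m n : rs m (yc n) = 0.
  by apply: (ker_yc _ (lrs m)) => j; case: (rE _ m (n1 j)).
have rs_yr m m' j : m != m' -> rs m (yr m' j) = 0.
  move=> mm; apply: (ker_yr _ _ (lrs m)) => [l|]; last exact: rr.
  by case: (rE _ m (nr (m', l))).
have ysr_ker m x : (forall i, esr m i x = 0) -> rs m x = 0 -> forall i, ysr m i x = 0.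
  by case: (hrow m) => _ h _; exact: h.
have Es_osc l n : (forall i, l <> 3 * i)%N -> Es l (osc e0 n) = 0.
  move=> hl; apply: (osc_ker _ (Es_lin l)) => i; apply: Es_neq; apply/eqP; exact: hl.
have les0 n : islin (oscs es0 n).
  apply: islin_sub; first exact: Es_lin.
  by rewrite /savg; apply/islin_scale/islin_bigsum => i; exact: Es_lin.
have oscs_E l n : (forall i, l <> 3 * i)%N -> oscs es0 n (E l) = 0.
  move=> hl; apply: oscs_ker => i; apply: Es_neq; apply/eqP => h; exact: hl (esym h).
exists y, ys, (D1 + D2); split.
- exact: addr_ge0.
- split.
  + move=> j; rewrite /ys; case: odd; last by case: bc.
    by case: (hrow (g j./2).1) => -[h _ _ _] _ _; exact: h.
  + move=> i j; have half_eq : odd i = odd j -> (i == j) = (i./2 == j./2).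
      move=> oij; apply/eqP/eqP => [->//|h].
      by rewrite -(odd_double_half i) -(odd_double_half j) oij h.
    have odd_neq : odd i != odd j -> (i == j) = false.
      by move=> h; apply/eqP => ij; rewrite ij eqxx in h.
    rewrite /ys /y; case: (boolP (odd i)) half_eq odd_neq => oi;
      case: (boolP (odd j)) => oj /= half_eq odd_neq.
    * rewrite half_eq //; have [gm|gm] := eqVneq (g i./2).1 (g j./2).1.
        have -> : (i./2 == j./2) = ((g i./2).2 == (g j./2).2).
          rewrite -(inj_eq (can_inj gb)) -pair_eqE /pair_eq gm eqxx.
          by [].
        rewrite gm; case: (hrow (g j./2).1) => -[_ h _ _] _ _; exact: h.
      rewrite ysr_ker => [|l|]; [|exact: Esr_yr|exact: rs_yr].
      case: eqP => // h; by rewrite h eqxx in gm.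
    * by rewrite odd_neq // ysr_ker.
    * by rewrite odd_neq // kerc.
    * by rewrite half_eq //; case: bc.
  + move=> j; rewrite /y; case: odd.
      case: (hrow (g j./2).1) => -[_ _ h _] _ _.
      by apply: le_trans (h _) _; rewrite lerDr.
    by case: bc => _ _ h _; apply: le_trans (h _) _; rewrite lerDl.
  + move=> j f; have f0 := rnorm_ge0 f; rewrite /ys; case: odd.
      case: (hrow (g j./2).1) => -[_ _ _ h] _ _.
      by apply: le_trans (h _ _) _; rewrite ler_wpM2r // lerDr.
    by case: bc => _ _ _ h; apply: le_trans (h _ _) _; rewrite ler_wpM2r // lerDl.
- split=> [j n|n j].
    rewrite /ys; case: odd.
      by apply: ysr_ker => [i|]; [exact: Es_osc | case: (rosc n (g j./2).1)].
    by apply: kerc => i; exact: Es_osc.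
  rewrite /y; case: odd.
    apply: (ker_yr _ _ (les0 n)) => [i|]; first exact: oscs_E.
    by case: (rosc n (g j./2).1).
  by apply: (ker_yc _ (les0 n)) => i; exact: oscs_E.
- move=> V sV cV Vosc Vy x.
  have Vc i : V (yc i) by have := Vy i.*2; rewrite /y odd_double doubleK.
  have Vr m i : V (yr m i).
    have := Vy (b (m, i)).*2.+1; rewrite /y /= odd_double /= uphalf_double bg.
    by [].
  have Vrow m : (forall i, V (er m i)) /\ V (r m).
    by case: (hrow m) => _ _ h; apply/(h _ sV); exact: Vr.
  have [Ve0 Vall] := rspan V sV cV Vosc (fun m => (Vrow m).2).
  apply: Vall; apply: mod3_ind => // n; first exact: ((spanc _ sV).1 Vc n).
  by have := (Vrow (g n).1).1 (g n).2; rewrite /er -surjective_pairing gb.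
- move=> j j0; have [h1 h2] := condc j j0; split.
    by under eq_bigr do rewrite /y odd_double doubleK.
  by under eq_bigr do rewrite /y odd_double doubleK.
Qed.

End RemainderSystem.

(** * The main theorem *)

Lemma fundamental_ge0 (R : realType) (k : scalar_kind) (S : sequence_space R k) m :
  0 <= fundamental S m.
Proof. by apply/ss_norm_ge0/ss_c00/indicator_c00. Qed.

Lemma equivalent_scale (R : realType) (u : nat -> \bar R) (Phi L : nat -> R) (c1 c2 : R) :
  0 < c1 -> 0 < c2 -> (forall m, c1 * L m <= Phi m <= c2 * L m) ->
  equivalent u (fun m => (Phi m)%:E) -> equivalent u (fun m => (L m)%:E).
Proof.
move=> c10 c20 hL [[A A0 hA] [B B0 hB]]; split.
  exists (A * c2); first exact: mulr_gt0.
  move=> m m0; apply: le_trans (hA m m0) _; rewrite -!EFinM lee_fin -mulrA ler_pM2l //.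
  by have /andP[] := hL m.
exists (c1^-1 * B); first by rewrite mulr_gt0 // invr_gt0.
move=> m m0; rewrite EFinM -muleA.
apply: (@le_trans _ _ ((c1^-1)%:E * (Phi m)%:E)%E).
  by rewrite -EFinM lee_fin ler_pdivlMl //; have /andP[] := hL m.
by apply: lee_wpmul2l; [rewrite lee_fin invr_ge0 ltW | exact: hB].
Qed.

Theorem theorem5p4 (R : realType) (k : scalar_kind)
    (X : completeNormedModType (scalar_field R k))
    (S : sequence_space R k) :
  separable X ->
  symmetric_space S ->
  complemented_subspace S X ->
  LRP (fundamental S) ->
  exists B : biorth_basis X,
    [/\ squeeze_symmetric B,
        URP (fundamental S) -> bidemocratic B,
        equivalent (uncond_parameter B) (fun m => (ln (1 + m%:R))%:E),
        equivalent (phi_u B) (fun m => (fundamental S m)%:E) &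
        ~ quasi_greedy B].
Proof.
move=> sepX symS compS lrp.
have [Phi [C [c1 [c2 [E [Es [P [DP [qc C0 sf [c10 c20 hL] hPP]]]]]]]]] :=
  complemented_sym_family symS compS.
have [DP0 hP idP PE [kerE rangeP]] := hPP.
have L0 := fundamental_ge0 S.
have [b b0 hb] := LRP_transfer c10 hL L0 lrp.
have hW := hardy_sum qc b0 hb.
have CW0 : 0 <= 2 * b%:R :> R by rewrite mulr_ge0.
have [y [ys [D [D0 bs [ys_osc oscs_y] dense cond]]]] :=
  remainder_system qc C0 sf DP0 hP idP PE kerE rangeP sepX.
have sf0 : sym_family (fun n => E (3 * n)%N) (fun n => Es (3 * n)%N) Phi C.
  apply: (sym_family_inj (h := fun n => 3 * n)%N) sf => i j /eqP.
  by rewrite eqn_pmul2l // => /eqP.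
have [B [Bv Bc]] := dkk_basis qc C0 D0 sf0 bs ys_osc oscs_y dense.
pose C1 := 1 + 2 * (1 + D) * (2 * b%:R + 1).
pose C2 := 2 * C + 4 * (C + D).
have C10 : 0 <= C1 by rewrite addr_ge0 // !mulr_ge0 // addr_ge0.
have C20 : 0 <= C2 by rewrite addr_ge0 // mulr_ge0 // addr_ge0.
have [_ _ y_norm ys_norm] := bs.
have dem (s : seq nat) (eps : nat -> scalar_field R k) : uniq s ->
    (forall n, rabs (eps n) = 1) ->
    rnorm (\sum_(n <- s) eps n *: bvec B n) <= C1 * Phi (size s).
  move=> us e1; under eq_bigr do rewrite Bv.
  exact: (dkk_democracy qc D0 hW sf0 y_norm).
have wk f : gauge_le (weak_val Phi) (fun n => bcoord B n f) (C2 * rnorm f).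
  have -> : (fun n => bcoord B n f) = (fun n => dkks Phi (fun n => Es (3 * n)%N) ys n f).
    by apply/funext => n; exact: Bc.
  exact: (dkk_weak qc C0 D0 sf0 ys_norm).
have condB := dkk_conditional qc sf0 bs oscs_y Bv Bc C0 cond.
exists B; split.
- exact: (sandwich_squeeze_symmetric qc CW0 C10 C20 hW dem wk).
- move=> /(URP_transfer c10 hL L0) [b' b'0 hb'].
  have hV := hardy_sum_dual qc b'0 hb'.
  by apply: (sandwich_bidemocratic qc C10 C20 dem wk _ hV); rewrite mulr_ge0.
- split; first exact: (sandwich_uncond_le qc C10 C20 dem wk).
  exact: (sandwich_le_uncond qc C20 wk condB).
- apply: equivalent_scale c10 c20 hL _.
  exact: (sandwich_phi_u qc C10 C20 dem wk).
- exact: (sandwich_not_quasi_greedy condB).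
Qed.
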